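(* Let $\alpha_0\in[0,1)$. Assume: (i) for every $p>1$, $\sup_{t\in[0,T]}\|\sigma_t\|_p<\infty$ and there is a constant $C(p)$ with $\|\widetilde\sigma_t-\widetilde\sigma_s\|_p\le C(p)|t-s|^{1/2}$ for all $s,t\in[0,T]$; (ii) $\sup_{t\in[0,T]}\|b_t\|_p<\infty$ for every $p>1$; (iii) $\sigma_t\neq0$ a.s. for every $t\in[0,T]$, and $\sup_{t\in[0,T]}\|\sigma_t^{-1}\|_p<\infty$ for every $p>1$. For $c_0\in(0,1)$ and $B>0$, suppose that $\kappa_n\sim Bn^{c_0}$ as $n\to\infty$. Then for every $p>1$, $$\sup_{n\in\mathbb N}\ \sup_{j\in I_n}\ \sup_{k\in I_{n,j}}\ n^{\gamma_*}\Big\|1_{\{j\in\mathcal L_n^c\}}\big(\mathbb L_{n,j}(\alpha_0)-\sigma_{t_k}^2\big)\Big\|_p<\infty$$ for any constant $\gamma_*$ satisfying $\gamma_*<\min\big\{\tfrac12(1-c_0),\tfrac12c_0\big\}$.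
   Context: Setting. Fix $T>0$ and a filtered probability space $(\Omega,\mathcal F,P)$ with filtration $(\mathcal F_t)_{t\in[0,T]}$; $\|\cdot\|_p$ is the $L^p(P)$-norm. $X_t=X_0+\int_0^tb_s\,ds+\int_0^t\sigma_s\,dw_s+J_t$, $t\in[0,T]$, is a real semimartingale, where $X_0$ is $\mathcal F_0$-measurable, $b$ and $\sigma$ are càdlàg adapted processes, $w$ is a standard Wiener process with respect to the filtration, and $J_t=\sum_{s\in(0,t]}\Delta J_s$ is finitely active, i.e. $\sum_{t\in[0,T]}1_{\{\Delta J_t\ne0\}}<\infty$ a.s. Put $t_j=jT/n$, $I_n=\{1,\dots,n\}$, $\Delta_jU=U_{t_j}-U_{t_{j-1}}$. Jumps. $N_t=\sum_{s\in(0,t]}1_{\{\Delta J_s\ne0\}}$, $J^\sigma_t=\sum_{s\in(0,t]}\Delta\sigma_s$, $\widetilde\sigma=\sigma-J^\sigma$, $N^\sigma_t=\sum_{s\in(0,t]}1_{\{\Delta J^\sigma_s\ne0\}}$, with $N^\sigma_T<\infty$ a.s., $\overline N=N+N^\sigma$. For an interval $A$, $\overline N(A)$ is the number of points of $\overline N$ in $A$. Local windows. $\kappa_n$ are nonnegative integers with $2\kappa_n+1\le n$, $\overline\kappa_n=2\kappa_n+1$. Set $\underline j_n=1$ if $j\le\kappa_n$, $\underline j_n=j-\kappa_n$ if $\kappa_n+1\le j\le n-\kappa_n$, $\underline j_n=n-2\kappa_n$ if $j\ge n-\kappa_n+1$. $I_{n,j}=\{\underline j_n,\underline j_n+1,\dots,\underline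 j_n+2\kappa_n\}$, $\mathtt I_{n,j}=(t_{\underline j_n-1},t_{\underline j_n+2\kappa_n}]$, $\mathcal L_n=\{j\in I_n:\overline N(\mathtt I_{n,j})\ne0\}$, $\mathcal L_n^c=I_n\setminus\mathcal L_n$. Local-global realized volatility. $\mathcal K_{n,j}(\alpha_0)$ is the set of $k\in I_{n,j}$ such that the rank (in increasing order) of $|\Delta_kX|$ among $\{|\Delta_{k'}X|\}_{k'\in I_{n,j}}$ is at most $(1-\alpha_0)\overline\kappa_n$. $K_{n,k}=1_{\{|\Delta_kX|\le n^{-1/4}\}}$. For $\zeta\sim N(0,1)$, $c(\alpha)$ is defined by $P[\zeta^2\le c(\alpha)]=1-\alpha$ (with $c(0)=+\infty$), and $q(\alpha)=E[\zeta^21_{\{|\zeta|\le c(\alpha)^{1/2}\}}]$. Then $$\mathbb L_{n,j}(\alpha_0)=\frac{n}{\overline\kappa_nT}\sum_{k\in\mathcal K_{n,j}(\alpha_0)}q(\alpha_0)^{-1}|\Delta_kX|^2K_{n,k}.$$ *)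

(* Defs.v *)
From HB Require Import structures.
From mathcomp Require Import all_boot all_order all_algebra.
From mathcomp Require Import all_classical all_reals all_analysis.

Set Implicit Arguments.
Unset Strict Implicit.
Unset Printing Implicit Defensive.

Import Order.TTheory GRing.Theory Num.Theory.
Import numFieldNormedType.Exports.

Local Open Scope classical_set_scope.
Local Open Scope ring_scope.

Section paths.
Context {R : realType}.
Implicit Types (f : R -> R) (T s t : R) (A : set R).

(* Processes are functions on all of R, but only their values on [0, T] are
   ever constrained or used; right limits are taken at t < T and left limits
   at t > 0. *)
Definition cadlag_path T f : Prop :=
  (forall t : R, 0 <= t < T -> f x @[x --> t^'+] --> f t) /\
  (forall t : R, 0 < t <= T -> cvg (f x @[x --> t^'-])).

Definition jump f s : R := f s - lim (f x @[x --> s^'-]).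

(* Number of jumps in A (+oo if there are infinitely many). *)
Definition njumps f A : \bar R := counting (A `&` [set s | jump f s != 0]).

(* Sum of the jumps over (0, t].  The finitely supported sum is the genuine
   one when there are finitely many jumps, and 0 by convention otherwise. *)
Definition jump_part f t : R := \sum_(s \in `]0, t]) jump f s.

End paths.

Section stochastic_processes.
Context {R : realType} {d : measure_display} {Omega : measurableType d}.
Variables (P : probability Omega R) (T : R).

Definition cvg_in_prob (Y : nat -> Omega -> R) (Z : Omega -> R) : Prop :=
  forall e : R, 0 < e ->
    P [set omega | e <= `|Y m omega - Z omega|] @[m --> \oo] --> 0%E.

Definition filtration (F : R -> set (set Omega)) : Prop :=
  (forall t : R, 0 <= t <= T ->
     sigma_algebra setT (F t) /\ F t `<=` @measurable d Omega) /\
  (forall s t : R, 0 <= s -> s <= t -> t <= T -> F s `<=` F t).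

Definition measurable_wrt (G : set (set Omega)) (Y : Omega -> R) : Prop :=
  forall B : set R, measurable B -> G (Y @^-1` B).

Definition adapted (F : R -> set (set Omega)) (Y : R -> Omega -> R) : Prop :=
  forall t : R, 0 <= t <= T -> measurable_wrt (F t) (Y t).

Definition cadlag (Y : R -> Omega -> R) : Prop :=
  forall omega, cadlag_path T (Y ^~ omega).

Definition ae_continuous (Y : R -> Omega -> R) : Prop :=
  {ae P, forall omega, {within `[0, T], continuous (Y ^~ omega)}}.

Definition wiener (F : R -> set (set Omega)) (w : R -> Omega -> R) : Prop :=
  [/\ adapted F w,
      {ae P, forall omega, w 0 omega = 0},
      ae_continuous w,
      (* w_t - w_s ~ N(0, t - s); normal_prob takes the standard deviation *)
      forall s t : R, 0 <= s -> s < t -> t <= T ->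
        forall B : set R, measurable B ->
        P [set omega | B (w t omega - w s omega)]
        = normal_prob 0 (Num.sqrt (t - s)) B &
      (* w_t - w_s is independent of F_s *)
      forall s t : R, 0 <= s -> s < t -> t <= T ->
        forall (A : set Omega) (B : set R), F s A -> measurable B ->
        P (A `&` [set omega | B (w t omega - w s omega)])
        = (P A * P [set omega | B (w t omega - w s omega)%R])%E].

(* The simple process sum_(i < N) xi_i 1_(tau_i, tau_(i+1)]. *)
Record simple_process := SimpleProcess {
  sp_size : nat ;
  sp_time : nat -> R ;
  sp_coef : nat -> Omega -> R
}.

Definition simple_predictable (F : R -> set (set Omega)) (H : simple_process)
    : Prop :=
  [/\ sp_time H 0%N = 0, sp_time H (sp_size H) = T,
      forall i, (i < sp_size H)%N -> sp_time H i <= sp_time H i.+1 &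
      forall i, (i < sp_size H)%N ->
        measurable_wrt (F (sp_time H i)) (sp_coef H i)].

Definition sp_val (H : simple_process) (s : R) (omega : Omega) : R :=
  \sum_(i < sp_size H)
    sp_coef H i omega * \1_(`]sp_time H i, sp_time H i.+1]) s.

Definition sp_int (H : simple_process) (w : R -> Omega -> R) (t : R)
    (omega : Omega) : R :=
  \sum_(i < sp_size H)
    sp_coef H i omega * (w (Num.min (sp_time H i.+1) t) omega
                         - w (Num.min (sp_time H i) t) omega).

(* M is (a version of) the Ito integral of sigma with respect to w on [0, T]:
   the a.s. continuous process which is the limit in probability of the
   elementary integrals of simple predictable H^m such that
   int_0^T (H^m_s - sigma_s)^2 ds -> 0 in probability.  For sigma cadlag and
   adapted such H^m exist and the limit does not depend on the choice of the
   H^m; this determines M up to indistinguishability. *)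
Definition ito_integral (F : R -> set (set Omega)) (w sigma M : R -> Omega -> R)
    : Prop :=
  [/\ forall t : R, 0 <= t <= T -> measurable_fun setT (M t),
      ae_continuous M &
      forall H : nat -> simple_process,
        (forall m, simple_predictable F (H m)) ->
        cvg_in_prob
          (fun m omega => \int[lebesgue_measure]_(s in `[0, T])
                            (sp_val (H m) s omega - sigma s omega) ^+ 2)
          (fun=> 0) ->
        forall t : R, 0 <= t <= T ->
          cvg_in_prob (fun m => sp_int (H m) w t) (M t)].

Definition Jsigma (sigma : R -> Omega -> R) : R -> Omega -> R :=
  fun t omega => jump_part (sigma ^~ omega) t.

Definition sigma_tilde (sigma : R -> Omega -> R) : R -> Omega -> R :=
  fun t omega => sigma t omega - Jsigma sigma t omega.

Definition Nbar (J sigma : R -> Omega -> R) (A : set R) (omega : Omega)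
    : \bar R :=
  (njumps (J ^~ omega) A + njumps (Jsigma sigma ^~ omega) A)%E.

(* X_t = X_0 + int_0^t b ds + int_0^t sigma dw + J_t, with J a finitely active
   pure jump process and sigma having finitely many jumps.  Finiteness of the
   number of jumps of sigma is what makes Jsigma the genuine sum of jumps. *)
Definition ito_semimartingale (F : R -> set (set Omega))
    (X b sigma w J : R -> Omega -> R) : Prop :=
  [/\ cadlag X /\ adapted F X,
      (cadlag b /\ adapted F b) /\ (cadlag sigma /\ adapted F sigma),
      [/\ cadlag J, adapted F J,
          {ae P, forall omega, (njumps (J ^~ omega) `]0%R, T] < +oo)%E} &
          {ae P, forall omega, forall t : R, 0 <= t <= T ->
             J t omega = jump_part (J ^~ omega) t}],
      {ae P, forall omega, (njumps (sigma ^~ omega) `]0%R, T] < +oo)%E} /\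
      {ae P, forall omega, (njumps (Jsigma sigma ^~ omega) `]0%R, T] < +oo)%E} &
      wiener F w /\
      exists2 M : R -> Omega -> R, ito_integral F w sigma M &
        {ae P, forall omega, forall t : R, 0 <= t <= T ->
           X t omega = X 0 omega
                       + \int[lebesgue_measure]_(s in `[0, t]) b s omega
                       + M t omega + J t omega}].

End stochastic_processes.

Section local_windows.
Context {R : realType}.
Implicit Types (n k j : nat) (T : R).

(* Indices are 1-based, as in I_n = {1, ..., n}; [kn] is kappa_n. *)
Definition grid T n j : R := j%:R * T / n%:R.

Definition kbar (kn : nat) : nat := (2 * kn + 1)%N.

Definition win_start n (kn : nat) j : nat :=
  if (j <= kn)%N then 1%N
  else if (j <= n - kn)%N then (j - kn)%N else (n - 2 * kn)%N.

Definition window n (kn : nat) j : seq nat := iota (win_start n kn j) (kbar kn).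

Definition win_itv T n (kn : nat) j : set R :=
  `]grid T n (win_start n kn j).-1, grid T n (win_start n kn j + 2 * kn)%N].

End local_windows.

Section local_global_realized_volatility.
Context {R : realType} {d : measure_display} {Omega : measurableType d}.
Variables (T : R) (X : R -> Omega -> R).

Definition incr (n k : nat) (omega : Omega) : R :=
  X (grid T n k) omega - X (grid T n k.-1) omega.

(* Rank in increasing order; tied values all get the largest of their ranks. *)
Definition rank_in (I : seq nat) (n k : nat) (omega : Omega) : nat :=
  count (fun k' => (`|incr n k' omega| <= `|incr n k omega|)%R) I.

Definition trimmed (alpha : R) (n kn j : nat) (omega : Omega) : seq nat :=
  [seq k <- window n kn j |
     (rank_in (window n kn j) n k omega)%:R <= (1 - alpha) * (kbar kn)%:R].

Definition trunc (n k : nat) (omega : Omega) : R :=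
  (`|incr n k omega| <= n%:R `^ (- 4^-1))%R%:R.

(* The c with P[zeta^2 <= c] = 1 - alpha for zeta ~ N(0,1); +oo at alpha = 0. *)
Definition c_norm (alpha : R) : \bar R :=
  if alpha == 0 then +oo%E
  else [get c : \bar R |
          normal_prob (0 : R) 1 [set z : R | ((z ^+ 2)%:E <= c)%E]
          = (1 - alpha)%:E].

Definition q_norm (alpha : R) : R :=
  \int[normal_prob (0 : R) 1]_(z in
      [set z : R | (`|z|%:E <= sqrte (c_norm alpha))%E]) z ^+ 2.

Definition LGRV (alpha : R) (n kn j : nat) (omega : Omega) : R :=
  n%:R / ((kbar kn)%:R * T)
  * \sum_(k <- trimmed alpha n kn j omega)
      (q_norm alpha)^-1 * `|incr n k omega| ^+ 2 * trunc n k omega.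

End local_global_realized_volatility.

(* The event {j \in L_n^c}: no point of Nbar in the window of j. *)
Definition jump_free {R : realType} {d : measure_display}
    {Omega : measurableType d} (T : R) (J sigma : R -> Omega -> R)
    (n kn j : nat) : set Omega :=
  [set omega | Nbar J sigma (win_itv T n kn j) omega = 0%E].

(* Main.v *)
(* On a window without jumps the volatility is within O(sqrt(K/n)) in every L^p of its
   value a at the left end (K the window length), so the rescaled increments are
   sqrt(n/T) Delta_k X = a (zeta_k + rho_k) with zeta_k i.i.d. standard normal, independent
   of the past, and rho_k of order sqrt(K/n): the martingale part of rho_k is controlled by
   a discrete Burkholder inequality applied to the elementary integrals that approximate
   the Ito integral, and the bound passes to the limit in probability.  Ranks are scale
   invariant, so trimming acts on zeta + rho alone.  Up to an event on which an empirical
   distribution function deviates by a fixed power of n (whose probability is smaller than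
   any power of n, the deviations being O(1/sqrt K) in every L^p), the trimmed set lies
   between {|zeta + rho| <= c - eta} and {|zeta + rho| <= c + eta} with
   eta = n^(-gamma'), gamma < gamma' < beta = min((1 - c0)/2, c0/2); hence the trimmed mean
   differs from the mean of zeta^2 1{|zeta| <= c} by the contribution of an annulus of
   width O(eta) plus terms of order rho, and that mean is q(alpha) + O(1/sqrt K).  The
   truncation at n^(-1/4) costs O(n^(-1/2)).  Everything is dominated by a measurable
   random variable, because the estimation error itself need not be measurable. *)
Require Import Defs.
From HB Require Import structures.
From mathcomp Require Import all_boot all_order all_algebra.
From mathcomp Require Import all_classical all_reals all_analysis.
From mathcomp Require Import measurable_realfun.
From mathcomp Require Import ring lra.

Import Order.TTheory GRing.Theory Num.Theory.
Import numFieldNormedType.Exports.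

Local Open Scope classical_set_scope.
Local Open Scope ring_scope.

Set Implicit Arguments.
Unset Strict Implicit.
Unset Printing Implicit Defensive.

(** * Families of random variables with uniformly bounded moments *)

Section moments.
Context {R : realType} {d : measure_display} {Omega : measurableType d}.
Variable P : probability Omega R.

(** The elementary sums must be martingale transforms, whereas the event of no jump in the whole
    window looks into the future; inside the sums it is replaced by the larger event of no jump up
    to the current mesh point. That event is adapted because, for a cadlag path, absence of jumps
    can be read off the values at the points of countably many partitions. Measurability of time
    integrals in omega comes in the same spirit from Riemann sums, path by path. Moments are those
    of natural order, all of them at once, so that products need only 2|yz| <= y^2 + z^2; real
    exponents return at the very end. Exceptional events are never estimated through their
    probability: their indicators are dominated by r-th powers of quantities of order n^(-delta),
    with r chosen such that r delta >= 1. *)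

Lemma ge0_le_integralT (f g : Omega -> \bar R) :
  (forall x, (0 <= f x)%E) -> (forall x, (f x <= g x)%E) ->
  (\int[P]_x f x <= \int[P]_x g x)%E.
Proof.
(* For nonnegative functions the integral is a supremum over the simple functions below, so
   monotonicity holds for arbitrary [f] and [g]. *)
move=> f0 fg; rewrite !ge0_integralTE//; last first.
  by move=> x; exact: le_trans (f0 x) (fg x).
apply: ereal_sup_le => _ [h hf <-]; exists h => // x; exact: le_trans (hf x) (fg x).
Qed.

(** Adding +oo to [g] on a measurable null set makes the comparison hold everywhere without changing
    the integral of [g]; monotonicity then applies even if [f] is not measurable. *)
Lemma ae_le_integral_measurable (f g : Omega -> \bar R) :
  measurable_fun setT g -> (forall x, (0 <= f x)%E) -> (forall x, (0 <= g x)%E) ->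
  {ae P, forall x, (f x <= g x)%E} -> (\int[P]_x f x <= \int[P]_x g x)%E.
Proof.
move=> mg f0 g0 [N [mN PN0 fgN]].
pose g' x := (g x + (+oo) * (\1_N x)%:E)%E.
have m1 : measurable_fun setT (fun x => (+oo * (\1_N x)%:E)%E : \bar R).
  by apply: emeasurable_funM => //; apply/measurable_EFinP; exact: measurable_indic.
have g10 x : (0 <= +oo * (\1_N x)%:E :> \bar R)%E by apply: mule_ge0.
apply: (@le_trans _ _ (\int[P]_x g' x)%E).
  apply: ge0_le_integralT => // x; rewrite /g'.
  have [xN|xN] := pselect (N x).
    rewrite indicE mem_set// mule1 addey ?leey//.
    by rewrite gt_eqF// (lt_le_trans _ (g0 x)).
  rewrite indicE memNset// mule0 adde0.
  by apply: contrapT => h; apply: xN; apply: fgN.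
rewrite /g' ge0_integralD//.
rewrite ge0_integralZl//; last by apply/measurable_EFinP; exact: measurable_indic.
have -> : (\int[P]_x (\1_N x)%:E = 0)%E by rewrite integral_indic// setIT; exact: PN0.
by rewrite mule0 adde0.
Qed.

(** Uniform boundedness in every L^p, encoded by absolute moments of natural order. Quantifying over
    all orders makes the class stable under products, since the order may be doubled. *)
Definition moments_bounded {I : Type} (D : set I) (Y : I -> Omega -> R) : Prop :=
  (forall i, D i -> measurable_fun setT (Y i)) /\
  forall m : nat, exists C : R, forall i, D i ->
    (\int[P]_x (`|Y i x| ^+ m)%:E <= C%:E)%E.

Lemma measurable_normX (f : Omega -> R) m : measurable_fun setT f ->
  measurable_fun setT (fun x => (`|f x| ^+ m)%:E).
Proof.
move=> mf; apply/measurable_EFinP; apply: measurable_funX.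
exact: measurableT_comp.
Qed.

Variables (I : Type) (D : set I).
Implicit Types Y Z : I -> Omega -> R.

Lemma mb_le Y Z : (forall i, D i -> measurable_fun setT (Y i)) ->
  (forall i x, D i -> `|Y i x| <= `|Z i x|) ->
  moments_bounded D Z -> moments_bounded D Y.
Proof.
move=> mY YZ [mZ hZ]; split => // m; have [C hC] := hZ m.
exists C => i Di; apply: le_trans (hC i Di).
apply: ge0_le_integralT => x; rewrite lee_fin ?exprn_ge0//.
by rewrite lerXn2r ?nnegrE// YZ.
Qed.

Lemma mb_eq Y Z : (forall i x, D i -> Y i x = Z i x) ->
  moments_bounded D Z -> moments_bounded D Y.
Proof.
move=> YZ hZ; apply: (mb_le _ _ hZ) => [i Di|i x Di]; last by rewrite YZ.
by rewrite (_ : Y i = Z i); [exact: hZ.1|apply/funext => x; exact: YZ].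
Qed.

(* It suffices to bound arbitrarily high moments, since |y|^m <= 1 + |y|^m' for m <= m'. *)
Lemma mb_cofinal Y : (forall i, D i -> measurable_fun setT (Y i)) ->
  (forall m : nat, exists2 m' : nat, (m <= m')%N & exists C : R, forall i, D i ->
     (\int[P]_x (`|Y i x| ^+ m')%:E <= C%:E)%E) ->
  moments_bounded D Y.
Proof.
move=> mY h; split => // m; have [m' mm' [C hC]] := h m.
exists (1 + C) => i Di.
apply: (@le_trans _ _ (\int[P]_x (1 + (`|Y i x| ^+ m')%:E))%E).
  apply: ge0_le_integralT => x; rewrite -?EFinD lee_fin ?exprn_ge0//.
  have [y1|y1] := leP `|Y i x| 1.
    by rewrite (@le_trans _ _ 1)// ?exprn_ile1// lerDl exprn_ge0.
  by rewrite (@le_trans _ _ (`|Y i x| ^+ m'))// ?lerDr// ler_weXn2l// ltW.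
rewrite ge0_integralD//.
- rewrite integral_cst// [X in (_ * X)%E]probability_setT mule1 EFinD.
  by apply: leeD2l => //; exact: hC.
- by apply: measurable_normX; exact: mY.
Qed.

Lemma mb_cst (c : I -> R) (C : R) : (forall i, D i -> `|c i| <= C) ->
  moments_bounded D (fun i _ => c i).
Proof.
move=> cC; split => [i Di|m]; first exact: measurable_cst.
exists (C ^+ m) => i Di; rewrite integral_cst// [X in (_ * X)%E]probability_setT mule1 lee_fin.
by rewrite lerXn2r ?nnegrE// ?(le_trans _ (cC i Di))// cC.
Qed.

Lemma mb_norm Y : moments_bounded D Y -> moments_bounded D (fun i x => `|Y i x|).
Proof.
move=> hY; apply: (mb_le _ _ hY) => [i Di|i x Di]; last by rewrite normr_id.
by apply: measurableT_comp => //; exact: hY.1.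
Qed.

Lemma mb_opp Y : moments_bounded D Y -> moments_bounded D (fun i x => - Y i x).
Proof.
move=> hY; apply: (mb_le _ _ hY) => [i Di|i x Di]; last by rewrite normrN.
by apply: measurableT_comp => //; exact: hY.1.
Qed.

Lemma normrX_add_le (x y : R) m :
  `|x + y| ^+ m <= 2 ^+ m * (`|x| ^+ m + `|y| ^+ m).
Proof.
wlog xy : x y / `|x| <= `|y|.
  move=> h; have [xy|yx] := leP `|x| `|y|; first exact: h.
  by rewrite addrC (addrC (`|x| ^+ m)); apply: h; exact: ltW.
apply: (@le_trans _ _ ((2 * `|y|) ^+ m)).
  by rewrite lerXn2r ?nnegrE ?mulr_ge0// (le_trans (ler_normD _ _))//; lra.
by rewrite exprMn ler_wpM2l ?exprn_ge0// lerDr exprn_ge0.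
Qed.

Lemma mb_add Y Z : moments_bounded D Y -> moments_bounded D Z ->
  moments_bounded D (fun i x => Y i x + Z i x).
Proof.
move=> [mY hY] [mZ hZ]; split => [i Di|m].
  by apply: measurable_funD; [exact: mY|exact: mZ].
have [C hC] := hY m; have [C' hC'] := hZ m.
exists (2 ^+ m * (C + C')) => i Di.
apply: (@le_trans _ _ (\int[P]_x ((2 ^+ m)%:E *
    ((`|Y i x| ^+ m)%:E + (`|Z i x| ^+ m)%:E)))%E).
  apply: ge0_le_integralT => x; rewrite -?EFinD -?EFinM lee_fin ?exprn_ge0//.
  exact: normrX_add_le.
have mYm := measurable_normX m (mY i Di); have mZm := measurable_normX m (mZ i Di).
rewrite ge0_integralZl_EFin//; last 2 first.
- by move=> x _; rewrite -EFinD lee_fin addr_ge0// exprn_ge0.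
- by apply: emeasurable_funD.
rewrite EFinM lee_pmul2l// ?lte_fin ?exprn_gt0//.
rewrite ge0_integralD//; first by rewrite EFinD leeD// ?hC ?hC'.
Qed.

(** The square of |y|^m - |z|^m gives |yz|^m <= |y|^(2m) + |z|^(2m), which plays the role of
    Hoelder's inequality. *)
Lemma mb_mul Y Z : moments_bounded D Y -> moments_bounded D Z ->
  moments_bounded D (fun i x => Y i x * Z i x).
Proof.
move=> [mY hY] [mZ hZ]; split => [i Di|m].
  by apply: measurable_funM; [exact: mY|exact: mZ].
have [C hC] := hY (m * 2)%N; have [C' hC'] := hZ (m * 2)%N.
exists (C + C') => i Di.
apply: (@le_trans _ _ (\int[P]_x
    ((`|Y i x| ^+ (m * 2))%:E + (`|Z i x| ^+ (m * 2))%:E))%E).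
  apply: ge0_le_integralT => x; rewrite -?EFinD lee_fin ?exprn_ge0//.
  rewrite normrM exprMn !exprM.
  have := sqr_ge0 (`|Y i x| ^+ m - `|Z i x| ^+ m).
  have := exprn_ge0 m (normr_ge0 (Y i x)); have := exprn_ge0 m (normr_ge0 (Z i x)).
  by nra.
have mYm := measurable_normX (m * 2) (mY i Di).
have mZm := measurable_normX (m * 2) (mZ i Di).
rewrite ge0_integralD//; first by rewrite EFinD leeD// ?hC ?hC'.
Qed.

Lemma mb_exp Y k : moments_bounded D Y -> moments_bounded D (fun i x => Y i x ^+ k).
Proof.
move=> hY; elim: k => [|k IH].
  by apply: (@mb_cst (fun=> 1) 1) => i _; rewrite normr1.
apply: (@mb_eq _ (fun i x => Y i x * Y i x ^+ k)); first by move=> i x _; rewrite exprS.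
exact: mb_mul.
Qed.

Lemma mb_scale (c : I -> R) (C : R) Y : (forall i, D i -> `|c i| <= C) ->
  moments_bounded D Y -> moments_bounded D (fun i x => c i * Y i x).
Proof. by move=> cC hY; apply: mb_mul => //; exact: (mb_cst cC). Qed.

Lemma mb_indic_mul (A : I -> set Omega) Y : (forall i, D i -> measurable (A i)) ->
  moments_bounded D Y -> moments_bounded D (fun i x => \1_(A i) x * Y i x).
Proof.
move=> mA hY; apply: (mb_le _ _ hY) => [i Di|i x Di].
  apply: measurable_funM; last exact: hY.1.
  by apply: measurable_indic; exact: mA.
rewrite normrM ler_piMl// indicE; by case: (_ \in _); rewrite ?normr1 ?normr0.
Qed.

End moments.

Lemma expr_mean_le {R : realType} (s : seq nat) (x : nat -> R) m :
  (0 < size s)%N -> (forall k, 0 <= x k) ->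
  ((size s)%:R^-1 * \sum_(k <- s) x k) ^+ m
    <= (size s)%:R^-1 * \sum_(k <- s) x k ^+ m.
Proof.
move=> s0 x0; set a := _ * \sum_(k <- s) x k.
have K0 : 0 < (size s)%:R :> R by rewrite ltr0n.
have a0 : 0 <= a by rewrite mulr_ge0 ?invr_ge0 ?sumr_ge0 ?ltW.
(* The graph of t^m lies above its tangent at the mean a. *)
have tl m' y : 0 <= y -> a ^+ m'.+1 + m'.+1%:R * a ^+ m' * (y - a) <= y ^+ m'.+1.
  move=> y0; elim: m' => [|m' IH]; first by rewrite !expr1 expr0; lra.
  have e1 : a ^+ m'.+2 = a * a ^+ m'.+1 by rewrite exprS.
  have e2 : y ^+ m'.+2 = y * y ^+ m'.+1 by rewrite exprS.
  have e3 : a ^+ m'.+1 = a * a ^+ m' by rewrite exprS.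
  rewrite e1 e2 -(natr1 m'.+1); have am := exprn_ge0 m' a0.
  apply: le_trans (ler_wpM2l y0 IH); rewrite e3.
  have mp : 0 <= m'.+1%:R :> R by [].
  rewrite -subr_ge0; set r := (X in 0 <= X).
  have -> : r = m'.+1%:R * a ^+ m' * (y - a) ^+ 2 by rewrite /r; ring.
  by rewrite mulr_ge0 ?sqr_ge0// mulr_ge0.
case: m => [|m].
  rewrite expr0 (eq_bigr (fun=> 1)) => [|k _]; last by rewrite expr0.
  by rewrite big_const_seq count_predT iter_addr_0 mulVf// gt_eqF.
rewrite -(ler_pM2l K0) mulrA divff ?gt_eqF// mul1r.
apply: le_trans (ler_sum _ (fun k _ => tl m (x k) (x0 k))).
rewrite big_split/= big_const_seq count_predT iter_addr_0 -mulr_sumr.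
rewrite big_split/= big_const_seq count_predT iter_addr_0.
have -> : \sum_(k <- s) x k = (size s)%:R * a by rewrite /a mulrA divff ?gt_eqF// mul1r.
rewrite -(mulr_natl (- a)) -(mulr_natl (a ^+ _)).
have -> : (size s)%:R * a + (size s)%:R * - a = 0 by rewrite mulrN subrr.
by rewrite mulr0 addr0.
Qed.

Section moments_mean.
Context {R : realType} {d : measure_display} {Omega : measurableType d}.
Variable P : probability Omega R.

Lemma mb_reindex (I I' : Type) (D : set I) (D' : set I') (f : I' -> I)
    (Y : I -> Omega -> R) : (forall i, D' i -> D (f i)) ->
  moments_bounded P D Y -> moments_bounded P D' (fun i => Y (f i)).
Proof.
move=> ff [mY hY]; split => [i Di|m]; first exact/mY/ff.
by have [C hC] := hY m; exists C => i Di; apply/hC/ff.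
Qed.

(** By Jensen's inequality the m-th moment of a mean is at most the mean of the m-th moments, so the
    bound does not depend on the length of the list. *)
Lemma mb_mean (I : Type) (D : set I) (s : I -> seq nat) (Y : I -> nat -> Omega -> R) :
  (forall i, D i -> (0 < size (s i))%N) ->
  moments_bounded P [set ik : I * nat | D ik.1 /\ ik.2 \in s ik.1]
    (fun ik => Y ik.1 ik.2) ->
  moments_bounded P D (fun i x => (size (s i))%:R^-1 * \sum_(k <- s i) Y i k x).
Proof.
move=> s0 [mY hY].
(* Extending by 0 outside the list makes [Z i k] measurable for every [k], while [Y i k] is known to
   be so on the list only. *)
pose Z i k x := if k \in s i then Y i k x else 0.
have ZY i x (F : R -> R) : \sum_(k <- s i) F (Y i k x) = \sum_(k <- s i) F (Z i k x).
  by rewrite !big_seq; apply: eq_bigr => k ks; rewrite /Z ks.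
have mZ i k : D i -> measurable_fun setT (Z i k).
  by move=> Di; rewrite /Z; have [ks|_] := boolP (k \in s i); [exact: (mY (i, k))|].
split => [i Di|m].
  apply: measurable_funM => //.
  rewrite (_ : (fun x => _) = fun x => \sum_(k <- s i) Z i k x); last first.
    by apply/funext => x; rewrite (ZY _ _ id).
  by apply: measurable_sum => k; exact: mZ.
have [C hC] := hY m; exists C => i Di.
have K0 : 0 < (size (s i))%:R :> R by rewrite ltr0n s0.
apply: (@le_trans _ _ (\int[P]_x ((size (s i))%:R^-1%:E *
  \sum_(k <- s i) (`|Z i k x| ^+ m)%:E))%E).
  apply: ge0_le_integralT => x; first by rewrite lee_fin exprn_ge0.
  rewrite sumEFin -EFinM lee_fin.
  apply: le_trans (@expr_mean_le R (s i) (fun k => `|Z i k x|) m (s0 i Di) _) => //.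
  rewrite lerXn2r ?nnegrE ?mulr_ge0 ?invr_ge0 ?sumr_ge0// normrM.
  rewrite ger0_norm ?invr_ge0// ler_wpM2l ?invr_ge0// (ZY _ _ id).
  exact: ler_norm_sum.
have mZm k := measurable_normX m (mZ i k Di).
rewrite ge0_integralZl_EFin//; last 2 first.
- by move=> x _; rewrite sume_ge0// => k _; rewrite lee_fin exprn_ge0.
- exact: emeasurable_sum.
rewrite ge0_integral_sum//.
rewrite -lee_pdivlMl ?invr_gt0// invrK.
apply: (@le_trans _ _ (\sum_(k <- s i) C%:E)%E).
  rewrite big_seq [leRHS]big_seq; apply: lee_sum => k ks.
  under eq_integral => x _ do rewrite /Z ks.
  exact: (hC (i, k)).
by rewrite sumEFin big_const_seq count_predT iter_addr_0 -EFinM mulr_natl.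
Qed.

End moments_mean.

(** * Independence and moments of martingale transforms *)

Section independence.
Context {R : realType} {d : measure_display} {Omega : measurableType d}.
Variable P : probability Omega R.
Implicit Types (G : set (set Omega)) (Y xi : Omega -> R).

(** A filtration is a family of bare sets of events; passing to [g_sigma_algebraType] gives access
    to the closure properties of measurable functions. *)
Lemma measurable_wrtP G Y : sigma_algebra setT G ->
  measurable_wrt G Y <-> measurable_fun [set: g_sigma_algebraType G] Y.
Proof.
move=> sG; split => [mY _ B mB|mY B mB].
  by rewrite setTI; apply: sub_sigma_algebra; exact: mY.
have := mY measurableT _ mB; rewrite setTI.
by rewrite measurable_g_measurableTypeE.
Qed.

Lemma measurable_wrt_sub G G' Y : G `<=` G' -> measurable_wrt G Y -> measurable_wrt G' Y.
Proof. by move=> GG' mY B mB; apply/GG'/mY. Qed.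

Lemma measurable_wrt_measurable G Y : G `<=` @measurable d Omega ->
  measurable_wrt G Y -> measurable_fun setT Y.
Proof. by move=> Gm mY _ B mB; rewrite setTI; apply/Gm/mY. Qed.

Lemma measurable_wrtM G Y Z : sigma_algebra setT G ->
  measurable_wrt G Y -> measurable_wrt G Z -> measurable_wrt G (fun x => Y x * Z x).
Proof.
move=> sG /(measurable_wrtP _ sG) mY /(measurable_wrtP _ sG) mZ.
by apply/(measurable_wrtP _ sG); exact: measurable_funM.
Qed.

Lemma measurable_wrtD G Y Z : sigma_algebra setT G ->
  measurable_wrt G Y -> measurable_wrt G Z -> measurable_wrt G (fun x => Y x + Z x).
Proof.
move=> sG /(measurable_wrtP _ sG) mY /(measurable_wrtP _ sG) mZ.
by apply/(measurable_wrtP _ sG); exact: measurable_funD.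
Qed.

Lemma measurable_wrtB G Y Z : sigma_algebra setT G ->
  measurable_wrt G Y -> measurable_wrt G Z -> measurable_wrt G (fun x => Y x - Z x).
Proof.
move=> sG /(measurable_wrtP _ sG) mY /(measurable_wrtP _ sG) mZ.
by apply/(measurable_wrtP _ sG); exact: measurable_funB.
Qed.

Lemma measurable_wrtX G Y m : sigma_algebra setT G ->
  measurable_wrt G Y -> measurable_wrt G (fun x => Y x ^+ m).
Proof.
move=> sG /(measurable_wrtP _ sG) mY.
by apply/(measurable_wrtP _ sG); exact: measurable_funX.
Qed.

Lemma measurable_wrt_cst G (c : R) : sigma_algebra setT G ->
  measurable_wrt G (fun=> c).
Proof. by move=> sG; apply/(measurable_wrtP _ sG). Qed.

Lemma measurable_wrt_indic G (A : set Omega) : sigma_algebra setT G ->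
  G A -> measurable_wrt G (\1_A : Omega -> R).
Proof.
move=> sG GA; apply/(measurable_wrtP _ sG).
by apply: measurable_indic; apply: sub_sigma_algebra.
Qed.

Definition independent_of (G : set (set Omega)) (xi : Omega -> R) : Prop :=
  forall (A : set Omega) (B : set R), G A -> measurable B ->
    P (A `&` xi @^-1` B) = (P A * P (xi @^-1` B))%E.

Section joint_law.
Variables (G : set (set Omega)) (Y xi : Omega -> R).
Hypotheses (Gm : G `<=` @measurable d Omega) (mY : measurable_wrt G Y).
Hypotheses (mxi : measurable_fun setT xi) (ind : independent_of G xi).

Let mY' : measurable_fun setT Y := measurable_wrt_measurable Gm mY.
Let Y' : {mfun Omega >-> R} := mfun_Sub (mem_set mY' : Y \in mfun).
Let xi' : {mfun Omega >-> R} := mfun_Sub (mem_set mxi : xi \in mfun).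
Let Yxi := fun x => (Y x, xi x).
Let mYxi : measurable_fun setT Yxi := measurable_fun_pair mY' mxi.
Let Yxi' : {mfun Omega >-> (R * R)%type} := mfun_Sub (mem_set mYxi : Yxi \in mfun).
Let PY : probability R R := distribution P Y'.
Let Pxi : probability R R := distribution P xi'.

(** Independence is the product formula on rectangles, and rectangles determine the law of the
    pair. *)
Let joint_lawE (A : set (R * R)) : measurable A ->
  (PY \x Pxi)%E A = distribution P Yxi' A.
Proof.
apply: product_measure_unique => A1 A2 mA1 mA2.
exact: (ind (mY mA1) mA2).
Qed.

(** Tonelli on the product law, so it also covers products whose integrability is still to be
    proved. *)
Lemma indep_integral_norm :
  (\int[P]_x (`|Y x * xi x|)%:E = \int[P]_x `|Y x|%:E * \int[P]_x `|xi x|%:E)%E.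
Proof.
have mn : measurable_fun setT (fun z : R => `|z|%:E).
  by apply/measurable_EFinP; exact: normr_measurable.
pose f (z : R * R) : \bar R := `|z.1 * z.2|%:E.
have mf : measurable_fun setT f.
  apply/measurable_EFinP; apply: measurableT_comp => //.
  by apply: measurable_funM.
transitivity (\int[distribution P Yxi']_z f z)%E.
  by rewrite ge0_integral_distribution// => z; rewrite lee_fin.
transitivity (\int[(PY \x Pxi)%E]_z f z)%E.
  by apply: eq_measure_integral => A mA _; first [exact/esym/joint_lawE | exact/joint_lawE].
rewrite fubini_tonelli1//; last by move=> z; rewrite lee_fin.
rewrite /fubini_F /f /=.
under eq_integral => y _.
  under eq_integral => z _ do rewrite normrM EFinM.
  rewrite ge0_integralZl_EFin//.
  over.
rewrite ge0_integralZr//; last by apply: integral_ge0 => z _; rewrite lee_fin.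
by congr *%E; rewrite ge0_integral_distribution// => z; rewrite lee_fin.
Qed.

Hypotheses (iY : P.-integrable setT (EFin \o Y)) (ixi : P.-integrable setT (EFin \o xi)).

Lemma indep_integrableM : P.-integrable setT (EFin \o (fun x => Y x * xi x)).
Proof.
apply/integrableP; split.
  by apply/measurable_EFinP; apply: measurable_funM.
rewrite /= indep_integral_norm.
move/integrableP : iY => [_ h1]; move/integrableP : ixi => [_ h2].
by rewrite lte_mul_pinfty// ?integral_ge0// ge0_fin_numE// integral_ge0.
Qed.

Lemma indep_integralM :
  (\int[P]_x (Y x * xi x)%:E = \int[P]_x (Y x)%:E * \int[P]_x (xi x)%:E)%E.
Proof.
have mE : measurable_fun setT (EFin : R -> \bar R) by apply/measurable_EFinP.
pose f (z : R * R) : \bar R := (z.1 * z.2)%:E.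
have mf : measurable_fun setT f.
  by apply/measurable_EFinP; apply: measurable_funM.
have iPY : PY.-integrable setT (EFin : R -> \bar R).
  by apply: integrable_pushforward.
have iPxi : Pxi.-integrable setT (EFin : R -> \bar R).
  by apply: integrable_pushforward.
transitivity (\int[distribution P Yxi']_z f z)%E.
  by rewrite integral_distribution//; exact: indep_integrableM.
transitivity (\int[(PY \x Pxi)%E]_z f z)%E.
  by apply: eq_measure_integral => A mA _; first [exact/esym/joint_lawE | exact/joint_lawE].
rewrite -integral12_prod_meas1//; last first.
  apply/integrable12ltyP => //=.
  move/integrableP : iPY => [_ h1]; move/integrableP : iPxi => [_ h2].
  under eq_integral => y _.
    under eq_integral => z _ do rewrite normrM EFinM.
    rewrite ge0_integralZl_EFin//; last by apply/measurable_EFinP; exact: normr_measurable.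
    over.
  rewrite ge0_integralZr//; last 2 first.
  - by apply/measurable_EFinP; exact: normr_measurable.
  - by apply: integral_ge0 => z _; rewrite lee_fin.
  by rewrite lte_mul_pinfty// ?integral_ge0// ge0_fin_numE// integral_ge0.
rewrite /fubini_F /f /=.
have fxi : (\int[Pxi]_z z%:E)%E \is a fin_num by exact: integrable_fin_num.
under eq_integral => y _.
  under eq_integral => z _ do rewrite EFinM.
  rewrite integralZl//.
  over.
rewrite -(fineK fxi) integralZr// fineK//.
by congr *%E; rewrite integral_distribution.
Qed.

End joint_law.
End independence.

(** In the binomial expansion each term of degree at least 2 in [y] is at most s^(2m-2) y^2 +
    y^(2m), according to which of |s|, |y| is larger, and the binomial coefficients sum to 2^(2m) =
    4^m. The linear term is kept exactly because its expectation will vanish. *)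
Lemma expr_even_add_le {R : realType} (m : nat) (s y : R) : (0 < m)%N ->
  (s + y) ^+ (2 * m) <= s ^+ (2 * m) + (2 * m)%:R * (s ^+ (2 * m).-1 * y)
    + 4 ^+ m * (s ^+ (2 * m.-1) * y ^+ 2 + y ^+ (2 * m)).
Proof.
case: m => // m _; rewrite exprDn.
have E : (2 * m).+2 = (2 * m.+1)%N by rewrite mulnS.
rewrite -E.
rewrite 2!big_ord_recl /= bin0 bin1 mulr1n expr0 mulr1 subn0 /bump /= subn1 expr1.
rewrite -[leRHS]addrA lerD2l -[X in _ <= X + _]/((2 * m).+2%:R * (s ^+ (2 * m).+2.-1 * y)) mulr_natl lerD2l.
set V := s ^+ (2 * m) * y ^+ 2 + y ^+ (2 * m).+2.
have V0 : 0 <= V.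
  have e k (z : R) : 0 <= z ^+ (2 * k) by rewrite exprM exprn_ge0 ?sqr_ge0.
  by rewrite /V E addr_ge0// mulr_ge0// sqr_ge0.
apply: (@le_trans _ _ (\sum_(i < (2 * m).+1) V *+ 'C((2 * m).+2, i.+2))).
  apply: ler_sum => i _; rewrite /bump /= !add1n ler_wMn2r//.
  apply: le_trans (ler_norm _) _; rewrite normrM !normrX.
  have -> : V = `|s| ^+ (2 * m) * `|y| ^+ 2 + `|y| ^+ (2 * m).+2.
    have e k (z : R) : z ^+ (2 * k) = `|z| ^+ (2 * k) by rewrite !exprM real_normK ?num_real.
    rewrite /V (e m s); congr (_ * _ + _); first exact: (e 1%N y).
    by rewrite E (e m.+1 y).
  have hi : (i <= 2 * m)%N by rewrite -ltnS.
  have -> : ((2 * m).+2 - i.+2 = 2 * m - i)%N by rewrite !subSS.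
  have [sy|ys] := leP `|s| `|y|.
    apply: (@le_trans _ _ (`|y| ^+ (2 * m - i) * `|y| ^+ i.+2)).
      by rewrite ler_wpM2r ?exprn_ge0// lerXn2r ?nnegrE.
    rewrite -exprD !addnS subnK//; by rewrite lerDr mulr_ge0 ?exprn_ge0.
  apply: (@le_trans _ _ (`|s| ^+ (2 * m - i) * (`|s| ^+ i * `|y| ^+ 2))).
    rewrite ler_wpM2l ?exprn_ge0// -addn2 exprD ler_wpM2r ?exprn_ge0//.
    by rewrite lerXn2r ?nnegrE// ltW.
  by rewrite mulrA -exprD subnK// lerDl exprn_ge0.
under eq_bigr do rewrite -mulr_natr.
rewrite -mulr_sumr mulrC ler_wpM2r// -natr_sum.
have -> : (4 : R) ^+ m.+1 = (2 ^ (2 * m).+2)%:R.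
  by rewrite E expnM natrX.
rewrite ler_nat -[X in (_ <= X ^ _)%N]/(1 + 1)%N expnDn.
under [leqRHS]eq_bigr do rewrite !exp1n !muln1.
by rewrite [leqRHS]big_ord_recl [in leqRHS]big_ord_recl /= addnA leq_addl.
Qed.

Section martingale_moments.
Context {R : realType} {d : measure_display} {Omega : measurableType d}.
Variable P : probability Omega R.

(** Young's inequality after rescaling: with s = S^2/A and y = D^2/e one has s^(m-1) y <= s^m + y^m,
    and both terms on the right have integral at most 1. Hence the factor 2. *)
Lemma mixed_moment_le (m : nat) (S D : Omega -> R) (A e : R) : (0 < m)%N ->
  measurable_fun setT S -> measurable_fun setT D ->
  0 < e -> e <= A ->
  (\int[P]_x (S x ^+ (2 * m))%:E <= (A ^+ m)%:E)%E ->
  (\int[P]_x (D x ^+ (2 * m))%:E <= (e ^+ m)%:E)%E ->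
  (\int[P]_x (S x ^+ (2 * m.-1) * D x ^+ 2)%:E <= (2 * A ^+ m.-1 * e)%:E)%E.
Proof.
case: m => // m _ mS mD e0 eA hS hD /=.
have A0 : 0 < A := lt_le_trans e0 eA.
pose c := A ^+ m * e.
have c0 : 0 < c by rewrite mulr_gt0 ?exprn_gt0.
have pw k (z : R) : 0 <= z ^+ (2 * k) by rewrite exprM exprn_ge0 ?sqr_ge0.
apply: (@le_trans _ _ (\int[P]_x ((c / A ^+ m.+1)%:E * (S x ^+ (2 * m.+1))%:E
   + (c / e ^+ m.+1)%:E * (D x ^+ (2 * m.+1))%:E))%E).
  apply: ge0_le_integralT => x; rewrite -?EFinM -?EFinD lee_fin.
    by rewrite mulr_ge0 ?sqr_ge0.
  set s := S x ^+ 2 / A; set y := D x ^+ 2 / e.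
  have s0 : 0 <= s by rewrite divr_ge0 ?sqr_ge0 ?ltW.
  have y0 : 0 <= y by rewrite divr_ge0 ?sqr_ge0 ?ltW.
  have -> : S x ^+ (2 * m) * D x ^+ 2 = c * (s ^+ m * y).
    rewrite /c /s /y exprM; set u := S x ^+ 2; set v := D x ^+ 2.
    by rewrite expr_div_n; field; rewrite ?gt_eqF ?exprn_gt0.
  have -> : c / A ^+ m.+1 * S x ^+ (2 * m.+1) = c * s ^+ m.+1.
    by rewrite /s exprM expr_div_n; ring.
  have -> : c / e ^+ m.+1 * D x ^+ (2 * m.+1) = c * y ^+ m.+1.
    by rewrite /y exprM expr_div_n; ring.
  rewrite -mulrDr ler_wpM2l ?(ltW c0)//.
  have [sy|ys] := leP s y.
    apply: (@le_trans _ _ (y ^+ m.+1)); last by rewrite lerDr exprn_ge0.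
    by rewrite exprSr ler_wpM2r// lerXn2r ?nnegrE.
  apply: (@le_trans _ _ (s ^+ m.+1)); last by rewrite lerDl exprn_ge0.
  by rewrite exprSr ler_wpM2l ?exprn_ge0// ltW.
have mm (f : Omega -> R) : measurable_fun setT f ->
    measurable_fun setT (fun x => (f x ^+ (2 * m.+1))%:E).
  by move=> mf; apply/measurable_EFinP; exact: measurable_funX.
have c1 : 0 <= c / A ^+ m.+1 by rewrite divr_ge0 ?exprn_ge0 ?ltW.
have c2 : 0 <= c / e ^+ m.+1 by rewrite divr_ge0 ?exprn_ge0 ?ltW.
rewrite ge0_integralD//; last 4 first.
- by move=> x _; rewrite -EFinM lee_fin mulr_ge0.
- by apply: emeasurable_funM => //; exact: mm.
- by move=> x _; rewrite -EFinM lee_fin mulr_ge0.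
- by apply: emeasurable_funM => //; exact: mm.
rewrite !ge0_integralZl_EFin//; last 4 first.
- by move=> x _; rewrite lee_fin.
- exact: mm.
- by move=> x _; rewrite lee_fin.
- exact: mm.
have -> : (2 * A ^+ m * e)%:E = ((c / A ^+ m.+1)%:E * (A ^+ m.+1)%:E
   + (c / e ^+ m.+1)%:E * (e ^+ m.+1)%:E)%E.
  by rewrite -!EFinM -EFinD !divfK ?gt_eqF ?exprn_gt0// /c; congr _%:E; ring.
by apply: leeD; apply: lee_wpmul2l => //; rewrite lee_fin.
Qed.


(** The factor 4^m comes from the binomial expansion; 3 = 2 + 1 adds the constant of the mixed
    moment to that of the pure power of D eta. *)
Definition moment_const (m : nat) (mu : R) : R := 3 * 4 ^+ m * mu.

(* The increments D_i eta_i are martingale differences; each step adds at most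
   c e to the bound because the term linear in eta_i has zero mean. *)
Lemma martingale_transform_moment (m : nat) (mu e : R) (G : nat -> set (set Omega))
    (D eta : nat -> Omega -> R) (N : nat) : (0 < m)%N -> 1 <= mu -> 0 < e ->
  (forall i, (i <= N)%N -> sigma_algebra setT (G i) /\ G i `<=` @measurable d Omega) ->
  (forall i, (i < N)%N -> G i `<=` G i.+1) ->
  (forall i, (i < N)%N -> measurable_wrt (G i) (D i)) ->
  (forall i, (i < N)%N -> measurable_wrt (G i.+1) (eta i)) ->
  (forall i, (i < N)%N -> independent_of P (G i) (eta i)) ->
  (forall i, (i < N)%N -> P.-integrable setT (EFin \o eta i)) ->
  (forall i, (i < N)%N -> (\int[P]_x (eta i x)%:E = 0)%E) ->
  (forall i, (i < N)%N -> (\int[P]_x (eta i x ^+ 2)%:E <= mu%:E)%E) ->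
  (forall i, (i < N)%N -> (\int[P]_x (eta i x ^+ (2 * m))%:E <= mu%:E)%E) ->
  (forall i, (i < N)%N -> (\int[P]_x (D i x ^+ (2 * m))%:E <= (e ^+ m)%:E)%E) ->
  (\int[P]_x ((\sum_(i < N) D i x * eta i x) ^+ (2 * m))%:E
    <= ((moment_const m mu * N%:R * e) ^+ m)%:E)%E.
Proof.
move=> m0 mu1 e0 HG Ginc mD meta ind ieta eta0 eta2 etam hD.
set c := moment_const m mu.
have mu0 : 0 < mu by rewrite (lt_le_trans _ mu1).
have pm k (z : R) : 0 <= z ^+ (2 * k) by rewrite exprM exprn_ge0 ?sqr_ge0.
have fm k : (1 <= (4 : R) ^+ k) by rewrite exprn_ege1// ler1n.
have cmu : mu <= c.
  by rewrite /c /moment_const ler_peMl ?(ltW mu0)//; have := fm m; lra.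
have c1 : 1 <= c := le_trans mu1 cmu.
have GS k : (k <= N)%N -> measurable_wrt (G k) (fun x => \sum_(i < k) D i x * eta i x).
  elim: k => [|k IH] kN.
    rewrite (_ : (fun _ => _) = fun=> 0); first by apply: measurable_wrt_cst; exact: (HG 0%N kN).1.
    by apply/funext => x; rewrite big_ord0.
  rewrite (_ : (fun _ => _) = fun x => \sum_(i < k) D i x * eta i x + D k x * eta k x); last first.
    by apply/funext => x; rewrite big_ord_recr.
  have sG := (HG _ kN).1.
  apply: measurable_wrtD => //.
    by apply: (measurable_wrt_sub (Ginc _ kN)); apply: IH; exact: ltnW.
  apply: measurable_wrtM => //; last exact: meta.
  by apply: (measurable_wrt_sub (Ginc _ kN)); exact: mD.
have mp (f : Omega -> R) k : measurable_fun setT f ->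
    measurable_fun setT (fun x => (f x ^+ k)%:E).
  by move=> mf; apply/measurable_EFinP; exact: measurable_funX.
have nE (f : Omega -> R) k : (\int[P]_x `|f x ^+ (2 * k)|%:E = \int[P]_x (f x ^+ (2 * k))%:E)%E.
  by apply: eq_integral => x _; rewrite ger0_norm.
suff main k : (k < N)%N ->
    (\int[P]_x ((\sum_(i < k.+1) D i x * eta i x) ^+ (2 * m))%:E
      <= ((c * k.+1%:R * e) ^+ m)%:E)%E.
  case: N {HG Ginc mD meta ind ieta eta0 eta2 etam hD GS} main => [_|N']; last by apply.
  rewrite mulr0 mul0r expr0n gtn_eqF//=.
  by under eq_integral do rewrite big_ord0 expr0n muln_eq0 /= gtn_eqF//; rewrite integral0.
(* The mixed moment estimate requires e <= A, which fails for the empty sum, where A = 0; hence the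
   induction starts with one term. *)
elim: k => [|k IH] kN.
  have sG := HG _ (ltnW kN).
  have mDm := measurable_wrtX (2 * m) sG.1 (mD _ kN).
  have mem : measurable_fun setT (fun x => eta 0%N x ^+ (2 * m)).
    apply: measurable_funX; exact: (measurable_wrt_measurable (HG _ kN).2 (meta _ kN)).
  have ind' : independent_of P (G 0%N) (fun x => eta 0%N x ^+ (2 * m)).
    move=> A B GA mB.
    have mB' : measurable ((fun z : R => z ^+ (2 * m)) @^-1` B).
      by rewrite -[_ @^-1` _]setTI; apply: (exprn_measurable (2 * m)).
    exact: (ind _ kN _ _ GA mB').
  under eq_integral => x _ do rewrite big_ord_recr big_ord0 /= add0r exprMn -[X in X%:E]ger0_norm ?mulr_ge0//.
  rewrite (indep_integral_norm sG.2 mDm mem ind') !nE mulr1 exprMn EFinM [leRHS]muleC.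
  apply: lee_pmul => //; try by apply: integral_ge0 => x _; rewrite lee_fin.
    exact: hD.
  apply: le_trans (etam _ kN) _; rewrite lee_fin (le_trans cmu)//.
  by rewrite -[leLHS]expr1 ler_weXn2l.
have kN' := ltnW kN.
set S := fun x => \sum_(i < k.+1) D i x * eta i x.
have sG := HG _ kN'.
have mwS : measurable_wrt (G k.+1) S := GS _ kN'.
have mwD := mD _ kN.
have mS := measurable_wrt_measurable sG.2 mwS.
have mDk := measurable_wrt_measurable sG.2 mwD.
have meta' := measurable_wrt_measurable (HG _ kN).2 (meta _ kN).
set A := c * k.+1%:R * e.
have hS : (\int[P]_x (S x ^+ (2 * m))%:E <= (A ^+ m)%:E)%E := IH kN'.
have eA : e <= A by rewrite /A ler_peMl ?(ltW e0)// mulr_ege1// ler1n.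
have A0 : 0 < A := lt_le_trans e0 eA.
(* Pointwise (S + D eta)^(2m) <= U + V. The nonnegative terms are collected in [U], whose integral
   is bounded first; [V] is the signed linear term, of mean zero by independence. *)
pose U x := S x ^+ (2 * m) + 4 ^+ m * (S x ^+ (2 * m.-1) * D k.+1 x ^+ 2 * eta k.+1 x ^+ 2
    + D k.+1 x ^+ (2 * m) * eta k.+1 x ^+ (2 * m)).
pose V x := (2 * m)%:R * (S x ^+ (2 * m).-1 * D k.+1 x * eta k.+1 x).
have indX j : independent_of P (G k.+1) (fun x => eta k.+1 x ^+ j).
  move=> A' B GA mB.
  have mB' : measurable ((fun z : R => z ^+ j) @^-1` B).
    by rewrite -[_ @^-1` _]setTI; apply: (exprn_measurable j).
  exact: (ind _ kN _ _ GA mB').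
have q1 x : 0 <= S x ^+ (2 * m.-1) * D k.+1 x ^+ 2.
  by apply: mulr_ge0 => //; exact: sqr_ge0.
have q2 x : 0 <= S x ^+ (2 * m.-1) * D k.+1 x ^+ 2 * eta k.+1 x ^+ 2.
  by apply: mulr_ge0 => //; exact: sqr_ge0.
have q3 x : 0 <= D k.+1 x ^+ (2 * m) * eta k.+1 x ^+ (2 * m) by exact: mulr_ge0.
have q4 x := addr_ge0 (q2 x) (q3 x).
have U0 x : 0 <= U x.
  apply: addr_ge0 => //; apply: mulr_ge0; first exact: le_trans (fm m).
  exact: q4.
have t1 : (\int[P]_x (S x ^+ (2 * m.-1) * D k.+1 x ^+ 2 * eta k.+1 x ^+ 2)%:E
    <= (2 * A ^+ m.-1 * e)%:E * mu%:E)%E.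
  have w : measurable_wrt (G k.+1) (fun x => S x ^+ (2 * m.-1) * D k.+1 x ^+ 2).
    by apply: (measurable_wrtM sG.1); apply: measurable_wrtX => //; exact: sG.1.
  under eq_integral => x _ do rewrite -(ger0_norm (q2 x)).
  rewrite (indep_integral_norm sG.2 w (measurable_funX 2 meta') (indX 2%N)).
  apply: lee_pmul => //; try by apply: integral_ge0 => x _; rewrite lee_fin.
    under eq_integral => x _ do rewrite (ger0_norm (q1 x)).
    exact: mixed_moment_le (hD _ kN).
  by rewrite -[2%N]/(2 * 1)%N nE; exact: eta2.
have t2 : (\int[P]_x (D k.+1 x ^+ (2 * m) * eta k.+1 x ^+ (2 * m))%:E
    <= (e ^+ m)%:E * mu%:E)%E.
  have w := measurable_wrtX (2 * m) sG.1 mwD.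
  under eq_integral => x _ do rewrite -(ger0_norm (q3 x)).
  rewrite (indep_integral_norm sG.2 w (measurable_funX (2 * m) meta') (indX (2 * m)%N)) !nE.
  apply: lee_pmul => //; try by apply: integral_ge0 => x _; rewrite lee_fin.
    exact: hD.
  exact: etam.
have mt1 : measurable_fun setT (fun x => S x ^+ (2 * m.-1) * D k.+1 x ^+ 2 * eta k.+1 x ^+ 2).
  by apply: measurable_funM; [apply: measurable_funM|]; exact: measurable_funX.
have mt2 : measurable_fun setT (fun x => D k.+1 x ^+ (2 * m) * eta k.+1 x ^+ (2 * m)).
  by apply: measurable_funM; exact: measurable_funX.
have mU : measurable_fun setT U.
  apply: measurable_funD; first exact: measurable_funX.
  by apply: measurable_funM => //; exact: measurable_funD.
have Ubnd : (\int[P]_x (U x)%:E <= ((c * k.+2%:R * e) ^+ m)%:E)%E.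
  rewrite /U; under eq_integral do rewrite EFinD EFinM EFinD.
  rewrite ge0_integralD//; last 4 first.
  - by move=> x _; rewrite lee_fin.
  - exact: mp.
  - by move=> x _; rewrite -EFinD -EFinM lee_fin mulr_ge0// ?(le_trans _ (fm m)).
  - apply: emeasurable_funM => //; apply: emeasurable_funD; exact/measurable_EFinP.
  rewrite ge0_integralZl_EFin//; last 2 first.
  - by move=> x _; rewrite -EFinD lee_fin.
  - by apply: emeasurable_funD; exact/measurable_EFinP.
  rewrite ge0_integralD//; last 4 first.
  - by move=> x _; rewrite lee_fin.
  - exact/measurable_EFinP.
  - by move=> x _; rewrite lee_fin.
  - exact/measurable_EFinP.
  apply: (@le_trans _ _ ((A ^+ m)%:E + (4 ^+ m)%:E *
      ((2 * A ^+ m.-1 * e)%:E * mu%:E + (e ^+ m)%:E * mu%:E))%E).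
    by apply: leeD => //; apply: lee_wpmul2l => //; exact: leeD.
  rewrite [leLHS](_ : _ = (A ^+ m + 4 ^+ m * (2 * A ^+ m.-1 * e * mu + e ^+ m * mu))%:E)//.
  rewrite lee_fin.
  have mE : m = m.-1.+1 by rewrite prednK.
  have em : e ^+ m <= A ^+ m.-1 * e.
    by rewrite mE /= exprSr ler_wpM2r ?(ltW e0)// lerXn2r ?nnegrE// ltW.
  (* With A = c (k+1) e, one more step yields A^m + c e A^(m-1) = A^(m-1) (A + c e), and A + c e = c
     (k+2) e dominates A. *)
  apply: (@le_trans _ _ (A ^+ m.-1 * (A + c * e))).
    have AE : A ^+ m = A ^+ m.-1 * A by rewrite [in LHS]mE exprSr.
    rewrite AE [leRHS]mulrDr lerD2l /c /moment_const.
    apply: (@le_trans _ _ (4 ^+ m * (2 * A ^+ m.-1 * e * mu + A ^+ m.-1 * e * mu))).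
      by rewrite ler_wpM2l// lerD2l ler_wpM2r// ltW.
    by rewrite le_eqVlt; apply/orP; left; apply/eqP; ring.
  have -> : A + c * e = c * k.+2%:R * e by rewrite /A -(natr1 k.+1); ring.
  rewrite [X in _ <= _ ^+ X]mE exprSr ler_wpM2r//.
    by rewrite mulr_ge0 ?(ltW e0)// mulr_ge0 ?(le_trans _ c1).
  rewrite lerXn2r ?nnegrE ?(ltW A0)//.
    by rewrite mulr_ge0 ?(ltW e0)// mulr_ge0 ?(le_trans _ c1).
  by rewrite /A ler_wpM2r ?(ltW e0)// ler_wpM2l ?(le_trans _ c1)// ler_nat.
have iU : P.-integrable setT (EFin \o U).
  apply/integrableP; split; first exact/measurable_EFinP.
  under eq_integral do rewrite /= ger0_norm//.
  exact: le_lt_trans Ubnd (ltry _).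
have wSD : measurable_wrt (G k.+1) (fun x => S x ^+ (2 * m).-1 * D k.+1 x).
  by apply: (measurable_wrtM sG.1) => //; exact: measurable_wrtX sG.1 mwS.
(* The coefficient of the linear term is integrable because |s|^(2m-1) |y| <= s^(2m) + y^(2m). *)
have iSD : P.-integrable setT (EFin \o (fun x => S x ^+ (2 * m).-1 * D k.+1 x)).
  apply/integrableP; split.
    by apply/measurable_EFinP; exact: measurable_wrt_measurable sG.2 wSD.
  apply: (@le_lt_trans _ _ (\int[P]_x ((S x ^+ (2 * m))%:E + (D k.+1 x ^+ (2 * m))%:E))%E).
    apply: ge0_le_integralT => x; rewrite /= -?EFinD lee_fin//.
    have e2 z : z ^+ (2 * m) = `|z| ^+ (2 * m) :> R by rewrite !exprM real_normK ?num_real.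
    have m2 : (2 * m)%N = (2 * m).-1.+1 by rewrite prednK// muln_gt0.
    rewrite normrM normrX (e2 (S x)) (e2 (D k.+1 x)); have [sy|ys] := leP `|S x| `|D k.+1 x|.
      apply: (@le_trans _ _ (`|D k.+1 x| ^+ (2 * m))); last by rewrite lerDr exprn_ge0.
      by rewrite [in leRHS]m2 exprSr ler_wpM2r// lerXn2r ?nnegrE.
    apply: (@le_trans _ _ (`|S x| ^+ (2 * m))); last by rewrite lerDl exprn_ge0.
    by rewrite [in leRHS]m2 exprSr ler_wpM2l ?exprn_ge0// ltW.
  rewrite ge0_integralD//; last 4 first.
  - by move=> x _; rewrite lee_fin.
  - exact: mp.
  - by move=> x _; rewrite lee_fin.
  - exact: mp.
  apply: lte_add_pinfty; first exact: le_lt_trans hS (ltry _).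
  exact: le_lt_trans (hD _ kN) (ltry _).
have iV1 := indep_integrableM sG.2 wSD meta' (ind _ kN) iSD (ieta _ kN).
have V1 := indep_integralM sG.2 wSD meta' (ind _ kN) iSD (ieta _ kN).
have iV : P.-integrable setT (EFin \o V).
  rewrite (_ : _ \o _ = fun x => ((2 * m)%:R%:E * (S x ^+ (2 * m).-1 * D k.+1 x * eta k.+1 x)%:E)%E).
    exact: integrableZl.
  by apply/funext => x /=; rewrite /V EFinM.
have V0 : (\int[P]_x (V x)%:E = 0)%E.
  rewrite /V; under eq_integral do rewrite EFinM.
  by rewrite integralZl// V1 eta0// mule0 mule0.
apply: le_trans Ubnd.
rewrite -[leRHS]adde0 -V0 -integralD//.
apply: ge0_le_integralT => x; rewrite -?EFinD lee_fin//.
rewrite big_ord_recr /=; apply: le_trans (expr_even_add_le _ _ m0) _.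
rewrite -/(S x) /U /V; rewrite le_eqVlt; apply/orP; left; apply/eqP.
by rewrite !exprMn; ring.
Qed.

End martingale_moments.

(** * The standard normal law *)

Section normal_law.
Context {R : realType}.
Local Notation mu := (@lebesgue_measure R).
Local Notation N01 := (normal_prob (0 : R) 1).

(** The density coincides almost everywhere with the Radon-Nikodym derivative of the normal law,
    since both have the same integral over every measurable set. *)
Lemma normal_integral (m s : R) (f : R -> \bar R) : measurable_fun setT f ->
  (forall x, (0 <= f x)%E) ->
  (\int[normal_prob m s]_x f x = \int[mu]_x (f x * (normal_pdf m s x)%:E))%E.
Proof.
move=> mf f0; have dom := @normal_prob_dominates R m s.
rewrite -(Radon_Nikodym_SigmaFinite.change_of_variables dom)//.
have iRN := Radon_Nikodym_SigmaFinite.f_integrable dom.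
apply: ae_eq_integral => //.
- by apply: emeasurable_funM => //; exact: measurable_int iRN.
- by apply: emeasurable_funM => //; apply/measurable_EFinP; exact: measurable_normal_pdf.
- apply: ae_eqe_mul2l; apply: integral_ae_eq => //.
  + by apply/measurable_EFinP; exact: measurable_normal_pdf.
  + by move=> E _ mE; rewrite -(Radon_Nikodym_SigmaFinite.f_integral dom).
Qed.

(** Uniqueness of Lebesgue measure: its normalized image under scaling agrees with it on half-open
    intervals. *)
Lemma lebesgue_measure_scale (s : R) (A : set R) : 0 < s -> measurable A ->
  mu ((fun x => x / s) @^-1` A) = (s%:E * mu A)%E.
Proof.
move=> s0 mA.
pose phi0 : R -> measurableTypeR R := fun x => x / s.
have mphi : measurable_fun setT phi0 by apply: measurable_funM.
have sV : 0 <= s^-1 by rewrite invr_ge0 ltW.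
pose nu : {measure set (measurableTypeR R) -> \bar R} :=
  mscale (NngNum sV) (pushforward mu phi0).
have : mu A = nu mphi A.
  apply: lebesgue_measure_unique => // _ [[a b] _ <-].
  rewrite /nu /mscale /= /pushforward.
  transitivity ((s^-1)%:E * mu (phi0 @^-1` `]a, b]))%E; last by [].
  have -> : phi0 @^-1` `]a, b] = `]a * s, b * s]%classic.
    by apply/seteqP; split => x; rewrite /= !in_itv /= ltr_pdivlMr// ler_pdivrMr.
  rewrite !lebesgue_measure_itv /= !lte_fin ltr_pM2r//.
  case: ifP => _; last by rewrite mule0.
  by rewrite -!EFinB -EFinM -mulrBl mulrCA mulVf ?gt_eqF// mulr1.
rewrite /nu /mscale /= /pushforward => ->.
by rewrite muleA -EFinM divff ?gt_eqF// mul1e.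
Qed.

Lemma normal_pdf_scale (s x : R) : 0 < s -> normal_pdf 0 s x = normal_pdf 0 1 (x / s) / s.
Proof.
move=> s0; rewrite !normal_pdfE ?gt_eqF// /normal_peak /normal_fun.
rewrite !subr0 expr1n mul1r.
have -> : Num.sqrt (s ^+ 2 * pi *+ 2) = s * Num.sqrt (pi *+ 2).
  by rewrite -mulrnAr sqrtrM ?sqr_ge0// sqrtr_sqr gtr0_norm.
have -> : - x ^+ 2 / (s ^+ 2 *+ 2) = - (x / s) ^+ 2 / 2 by field; rewrite gt_eqF.
by rewrite invfM; ring.
Qed.

Lemma normal_prob_scale (s : R) (A : set R) : 0 < s -> measurable A ->
  normal_prob 0 s ((fun x => x / s) @^-1` A) = N01 A.
Proof.
move=> s0 mA; rewrite /normal_prob.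
pose phi0 : R -> measurableTypeR R := fun x => x / s.
have mphi : measurable_fun setT phi0 by apply: measurable_funM.
under eq_integral => x _ do rewrite normal_pdf_scale//.
pose f (x : R) := (normal_pdf 0 1 x / s)%:E.
have mf : measurable_fun setT f.
  by apply/measurable_EFinP; apply: measurable_funM => //; exact: measurable_normal_pdf.
have f0 x : (0 <= f x)%E by rewrite lee_fin divr_ge0 ?normal_pdf_ge0 ?ltW.
transitivity (\int[pushforward mu phi0]_(x in A) f x)%E.
  rewrite [RHS]ge0_integral_pushforward//; exact: measurable_funTS.
have s0' : 0 <= s := ltW s0.
transitivity (\int[mscale (NngNum s0') mu]_(x in A) f x)%E.
  apply: eq_measure_integral => B mB _.
  exact: lebesgue_measure_scale.
rewrite ge0_integral_mscale//; last exact: measurable_funTS.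
rewrite -ge0_integralZl_EFin//; last exact: measurable_funTS.
by apply: eq_integral => x _; rewrite -EFinM mulrC divfK ?gt_eqF.
Qed.

Lemma normal_prob_opp (A : set R) : measurable A -> N01 (-%R @^-1` A) = N01 A.
Proof.
move=> mA; rewrite /normal_prob.
transitivity (\int[pushforward mu (-%R : R -> measurableTypeR R)]_(x in A) (normal_pdf 0 1 x)%:E)%E.
  rewrite [RHS]ge0_integral_pushforward//.
  - apply: eq_integral => x _ /=; congr _%:E.
    by rewrite !normal_pdfE// /normal_fun !subr0 sqrrN.
  - by apply: measurable_funTS; apply/measurable_EFinP; exact: measurable_normal_pdf.
  - by move=> x _; rewrite lee_fin normal_pdf_ge0.
by apply: eq_measure_integral => B mB _; exact: lebesgue_measureN.
Qed.

(** The factor exp(-x^2/2) splits into two copies of exp(-x^2/4): one absorbs the power of |x|, the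
    other is up to a constant the density of N(0, 2), whose integral is known. *)
Lemma normal_moment (k : nat) : exists C : R, (\int[N01]_x (`|x| ^+ k)%:E <= C%:E)%E.
Proof.
(* In exp(y) >= 1 + y^(k+1)/(k+1)! at y = x^2/4, the last term multiplied by [c] is |x|^(2(k+1));
   [r] is the ratio of the two normalizing constants. *)
pose c : R := k.+1`!%:R * 4 ^+ k.+1.
pose r : R := normal_peak 1 / normal_peak (Num.sqrt 2).
have s2 : Num.sqrt 2 != 0 :> R by rewrite gt_eqF// sqrtr_gt0.
have r0 : 0 <= r by rewrite divr_ge0 ?normal_peak_ge0.
have c0 : 0 <= c by rewrite mulr_ge0// exprn_ge0.
have mX : measurable_fun setT (fun x : R => (`|x| ^+ k)%:E).
  by apply/measurable_EFinP; apply: measurable_funX; exact: normr_measurable.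
exists ((1 + c) * r); rewrite normal_integral//.
apply: (@le_trans _ _ (\int[mu]_x (((1 + c) * r)%:E * (normal_pdf 0 (Num.sqrt 2) x)%:E))%E).
  apply: ge0_le_integral => //.
  - by move=> x _; rewrite -EFinM lee_fin mulr_ge0 ?exprn_ge0 ?normal_pdf_ge0.
  - by apply: emeasurable_funM => //; apply/measurable_EFinP; exact: measurable_normal_pdf.
  - by apply: emeasurable_funM => //; apply/measurable_EFinP; exact: measurable_normal_pdf.
  move=> x _; rewrite -!EFinM lee_fin !normal_pdfE// /r.
  have -> : (1 + c) * (normal_peak 1 / normal_peak (Num.sqrt 2))
     * (normal_peak (Num.sqrt 2) * normal_fun 0 (Num.sqrt 2) x)
     = normal_peak 1 * ((1 + c) * normal_fun 0 (Num.sqrt 2) x).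
    by field; rewrite gt_eqF// normal_peak_gt0.
  rewrite mulrCA ler_wpM2l ?normal_peak_ge0//.
  rewrite /normal_fun !subr0 sqr_sqrtr// expr1n.
  have -> : - x ^+ 2 / (1 *+ 2) = - (x ^+ 2 / 4) + - x ^+ 2 / (2 *+ 2) by field.
  rewrite expRD mulrA ler_wpM2r ?expR_ge0//.
  rewrite expRN ler_pdivrMr ?expR_gt0//.
  set y := x ^+ 2 / 4; have y0 : 0 <= y by rewrite divr_ge0 ?sqr_ge0.
  have E1 := expR_ge1Dxn k y0.
  have : 1 + `|x| ^+ (2 * k.+1) <= (1 + c) * expR y.
    apply: (@le_trans _ _ ((1 + c) * (1 + y ^+ k.+1 / k.+1`!%:R))); last first.
      by rewrite ler_wpM2l// addr_ge0.
    have -> : `|x| ^+ (2 * k.+1) = c * (y ^+ k.+1 / k.+1`!%:R).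
      rewrite exprM real_normK ?num_real// /c /y expr_div_n; field.
      by rewrite gt_eqF ?exprn_gt0//= pnatr_eq0 -lt0n fact_gt0.
    have : 0 <= y ^+ k.+1 / k.+1`!%:R by rewrite divr_ge0 ?exprn_ge0.
    by move: (y ^+ k.+1 / _) c0 => z; nra.
  apply: le_trans; have [x1|x1] := leP `|x| 1.
    by rewrite (@le_trans _ _ 1)// ?exprn_ile1// lerDl exprn_ge0.
  rewrite (@le_trans _ _ (`|x| ^+ (2 * k.+1)))// ?lerDr// ler_weXn2l ?(ltW x1)//.
  by rewrite mul2n -addnn (leq_trans (leqnSn k))// leq_addl.
rewrite ge0_integralZl_EFin//.
- by rewrite integral_normal_pdf mule1.
- by move=> x _; rewrite lee_fin normal_pdf_ge0.
- by apply/measurable_EFinP; exact: measurable_normal_pdf.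
- by rewrite mulr_ge0// addr_ge0.
Qed.

Lemma normal_integrable : N01.-integrable setT (EFin : R -> \bar R).
Proof.
apply/integrableP; split; first exact/measurable_EFinP.
by have [C hC] := normal_moment 1; apply: le_lt_trans hC (ltry _).
Qed.

Lemma normal_mean : (\int[N01]_x x%:E = 0)%E.
Proof.
have h : (\int[N01]_x x%:E = \int[N01]_x (- x)%:E)%E.
  pose phi0 : R -> measurableTypeR R := -%R.
  have mphi : measurable_fun setT phi0 by exact: measurable_funN.
  transitivity (\int[pushforward N01 phi0]_x x%:E)%E.
    by apply: eq_measure_integral => A mA _; exact/esym/normal_prob_opp.
  rewrite integral_pushforward//.
  have -> : EFin \o phi0 = (fun x => - x%:E)%E by apply/funext => x.
  exact/integrableN/normal_integrable.
have /fineK fN : (\int[N01]_x x%:E)%E \is a fin_num.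
  exact: (integrable_fin_num measurableT normal_integrable).
have e : (\int[N01]_x (- x)%:E = (-1)%:E * \int[N01]_x x%:E)%E.
  rewrite -integralZl//; last exact: normal_integrable.
  by apply: eq_integral => x _; rewrite -EFinM mulN1r.
move: h; rewrite e -fN mulN1e -EFinN => /eqP; rewrite eqe => /eqP h; congr _%:E.
by move: h; set a := fine _; lra.
Qed.


Definition band (u : R) : set R := [set z | `|z| <= u].

Definition normal_band (u : R) : R := fine (N01 (band u)).

Lemma measurable_band (u : R) : measurable (band u).
Proof.
have -> : band u = (fun z : R => `|z|) @^-1` `]-oo, u].
  by apply/seteqP; split => z /=; rewrite in_itv.
by rewrite -[X in measurable X]setTI; exact: normr_measurable.
Qed.

Lemma normal_bandE (u : R) : (normal_band u)%:E = N01 (band u).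
Proof. by rewrite /normal_band fineK// fin_num_measure//; exact: measurable_band. Qed.

Lemma normal_peak1_le1 : normal_peak (1 : R) <= 1.
Proof.
rewrite /normal_peak invf_le1 ?sqrtr_gt0; last by rewrite expr1n mul1r mulrn_wgt0 ?pi_gt0.
rewrite -[leLHS]sqrtr1 ler_sqrt expr1n mul1r; last by rewrite mulrn_wge0// pi_ge0.
by have := @pi_ge2 R; rewrite mulr2n; lra.
Qed.

Lemma normal_interval_le (u v : R) : u <= v -> (N01 `]u, v] <= (v - u)%:E)%E.
Proof.
move=> uv; rewrite /normal_prob.
apply: (@le_trans _ _ (\int[mu]_(x in `]u, v]) (cst 1%E x))%E).
  apply: ge0_le_integral => //.
  - by move=> x _; rewrite lee_fin normal_pdf_ge0.
  - by apply: measurable_funTS; apply/measurable_EFinP; exact: measurable_normal_pdf.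
  - move=> x _; rewrite lee_fin (le_trans (normal_pdf_ub _ _ _))// normal_peak1_le1//.
rewrite integral_cst// mul1e /= lebesgue_measure_itv /= lte_fin.
by case: ltP => // _; rewrite lee_fin subr_ge0.
Qed.

Lemma normal_interval_ge (u v : R) : 0 <= u <= v ->
  ((normal_pdf 0 1 v * (v - u))%:E <= N01 `]u, v])%E.
Proof.
move=> /andP[u0 uv]; rewrite /normal_prob.
apply: (@le_trans _ _ (\int[mu]_(x in `]u, v]) (cst (normal_pdf 0 1 v)%:E x))%E).
  rewrite integral_cst//= lebesgue_measure_itv /= lte_fin.
  case: ltP => [_|vu]; first by rewrite -EFinB -EFinM.
  have -> : v = u by apply/eqP; rewrite eq_le vu.
  by rewrite subrr mulr0 mule0.
apply: ge0_le_integral => //.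
- by move=> x _; rewrite lee_fin normal_pdf_ge0.
- by apply: measurable_funTS; apply/measurable_EFinP; exact: measurable_normal_pdf.
- move=> x /=; rewrite in_itv /= => /andP[ux xv]; rewrite lee_fin !normal_pdfE//.
  rewrite ler_wpM2l ?normal_peak_ge0// /normal_fun ler_expR !subr0 expr1n.
  rewrite ler_pdivrMr ?divfK// lerN2 lerXn2r ?nnegrE//; last exact: le_trans u0 uv.
  exact: le_trans u0 (ltW ux).
Qed.

(** The annulus is ]u, v] together with its reflection. The upper bound counts both halves, with
    density at most 1; for the lower bound one half is enough. *)
Lemma normal_bandB (u v : R) : 0 <= u <= v ->
  (N01 (band u) + N01 `]u, v] <= N01 (band v))%E /\
  (N01 (band v) <= N01 (band u) + (2 * (v - u))%:E)%E.
Proof.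
move=> /andP[u0 uv]; have mb := @measurable_band.
split.
  rewrite -measureU; [|exact: mb|exact: measurable_itv|]; last first.
    apply/seteqP; split => // z /= [zu]; rewrite in_itv /= => /andP[uz _].
    by move: (le_lt_trans (ler_norm z) (le_lt_trans zu uz)); rewrite ltxx.
  apply: le_measure; rewrite ?inE; [|exact: mb|].
    by apply: measurableU => //; exact: mb.
  move=> z /= [zu|]; first exact: le_trans zu uv.
  rewrite in_itv /= => /andP[uz zv]; rewrite /band /= ger0_norm//.
  exact: le_trans u0 (ltW uz).
have mN (A : set R) : measurable A -> measurable (-%R @^-1` A).
  by move=> mA; rewrite -[X in measurable X]setTI; exact: measurable_funN.
have sub : band v `<=` band u `|` (`]u, v] `|` -%R @^-1` `]u, v]).
  move=> z /= zv; have [zu|uz] := leP `|z| u; first by left.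
  right; have [z0|z0] := leP 0 z.
    by left; rewrite /= in_itv /=; move: uz zv; rewrite /band /= ger0_norm// => -> ->.
  by right; rewrite /= in_itv /=; move: uz zv; rewrite /band /= ltr0_norm// => -> ->.
apply: (@le_trans _ _ (N01 (band u `|` (`]u, v] `|` -%R @^-1` `]u, v])))).
  apply: le_measure; rewrite ?inE//; first exact: mb.
  by apply: measurableU; [exact: mb|apply: measurableU => //; exact: mN].
pose I : set R := `]u, v]%classic.
have mI : measurable I by exact: measurable_itv.
apply: (@le_trans _ _ (N01 (band u) + N01 (I `|` -%R @^-1` I))%E).
  by apply: measureU2; [exact: mb|apply: measurableU => //; exact: mN].
apply: leeD => //; apply: (@le_trans _ _ (N01 I + N01 (-%R @^-1` I))%E).
  by apply: measureU2 => //; exact: mN.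
rewrite mulr2n mulrDl !mul1r EFinD; apply: leeD; first exact: normal_interval_le.
by rewrite normal_prob_opp//; exact: normal_interval_le.
Qed.

Lemma normal_band_ub (u v : R) : 0 <= u <= v -> normal_band v - normal_band u <= 2 * (v - u).
Proof.
move=> uv; have [_] := normal_bandB uv.
by rewrite -!normal_bandE -EFinD lee_fin lerBlDl.
Qed.

Lemma normal_band_lb (u v : R) : 0 <= u <= v ->
  normal_pdf 0 1 v * (v - u) <= normal_band v - normal_band u.
Proof.
move=> uv; have [+ _] := normal_bandB uv.
have := normal_interval_ge uv; rewrite -!normal_bandE.
have /fineK <- : N01 `]u, v] \is a fin_num by rewrite fin_num_measure.
by rewrite -EFinD !lee_fin; lra.
Qed.

Lemma normal_band0 : normal_band 0 = 0.
Proof.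
rewrite /normal_band; have -> : band 0 = [set 0].
  by apply/seteqP; split => z; rewrite /band /= normr_le0 => /eqP.
have := @normal_prob_dominates R 0 1 => /null_content_dominatesP.
by move=> h; rewrite (h [set 0])//; exact: lebesgue_measure_set1.
Qed.

Lemma normal_band_lt0 (u : R) : u < 0 -> normal_band u = 0.
Proof.
move=> u0; rewrite /normal_band (_ : band u = set0) ?measure0//.
by apply/seteqP; split => // z; rewrite /band /= => zu; have := normr_ge0 z; lra.
Qed.

(** Negative thresholds are covered too, their band being empty; thresholds such as c - 2 eta may
    indeed be negative. *)
Lemma normal_band_lipschitz (u v : R) : `|normal_band v - normal_band u| <= 2 * `|v - u|.
Proof.
wlog uv : u v / u <= v.
  by move=> h; have [/h//|/ltW/h] := leP u v; rewrite distrC (distrC u).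
have mono : 0 <= u <= v -> normal_band u <= normal_band v.
  move=> /normal_band_lb; apply: contraTT; rewrite -!ltNge => h.
  apply: (@lt_le_trans _ _ 0); first by rewrite subr_lt0.
  by rewrite mulr_ge0 ?normal_pdf_ge0// subr_ge0.
have [u0|u0] := leP 0 u.
  have uv' : 0 <= u <= v by rewrite u0.
  rewrite !ger0_norm ?subr_ge0//; first exact: normal_band_ub.
  exact: mono.
rewrite (normal_band_lt0 u0) subr0; have [v0|v0] := leP 0 v; last first.
  by rewrite normal_band_lt0// normr0 mulr_ge0.
have h : 0 <= (0 : R) <= v by apply/andP.
have := normal_band_ub h; rewrite normal_band0 !subr0.
rewrite ger0_norm; last by rewrite /normal_band fine_ge0.
by rewrite ger0_norm ?subr_ge0//; lra.
Qed.

Lemma normal_band_continuous : continuous normal_band.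
Proof.
move=> u; apply/cvgrPdist_le => e e0; near=> v.
rewrite distrC (le_trans (normal_band_lipschitz u v))//.
rewrite mulrC -ler_pdivlMr// distrC.
near: v; apply: (@cvgr_dist_le _ _ _ (nbhs u) _ id u) => //.
by rewrite divr_gt0.
Unshelve. all: end_near. Qed.

(** Intermediate values: the mass is 0 at 0, continuous in the threshold, and tends to 1 because the
    bands exhaust the line. *)
Lemma normal_band_exists (p : R) : 0 <= p < 1 -> exists2 r, 0 <= r & normal_band r = p.
Proof.
move=> /andP[p0 p1].
have nd : {homo (fun n : nat => band n%:R) : n m / (n <= m)%N >-> (n <= m)%O}.
  move=> n m nm; apply/subsetPset => z /= h.
  by rewrite /band /= (le_trans h)// ler_nat.
have mU : measurable (\bigcup_n band n%:R).
  by apply: bigcupT_measurable => n; exact: measurable_band.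
have := nondecreasing_cvg_mu (mu := N01) (fun n => measurable_band n%:R) mU nd.
have -> : \bigcup_n band n%:R = setT.
  apply/seteqP; split => // z _; exists (Num.truncn `|z|).+1 => //=.
  by rewrite /band /= ltW// truncnS_gt.
set NT := (X in _ --> X); have -> : NT = 1%E by exact: probability_setT.
move=> /fine_cvg /= h.
have : \forall n \near \oo, p < normal_band n%:R.
  by apply: (cvgr_gt 1 h).
move=> [n _ /(_ n (leqnn n))] /= pn.
have [r] : exists2 r, r \in `[0, n%:R] & normal_band r = p.
  apply: IVT => //.
  - by apply: continuous_subspaceT => x; exact: normal_band_continuous.
  - rewrite normal_band0 (min_idPl _) ?(max_idPr _) ?p0 ?(ltW pn)//.
      by rewrite (le_trans p0) ?(ltW pn).
    by rewrite (le_trans p0) ?(ltW pn).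
by rewrite in_itv /= => /andP[r0 _]; exists r.
Qed.

Lemma band_sqr (r : R) : 0 <= r ->
  [set z : R | ((z ^+ 2)%:E <= (r ^+ 2)%:E)%E] = band r.
Proof.
move=> r0; apply/seteqP; split => z; rewrite /band /= lee_fin -(real_normK (num_real z)).
  by rewrite ler_pXn2r// nnegrE.
by move=> zr; rewrite lerXn2r ?nnegrE.
Qed.

(** [c_norm] is a chosen solution of an equation over the extended reals. A solution exists by
    continuity; infinite or nonpositive values are excluded because they give mass 1 or 0, whereas 0
    < 1 - alpha < 1. *)
Lemma c_normP (alpha : R) : 0 < alpha < 1 -> exists r, [/\ 0 < r,
  c_norm alpha = (r ^+ 2)%:E & normal_band r = 1 - alpha].
Proof.
move=> /andP[a0 a1]; rewrite /c_norm gt_eqF//.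
pose Q (c : \bar R) := N01 [set z : R | ((z ^+ 2)%:E <= c)%E] = (1 - alpha)%:E.
have [r r0 hr] : exists2 r, 0 <= r & normal_band r = 1 - alpha.
  by apply: normal_band_exists; apply/andP; split; lra.
have : Q (get Q).
  apply: (getI (x := (r ^+ 2)%:E)).
  by rewrite /Q band_sqr// -normal_bandE hr.
rewrite -/Q; case: (get Q) => [c| |]; rewrite /Q.
- have [c0|c0] := leP c 0.
    have le0 : (N01 [set z : R | ((z ^+ 2)%:E <= c%:E)%E] <= N01 (band 0))%E.
      apply: le_measure; rewrite ?inE.
      + move: c0; rewrite le_eqVlt => /orP[/eqP ->|c0].
          rewrite [X in _ X](_ : _ = band 0); first exact: measurable_band.
          by rewrite -band_sqr// expr0n.
        rewrite (_ : mkset _ = set0)//; apply/seteqP; split => // z /=.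
        by rewrite lee_fin => zc; have := sqr_ge0 z; lra.
      + exact: measurable_band.
      + move=> z /=; rewrite lee_fin => zc; rewrite /band /= normr_le0.
        rewrite -sqrf_eq0 eq_le sqr_ge0 andbT; exact: le_trans zc c0.
    move=> h; move: le0; rewrite h -normal_bandE normal_band0 lee_fin; lra.
  have -> : c = Num.sqrt c ^+ 2 by rewrite sqr_sqrtr// ltW.
  rewrite band_sqr// -normal_bandE => -[h].
  by exists (Num.sqrt c); rewrite sqrtr_gt0.
- rewrite (_ : mkset _ = setT); last by apply/seteqP; split => // z _ /=; rewrite leey.
  set NT := (X in X = _); have -> : NT = 1%E by exact: probability_setT.
  by move=> [h]; lra.
- rewrite (_ : mkset _ = set0) ?measure0; last by apply/seteqP; split.
  by move=> [h]; lra.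
Qed.

Definition q_set (alpha : R) : set R := [set z : R | (`|z|%:E <= sqrte (c_norm alpha))%E].

Lemma q_set0 : q_set 0 = setT.
Proof.
by apply/seteqP; split => // z _; rewrite /q_set /c_norm eqxx /= leey.
Qed.

Lemma q_set_band (alpha r : R) : 0 < r -> c_norm alpha = (r ^+ 2)%:E ->
  q_set alpha = band r.
Proof.
move=> r0 cE; rewrite /q_set cE /= sqrtr_sqr gtr0_norm//.
Qed.

Lemma measurable_q_set (alpha : R) : 0 <= alpha < 1 -> measurable (q_set alpha).
Proof.
move=> /andP[]; rewrite le_eqVlt => /orP[/eqP <- _|a0 a1]; first by rewrite q_set0.
have /c_normP[r [r0 cE _]] : 0 < alpha < 1 by rewrite a0.
by rewrite (q_set_band r0 cE); exact: measurable_band.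
Qed.

(** [Rintegral] takes the finite part of an integral, so finiteness has to be established; it
    follows from the second moment. *)
Lemma q_normE (alpha : R) : 0 <= alpha < 1 ->
  (\int[N01]_z (\1_(q_set alpha) z * z ^+ 2)%:E = (q_norm alpha)%:E)%E.
Proof.
move=> /measurable_q_set mD.
have mz : measurable_fun setT (fun z : R => z ^+ 2) by exact: measurable_funX.
rewrite /q_norm /Rintegral -/(q_set alpha) fineK; last first.
  rewrite ge0_fin_numE; last by apply: integral_ge0 => z _; rewrite lee_fin sqr_ge0.
  have [C hC] := normal_moment 2.
  apply: (@le_lt_trans _ _ (\int[N01]_z (`|z| ^+ 2)%:E)%E); last first.
    exact: le_lt_trans hC (ltry _).
  rewrite [leLHS]integral_mkcond; apply: ge0_le_integralT => z; rewrite patchE.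
    by case: ifP; rewrite ?lee_fin ?sqr_ge0.
  by case: ifP; rewrite real_normK ?num_real// lee_fin sqr_ge0.
rewrite [RHS]integral_mkcond; apply: eq_integral => z _; rewrite patchE indicE.
by case: ifP; rewrite ?mul1r ?mul0r.
Qed.

Lemma q_norm_gt0 (alpha : R) : 0 <= alpha < 1 -> 0 < q_norm alpha.
Proof.
move=> a01; rewrite -lte_fin -q_normE//.
have [r r0 sub] : exists2 r : R, 0 < r & band r `<=` q_set alpha.
  move: a01 => /andP[]; rewrite le_eqVlt => /orP[/eqP <- _|a0 a1].
    by exists 1; rewrite ?q_set0.
  have /c_normP[r [r0 cE _]] : 0 < alpha < 1 by rewrite a0.
  by exists r => //; rewrite (q_set_band r0 cE).
have r2 : 0 <= r / 2 <= r by apply/andP; split; lra.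
apply: (@lt_le_trans _ _ ((r / 2) ^+ 2 * (normal_pdf 0 1 r * (r - r / 2)))%:E).
  have h1 : 0 < r - r / 2 by lra.
  have h2 : 0 < normal_pdf 0 1 r.
    by rewrite normal_pdfE// mulr_gt0 ?normal_peak_gt0// expR_gt0.
  by rewrite lte_fin !mulr_gt0// exprn_gt0// divr_gt0.
pose A : set R := `]r / 2, r]%classic.
apply: (@le_trans _ _ (((r / 2) ^+ 2)%:E * N01 A)%E).
  by rewrite EFinM; apply: lee_wpmul2l; [rewrite lee_fin sqr_ge0|exact: normal_interval_ge].
have mA : measurable A by exact: measurable_itv.
have -> : N01 A = (\int[N01]_z (\1_A z)%:E)%E by rewrite integral_indic// setIT.
rewrite -ge0_integralZl_EFin//; last 2 first.
- by apply/measurable_EFinP; exact: measurable_indic.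
- exact: sqr_ge0.
apply: ge0_le_integralT => z; rewrite -?EFinM lee_fin.
  by rewrite mulr_ge0 ?sqr_ge0.
rewrite !indicE; have [|_] := boolP (z \in A); last first.
  by rewrite mulr0 mulr_ge0 ?sqr_ge0.
rewrite inE /A /= in_itv /= => /andP[rz zr]; rewrite mulr1 mem_set; last first.
  by apply: sub; rewrite /band /= ger0_norm//; lra.
by rewrite mul1r lerXn2r ?nnegrE//; lra.
Qed.

End normal_law.

(** * Cadlag paths *)

Section cadlag_paths.
Context {R : realType}.
Variable T : R.
Implicit Types f : R -> R.

Definition right_cont_at f (x : R) : Prop :=
  forall e, 0 < e -> exists2 dl, 0 < dl & forall y, x < y -> y < x + dl -> `|f y - f x| < e.

Definition left_lim f (x : R) : R := lim (f y @[y --> x^'-]).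

Lemma cadlag_right f x : cadlag_path T f -> 0 <= x < T -> right_cont_at f x.
Proof.
move=> [fr _] xT e e0; have /cvgrPdist_lt/(_ e e0) := fr x xT.
move=> [dl /= dl0 h]; exists dl => // y xy yd; rewrite distrC; apply: h => //=.
by rewrite distrC ger0_norm ?subr_ge0 ?(ltW xy)//; lra.
Qed.

Lemma cadlag_left f x : cadlag_path T f -> 0 < x <= T ->
  forall e, 0 < e -> exists2 dl, 0 < dl &
    forall y, x - dl < y -> y < x -> `|f y - left_lim f x| < e.
Proof.
move=> [_ fl] xT e e0; have /cvgrPdist_lt/(_ e e0) := fl x xT.
move=> [dl /= dl0 h]; exists dl => // y xy yd; rewrite distrC; apply: h => //=.
by rewrite ger0_norm ?subr_ge0 ?(ltW yd)//; lra.
Qed.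

(** One-sided limits bound the path near each point, and compactness of [0, T] makes the bound
    uniform; the covering property is applied along the filter of large [M]. *)
Lemma cadlag_bounded f : cadlag_path T f -> exists2 M, 0 <= M & forall x, 0 <= x <= T -> `|f x| <= M.
Proof.
move=> cf.
have := @segment_compact R 0 T => /compact_near_coveringP.
move=> /(_ R (+oo : set_system R) (fun M x => 0 <= x <= T -> `|f x| <= M) _).
case.
  move=> x /=; rewrite in_itv /= => /andP[x0 xT].
  have [dr dr0 hr] : exists2 dr, 0 < dr &
      forall y, x < y -> y < x + dr -> y <= T -> `|f y| <= `|f x| + 1.
    have [xlT|] := ltP x T; last first.
      move=> Tx; exists 1 => // y xy _ yT.
      by move: (le_lt_trans Tx xy); rewrite ltNge yT.
    have [|dl dl0 h] := @cadlag_right f x cf _ 1 ltr01; first by rewrite x0.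
    exists dl => // y xy yd _; have := h y xy yd.
    have := ler_normD (f y - f x) (f x); rewrite subrK; lra.
  have [dl dl0 hl] : exists2 dl, 0 < dl &
      forall y, x - dl < y -> y < x -> 0 <= y -> `|f y| <= `|left_lim f x| + 1.
    have [x0'|] := ltP 0 x; last first.
      move=> x0'; exists 1 => // y _ yx y0.
      by move: (lt_le_trans yx x0'); rewrite ltNge y0.
    have [|dl dl0 h] := @cadlag_left f x cf _ 1 ltr01; first by rewrite x0'.
    exists dl => // y xy yd _; have := h y xy yd.
    have := ler_normD (f y - left_lim f x) (left_lim f x); rewrite subrK; lra.
  near=> y M => /= /andP[y0 yT].
  have Mx : `|f x| + `|left_lim f x| + 1 <= M.
    by near: M; apply: nbhs_pinfty_ge; exact: num_real.
  have yx : `|x - y| < Num.min dl dr.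
    by near: y; apply: (@cvgr_dist_lt _ _ _ (nbhs x) _ id x) => //; rewrite lt_min dl0.
  move: yx; rewrite lt_min !ltr_norml => /andP[/andP[h1 h2] /andP[h3 h4]].
  have n1 := normr_ge0 (f x); have n2 := normr_ge0 (left_lim f x).
  have [xy|yx|xy] := ltgtP (x : R) (y : R); last by rewrite -xy; lra.
  - have : `|f y| <= `|f x| + 1 by apply: hr => //; lra.
    by lra.
  - have : `|f y| <= `|left_lim f x| + 1 by apply: hl => //; lra.
    by lra.
move=> M [_ /(_ (`|M| + 1))] h.
exists (`|M| + 1); first by rewrite addr_ge0.
have MM : M < `|M| + 1 by have := ler_norm M; lra.
by move=> x xT; apply: (h MM x _ xT); rewrite /= in_itv.
Unshelve. all: end_near. Qed.

Definition no_jump f (a t : R) : Prop := forall s, a < s <= t -> jump f s = 0.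

(** Oscillation over the regular partition of [a, t] into m cells. It involves finitely many values
    of the path; that it holds eventually in m for every [e] characterizes absence of jumps, which
    thereby becomes an event of the filtration. *)
Definition small_osc f (a t e : R) (m : nat) : Prop := forall i, (i < m)%N ->
  `|f (a + i.+1%:R * ((t - a) / m%:R)) - f (a + i%:R * ((t - a) / m%:R))| < e.

Lemma no_jump_left f s : cadlag_path T f -> 0 < s <= T -> jump f s = 0 ->
  forall e, 0 < e -> exists2 dl, 0 < dl & forall y, s - dl < y -> y < s -> `|f y - f s| < e.
Proof.
move=> cf sT /eqP; rewrite /jump subr_eq0 => /eqP ->; exact: cadlag_left.
Qed.

(** Without jumps in ]a, t] the restriction of the path to [a, t] is continuous, hence uniformly
    continuous by compactness. The covering property is applied along m -> oo, as the cell length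
    shrinks. *)
Lemma no_jump_small_osc f (a t : R) : cadlag_path T f -> 0 <= a -> a <= t -> t <= T ->
  no_jump f a t -> forall e, 0 < e -> \forall m \near \oo, small_osc f a t e m.
Proof.
move=> cf a0 at_ tT nj e e0.
have := @segment_compact R a t => /compact_near_coveringP.
move=> /(_ nat \oo (fun m x => forall y, a <= y <= t -> `|y - x| <= (t - a) / m%:R ->
   a <= x <= t -> `|f y - f x| < e) _) h.
have {}h : \forall m \near \oo, forall x y, a <= y <= t -> `|y - x| <= (t - a) / m%:R ->
   a <= x <= t -> `|f y - f x| < e.
  have : \forall m \near \oo, `[a, t] `<=` (fun x => forall y, a <= y <= t ->
     `|y - x| <= (t - a) / m%:R -> a <= x <= t -> `|f y - f x| < e).
    apply: h => x /=; rewrite in_itv /= => /andP[ax xt].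
    have e2 : 0 < e / 2 by rewrite divr_gt0.
    have [dr dr0 hr] : exists2 dr, 0 < dr &
        forall y, x < y -> y < x + dr -> y <= t -> `|f y - f x| < e / 2.
      have [xlt|] := ltP x t; last first.
        move=> tx; exists 1 => // y xy _ yt.
        by move: (le_lt_trans tx xy); rewrite ltNge yt.
      have [|dl dl0 h] := @cadlag_right f x cf _ (e / 2) e2.
        by rewrite (le_trans a0 ax) (lt_le_trans xlt).
      by exists dl => // y xy yd _; exact: h.
    have [dl dl0 hl] : exists2 dl, 0 < dl &
        forall y, x - dl < y -> y < x -> a <= y -> `|f y - f x| < e / 2.
      have [ax'|] := ltP a x; last first.
        move=> xa; exists 1 => // y _ yx ay.
        by move: (lt_le_trans yx xa); rewrite ltNge ay.
      have jx : jump f x = 0 by apply: nj; rewrite ax'.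
      have xT : 0 < x <= T by rewrite (le_lt_trans a0 ax') (le_trans xt).
      have [dl dl0 h] := no_jump_left cf xT jx e2.
      by exists dl => // y xy yd _; exact: h.
    pose dd := Num.min dl dr; have dd0 : 0 < dd by rewrite lt_min dl0.
    have hc y : a <= y <= t -> `|y - x| < dd -> `|f y - f x| < e / 2.
      move=> /andP[ay yt] yd; move: yd; rewrite lt_min !(ltr_norml (y - x)) => /andP[/andP[h1 h2] /andP[h3 h4]].
      have [xy|yx|xy] := ltgtP (x : R) (y : R); last by rewrite -xy subrr normr0.
      - by apply: hr => //; lra.
      - by apply: hl => //; lra.
    near=> z m => /= y ayt yz azt.
    have zx : `|x - z| < dd / 2.
      by near: z; apply: (@cvgr_dist_lt _ _ _ (nbhs x) _ id x) => //; rewrite divr_gt0.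
    have hm : (t - a) / m%:R < dd / 2.
      near: m; near=> m.
      have m0 : 0 < m%:R :> R by rewrite ltr0n; near: m; exact: nbhs_infty_gt.
      rewrite ltr_pdivrMr// -ltr_pdivrMl ?divr_gt0//.
      by near: m; apply: nbhs_infty_gtr.
    have h1 : `|f z - f x| < e / 2 by apply: hc => //; rewrite distrC; lra.
    have h2 : `|f y - f x| < e / 2.
      apply: hc => //; have := ler_normD (y - z) (z - x); rewrite addrA subrK (distrC z); lra.
    have := ler_normB (f y - f x) (f z - f x).
    by rewrite opprB addrA subrK; lra.
  by apply: filterS => m hm x y ayt yx axt; exact: (hm x axt y ayt yx axt).
have m0 : \forall m \near \oo, (0 < m)%N by exact: nbhs_infty_gt.
apply: filterS2 h m0 => m hm m0 i im.
have mR : 0 < m%:R :> R by rewrite ltr0n.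
set hh := (t - a) / m%:R; have hh0 : 0 <= hh by rewrite divr_ge0 ?subr_ge0// ltW.
have ht k : (k <= m)%N -> a <= a + k%:R * hh <= t.
  move=> km; rewrite lerDl mulr_ge0//= -lerBrDl /hh mulrCA ler_piMr ?subr_ge0//.
  by rewrite ler_pdivrMr// mul1r ler_nat.
apply: hm; [exact: ht| |exact/ht/ltnW].
by rewrite -(natr1 i) mulrDl mul1r addrA addrC addrK ger0_norm.
Unshelve. all: end_near. Qed.

(** Some cell has its left end strictly before [s] and its right end at or after [s]; as the mesh
    shrinks, the increment over this cell tends to the jump at [s]. *)
Lemma small_osc_no_jump f (a t : R) : cadlag_path T f -> 0 <= a -> a <= t -> t <= T ->
  (forall e, 0 < e -> \forall m \near \oo, small_osc f a t e m) -> no_jump f a t.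
Proof.
move=> cf a0 at_ tT so s /andP[as_ st].
apply/eqP; rewrite -normr_le0; apply/ler_addgt0Pl => e e0; rewrite addr0.
have e3 : 0 < e / 3 by rewrite divr_gt0.
have s0 : 0 < s <= T by rewrite (le_lt_trans a0 as_) (le_trans st).
have [dl dl0 hl] := @cadlag_left f s cf s0 (e / 3) e3.
have [dr dr0 hr] : exists2 dr, 0 < dr &
    forall y, s < y -> y < s + dr -> y <= t -> `|f y - f s| < e / 3.
  have [slt|] := ltP s t; last first.
    move=> ts; exists 1 => // y sy _ yt.
    by move: (le_lt_trans ts sy); rewrite ltNge yt.
  have [|d d0 h] := @cadlag_right f s cf _ (e / 3) e3.
    by rewrite (le_trans a0 (ltW as_)) (lt_le_trans slt).
  by exists d => // y xy yd _; exact: h.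
pose dd := Num.min dl dr; have dd0 : 0 < dd by rewrite lt_min dl0.
have : \forall m \near \oo, [/\ (0 < m)%N, (t - a) / m%:R < dd & small_osc f a t (e / 3) m].
  near=> m; split.
  - by near: m; exact: nbhs_infty_gt.
  - have m0 : 0 < m%:R :> R by rewrite ltr0n; near: m; exact: nbhs_infty_gt.
    rewrite ltr_pdivrMr// -ltr_pdivrMl//.
    by near: m; apply: nbhs_infty_gtr.
  - by near: m; exact: so.
move=> [m _ /(_ m (leqnn m))] [m0 hdd hm].
have mR : 0 < m%:R :> R by rewrite ltr0n.
move: hdd hm; rewrite /small_osc; set hh := (t - a) / m%:R => hdd hm.
have tE : a + m%:R * hh = t by rewrite /hh mulrCA divff ?gt_eqF// mulr1 subrKC.
have exk : exists k, s <= a + k%:R * hh by exists m; rewrite tE.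
have [] := ex_minnP exk; case=> [|k]; first by rewrite mul0r addr0 leNgt as_.
move=> sk kmin.
have km : (k < m)%N by apply: kmin; rewrite tE.
have ks : a + k%:R * hh < s by rewrite ltNge; apply/negP => /kmin; rewrite ltnn.
have stp : a + k.+1%:R * hh = a + k%:R * hh + hh by rewrite -(natr1 k) mulrDl mul1r addrA.
move: hdd; rewrite lt_min => /andP[hdl hdr].
have h1 : `|f (a + k%:R * hh) - left_lim f s| < e / 3 by apply: hl => //; lra.
have h2 : `|f (a + k.+1%:R * hh) - f s| < e / 3.
  move: sk; rewrite le_eqVlt => /orP[/eqP <-|sk]; first by rewrite subrr normr0.
  apply: hr => //; first by lra.
  rewrite -tE lerD2l ler_wpM2r ?ler_nat// /hh divr_ge0 ?subr_ge0// ltW//.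
have h3 := hm _ km.
rewrite /jump -/(left_lim f s).
have -> : f s - left_lim f s = (f (a + k.+1%:R * hh) - f (a + k%:R * hh)) +
  (f (a + k%:R * hh) - left_lim f s) - (f (a + k.+1%:R * hh) - f s) by ring.
apply: le_trans (ler_normB _ _) _; have := ler_normD (f (a + k.+1%:R * hh) - f (a + k%:R * hh)) (f (a + k%:R * hh) - left_lim f s).
by lra.
Unshelve. all: end_near. Qed.

Definition jumps_finite f : Prop := finite_set (`]0, T] `&` [set s | jump f s != 0]).

Lemma jump_partE f (A B : set R) :
  A `&` [set s | jump f s != 0] = B `&` [set s | jump f s != 0] ->
  \sum_(s \in A) jump f s = \sum_(s \in B) jump f s.
Proof.
move=> AB; suff -> : finite_support 0 A (jump f) = finite_support 0 B (jump f) by [].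
have e : (jump f @^-1` [set~ 0]) = [set s | jump f s != 0].
  by apply/seteqP; split => s /= /eqP.
by rewrite /finite_support e AB.
Qed.

Lemma jump_part_const f (a t : R) : 0 <= a -> a <= t -> no_jump f a t ->
  jump_part f t = jump_part f a.
Proof.
move=> a0 at_ nj; apply: jump_partE; apply/seteqP; split => s /= [];
  rewrite !in_itv /= => /andP[s0 st] js; split => //; rewrite s0 /=.
  rewrite leNgt; apply/negP => as_; move/eqP: js; apply; apply: nj.
  by rewrite as_.
exact: le_trans st at_.
Qed.

Lemma jump_part_step f (x s : R) : jumps_finite f -> 0 <= x -> x < s -> s <= T ->
  (forall u, x < u < s -> jump f u = 0) -> jump f s != 0 ->
  jump_part f s = jump f s + jump_part f x.
Proof.
move=> fin x0 xs sT nj js; rewrite /jump_part.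
rewrite (@jump_partE f `]0, s] (`]0, s] `&` [set s | jump f s != 0])); last first.
  by rewrite -setIA setIid.
rewrite (fsbigD1 s)/=; last 2 first.
- apply: sub_finite_set fin => u [/=]; rewrite !in_itv /= => /andP[-> us] ju; split => //.
  exact: le_trans us sT.
- by split => //; rewrite /= in_itv /= lexx (le_lt_trans x0 xs).
congr (_ + _); apply: jump_partE; apply/seteqP; split => u /=.
  move=> [[[]]]; rewrite in_itv /= => /andP[u0 us] ju us' _; split => //.
  rewrite in_itv /= u0 /= leNgt; apply/negP => xu; move/eqP: ju; apply; apply: nj.
  by rewrite xu lt_neqAle us andbT; apply/eqP.
rewrite !in_itv /= => -[/andP[u0 ux] ju]; split => //; split; first split => //.
  by rewrite u0 (le_trans ux)// ltW.
by move=> us; move: xs; rewrite -us ltNge ux.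
Qed.

Lemma finite_set_left_gap (Z : set R) (s : R) : finite_set Z ->
  exists2 dl, 0 < dl & forall u, s - dl < u < s -> ~ Z u.
Proof.
move=> /finite_seqP[l ->]; elim: l => [|z l [dl dl0 IH]]; first by exists 1.
have [zs|sz] := ltP z s; last first.
  exists dl => // u h /=; rewrite inE => /orP[/eqP uz|]; last exact: IH.
  by move: h sz; rewrite uz => /andP[_]; rewrite ltNge => /negP.
exists (Num.min dl (s - z)); first by rewrite lt_min dl0 subr_gt0.
move=> u /andP[h us] /=; rewrite inE => /orP[/eqP uz|].
  by move: h; rewrite uz ltrBlDr -ltrBlDl lt_min ltxx andbF.
apply: IH; rewrite us andbT; apply: le_lt_trans h.
by rewrite lerD2l lerN2 ge_min lexx.
Qed.

(** Finitely many jumps leave a gap to the left of [s], on which [jump_part f] is constant; its left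
    limit is its value there. *)
Lemma jump_jump_part f s : jumps_finite f -> 0 < s <= T -> jump f s != 0 ->
  jump (jump_part f) s = jump f s.
Proof.
move=> fin /andP[s0 sT] js.
have [dl dl0 gap] := finite_set_left_gap s fin.
rewrite {1}/jump (_ : lim _ = jump_part f s - jump f s); first by rewrite opprB subrKC.
apply/cvg_lim => //; apply: cvg_near_cst; near=> x.
have xs : x < s by near: x; exact: nbhs_left_lt.
have x0 : 0 <= x by apply: ltW; near: x; exact: nbhs_left_gt.
have xd : s - dl < x by near: x; apply: nbhs_left_gt; lra.
suff nj u : x < u < s -> jump f u = 0.
  by rewrite (jump_part_step fin x0 xs sT nj js) addrAC subrr add0r.
move=> /andP[xu us]; apply: contrapT => /eqP ju; apply: (gap u).
  by rewrite us (lt_trans xd xu).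
split => //=; rewrite in_itv /= (le_lt_trans x0 xu) /=.
exact: le_trans (ltW us) sT.
Unshelve. all: end_near. Qed.

(** [Nbar] counts the jumps of [Jsigma], while the increments of sigma are controlled through its
    own jumps. *)
Lemma no_jump_of_jump_part f (a t : R) : jumps_finite f -> 0 <= a -> t <= T ->
  no_jump (jump_part f) a t -> no_jump f a t.
Proof.
move=> fin a0 tT nj s /andP[as_ st]; apply: contrapT => /eqP js.
have s0 : 0 < s <= T by rewrite (le_lt_trans a0 as_) (le_trans st).
move/eqP: (js); apply; rewrite -(jump_jump_part fin s0 js); apply: nj.
by rewrite as_.
Qed.

Lemma njumps_eq0 f (A : set R) : njumps f A = 0%E -> forall s, A s -> jump f s = 0.
Proof.
rewrite /njumps /counting; case: ifPn => [/asboolP fin|//].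
move=> [/eqP]; rewrite pnatr_eq0 => /eqP/size0nil h s As.
apply: contrapT => /eqP js.
move: (in_fset_set fin s); rewrite [RHS]mem_set//.
by change ((s \in finmap.enum_fset (fset_set (A `&` [set s | jump f s != 0]))) = true -> False); rewrite h.
Qed.

Lemma njumps_finite f (A : set R) : (njumps f A < +oo)%E ->
  finite_set (A `&` [set s | jump f s != 0]).
Proof. by rewrite /njumps /counting; case: ifPn => [/asboolP//|_]; rewrite ltxx. Qed.

Lemma njumps_ge0 f (A : set R) : (0 <= njumps f A)%E.
Proof. by rewrite /njumps /counting; case: ifPn => // _; rewrite lee_fin. Qed.

End cadlag_paths.

(** * Riemann sums along right-continuous paths *)

Section riemann_sums.
Context {R : realType}.
Local Notation mu := (@lebesgue_measure R).

Lemma sum_indic_pick (N : nat) (A : nat -> set R) (c : nat -> R) (i : nat) (s : R) :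
  (i < N)%N -> A i s -> (forall j, (j < N)%N -> j != i -> ~ A j s) ->
  \sum_(j < N) c j * \1_(A j) s = c i.
Proof.
move=> iN Ai nA; rewrite (bigD1 (Ordinal iN))//= indicE mem_set// mulr1.
rewrite big1 ?addr0// => j ji; rewrite indicE memNset ?mulr0//.
exact: nA.
Qed.

Lemma grid_co (h s : R) (N : nat) : 0 < h -> 0 <= s < N%:R * h ->
  exists i, [/\ (i < N)%N, `[i%:R * h, i.+1%:R * h[%classic s &
    forall j, j != i -> ~ `[j%:R * h, j.+1%:R * h[%classic s].
Proof.
move=> h0 /andP[s0 sN].
have ex : exists k, s < k%:R * h by exists N.
have [] := ex_minnP ex; case=> [|i]; first by rewrite mul0r ltNge s0.
move=> si imin; exists i; split; first exact: imin.
  by rewrite /= in_itv /= si andbT leNgt; apply/negP => /imin; rewrite ltnn.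
move=> j ji; rewrite /= in_itv /= => /andP[js sj]; move/negP: ji; apply.
have ij : (i <= j)%N by exact: (imin j.+1 sj).
rewrite eqn_leq ij andbT -ltnS -(ltr_nat R) -(ltr_pM2r h0).
exact: le_lt_trans js si.
Qed.

Lemma grid_oc (h s : R) (N : nat) : 0 < h -> 0 < s <= N%:R * h ->
  exists i, [/\ (i < N)%N, `]i%:R * h, i.+1%:R * h]%classic s &
    forall j, j != i -> ~ `]j%:R * h, j.+1%:R * h]%classic s].
Proof.
move=> h0 /andP[s0 sN].
have ex : exists k, s <= k%:R * h by exists N.
have [] := ex_minnP ex; case=> [|i]; first by rewrite mul0r leNgt s0.
move=> si imin; exists i; split; first exact: imin.
  by rewrite /= in_itv /= si andbT ltNge; apply/negP => /imin; rewrite ltnn.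
move=> j ji; rewrite /= in_itv /= => /andP[js sj]; move/negP: ji; apply.
have ij : (i <= j)%N by exact: (imin j.+1 sj).
rewrite eqn_leq ij andbT -ltnS -(ltr_nat R) -(ltr_pM2r h0).
exact: lt_le_trans js si.
Qed.

(** The cells contain their left ends and the value is read at the right end, so the point of
    evaluation is always strictly to the right of [s]. *)
Definition riemann_step (g : R -> R) (t : R) (N : nat) (s : R) : R :=
  \sum_(i < N) g (i.+1%:R * (t / N%:R)) * \1_(`[i%:R * (t / N%:R), i.+1%:R * (t / N%:R)[) s.

Lemma riemann_step_cvg (g : R -> R) (t s : R) : 0 <= s < t -> right_cont_at g s ->
  riemann_step g t N s @[N --> \oo] --> g s.
Proof.
move=> /andP[s0 st] rc; have t0 : 0 < t := le_lt_trans s0 st.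
apply/cvgrPdist_lt => e e0; have [dl dl0 h] := rc e e0.
near=> N.
have N0 : 0 < N%:R :> R by rewrite ltr0n; near: N; exact: nbhs_infty_gt.
have hN : t / N%:R < dl.
  rewrite ltr_pdivrMr// -ltr_pdivrMl//.
  by near: N; apply: nbhs_infty_gtr.
have h0 : 0 < t / N%:R by rewrite divr_gt0.
have [|i [iN Ai nA]] := @grid_co (t / N%:R) s N h0.
  by rewrite s0 /= mulrCA divff ?mulr1// gt_eqF.
have E := @sum_indic_pick N (fun i => `[i%:R * (t / N%:R), i.+1%:R * (t / N%:R)[%classic)
  (fun i => g (i.+1%:R * (t / N%:R))) i s iN Ai (fun j _ ji => nA j ji).
rewrite /riemann_step E.
move: Ai; rewrite /= in_itv /= => /andP[si si1].
have e1 : i.+1%:R * (t / N%:R) = i%:R * (t / N%:R) + t / N%:R.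
  by rewrite -(natr1 i) mulrDl mul1r.
by rewrite distrC; apply: h => //; rewrite e1; lra.
Unshelve. all: end_near. Qed.

Lemma riemann_step_bounded (g : R -> R) (t M s : R) (N : nat) : 0 < t -> 0 <= s < t ->
  (forall x, 0 <= x <= t -> `|g x| <= M) -> `|riemann_step g t N s| <= M.
Proof.
move=> t0 /andP[s0 st] gM.
have M0 : 0 <= M by apply: le_trans (gM 0 _); rewrite ?lexx ?(ltW t0).
case: N => [|N]; first by rewrite /riemann_step big_ord0 normr0.
have h0 : 0 < t / N.+1%:R by rewrite divr_gt0.
have [|i [iN Ai nA]] := @grid_co (t / N.+1%:R) s N.+1 h0.
  by rewrite s0 /= mulrCA divff ?mulr1.
have E := @sum_indic_pick N.+1 (fun i => `[i%:R * (t / N.+1%:R), i.+1%:R * (t / N.+1%:R)[%classic)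
  (fun i => g (i.+1%:R * (t / N.+1%:R))) i s iN Ai (fun j _ ji => nA j ji).
rewrite /riemann_step E.
apply: gM; rewrite mulr_ge0 ?(ltW h0)//= mulrCA ler_piMr ?(ltW t0)//.
by rewrite ler_pdivrMr// mul1r ler_nat.
Qed.

Lemma measurable_riemann_step (g : R -> R) (t : R) (N : nat) :
  measurable_fun setT (riemann_step g t N).
Proof.
by apply: measurable_sum => i; apply: measurable_funM.
Qed.

Lemma integral_riemann_step (g : R -> R) (t : R) (N : nat) : 0 < t ->
  (\int[mu]_(s in `[0%R, t[) (riemann_step g t N s)%:E =
   (t / N%:R * \sum_(i < N) g (i.+1%:R * (t / N%:R)))%:E)%E.
Proof.
move=> t0; case: N => [|N].
  rewrite big_ord0 mulr0; under eq_integral do rewrite /riemann_step big_ord0.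
  by rewrite integral0.
set h := t / N.+1%:R; have h0 : 0 < h by rewrite divr_gt0.
under eq_integral => s _ do rewrite /riemann_step -sumEFin.
have mE : measurable (`[0, t[%classic : set R) by exact: measurable_itv.
have mI i : measurable (`[i%:R * h, i.+1%:R * h[%classic : set R) by exact: measurable_itv.
have iI i : mu.-integrable `[0, t[ (fun s => (\1_(`[i%:R * h, i.+1%:R * h[) s)%:E).
  apply: measurable_bounded_integrable => //.
  - by rewrite /= lebesgue_measure_itv /= lte_fin t0 -EFinB ltry.
  - exists 1; split => // M M1 s _; rewrite /= indicE ger0_norm//.
    by apply: le_trans (ltW M1); case: (_ \in _).
rewrite integral_sum//; last first.
  move=> i; rewrite (_ : (fun x => _) = (fun x => (g (i.+1%:R * h))%:E *
    (\1_(`[i%:R * h, i.+1%:R * h[) x)%:E)%E); first exact: integrableZl.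
  by apply/funext => x; rewrite EFinM.
rewrite mulr_sumr -sumEFin; apply: eq_bigr => i _.
under eq_integral do rewrite EFinM.
rewrite integralZl// integral_indic// setIidl; last first.
  move=> s /=; rewrite !in_itv /= => /andP[is_ si].
  apply/andP; split; first by apply: le_trans is_; rewrite mulr_ge0 ?(ltW h0).
  apply: lt_le_trans si _.
  by rewrite mulrCA ler_piMr ?(ltW t0)// ler_pdivrMr// mul1r ler_nat.
rewrite /= lebesgue_measure_itv /= lte_fin ltr_pM2r// ltr_nat leqnn -EFinB -EFinM.
by rewrite -mulrBl -(natr1 i) addrAC subrr add0r mul1r mulrC.
Qed.

Lemma countable_measurable_fun (Z : set R) (g : R -> R) : countable Z -> measurable_fun Z g.
Proof.
move=> cZ _ B mB; apply: countable_measurable => [x|].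
  exact: measurable_set1.
by apply: sub_countable cZ; apply: subset_card_le; exact: subIsetl.
Qed.

(* Right endpoints turn right continuity into pointwise convergence of the step functions. *)
Lemma riemann_sum_cvg (g : R -> R) (t M : R) (Z : set R) : 0 < t -> finite_set Z ->
  (forall x, 0 <= x <= t -> `|g x| <= M) ->
  (forall s, 0 <= s < t -> ~ Z s -> right_cont_at g s) ->
  measurable_fun `[0, t] g /\
  t / N%:R * \sum_(i < N) g (i.+1%:R * (t / N%:R)) @[N --> \oo] -->
    \int[mu]_(s in `[0, t]) g s.
Proof.
move=> t0 fZ gM rc.
have cZ : countable Z by exact: finite_set_countable.
have mZ : measurable Z.
  by apply: countable_measurable => // x; exact: measurable_set1.
have muZ : mu Z = 0%E by exact: countable_lebesgue_measure0.
have M0 : 0 <= M by apply: le_trans (gM 0 _); rewrite ?lexx ?(ltW t0).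
have mE : measurable (`[0, t[%classic : set R) by exact: measurable_itv.
have muE : (mu `[0%R, t[ < +oo)%E by rewrite /= lebesgue_measure_itv /= lte_fin t0 -EFinB ltry.
have mg : measurable_fun `[0, t] g.
  (* Outside [Z] and [t] the path is a pointwise limit of step functions; on the remaining finite
     set every function is measurable. *)
  have -> : `[0, t]%classic = (`[0, t[ `\` Z) `|` (`[0, t] `&` (Z `|` [set t])).
    apply/seteqP; split => x /=; rewrite !in_itv /=.
      move=> /andP[x0 xt]; have [Zx|nZx] := pselect (Z x).
        by right; rewrite x0 xt; split => //; left.
      move: xt; rewrite le_eqVlt => /orP[/eqP xt|xt].
        by right; rewrite x0 xt eqxx; split => //; right.
      by left; split => //; rewrite x0.
    by move=> [[/andP[x0 /ltW xt] _]|[/andP[x0 xt] _]]; rewrite x0.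
  have cZt : countable (`[0, t] `&` (Z `|` [set t])).
    apply: (@sub_countable _ _ _ (Z `|` [set t])); first by apply: subset_card_le; exact: subIsetr.
    by apply: finite_set_countable; rewrite finite_setU.
  apply/measurable_funU.
  - exact: measurableD.
  - by apply: countable_measurable => // x; exact: measurable_set1.
  split; last exact: countable_measurable_fun.
  apply: (measurable_fun_cvg (h := riemann_step g t)) => [N|s [/=]].
    by apply: measurable_funTS; exact: measurable_riemann_step.
  by rewrite in_itv /= => st nZ; apply: riemann_step_cvg => //; exact: rc.
split => //.
have mgE : measurable_fun `[0, t[ g.
  by apply: measurable_funS mg => //; by move=> x /=; rewrite !in_itv /= => /andP[-> /ltW].
have [ig cv] : mu.-integrable `[0, t[ (fun s => (g s)%:E) /\
    ((\int[mu]_(s in `[0%R, t[) (riemann_step g t N s)%:E)%E @[N --> \oo] -->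
      (\int[mu]_(s in `[0%R, t[) (g s)%:E)%E).
  suff [] : [/\ mu.-integrable `[0, t[ (fun s => (g s)%:E),
    (\int[mu]_(s in `[0%R, t[) `|(riemann_step g t N s)%:E - (g s)%:E|)%E @[N --> \oo] --> 0%E &
    (\int[mu]_(s in `[0%R, t[) (riemann_step g t N s)%:E)%E @[N --> \oo] -->
      (\int[mu]_(s in `[0%R, t[) (g s)%:E)%E] by [].
  apply: (@dominated_convergence _ _ R mu `[0, t[%classic mE
    (fun N s => (riemann_step g t N s)%:E) (fun s => (g s)%:E) (fun=> M%:E)).
  - by move=> N; apply/measurable_EFinP; apply: measurable_funTS; exact: measurable_riemann_step.
  - exact/measurable_EFinP.
  - exists Z; split => // s /= /not_implyP[]; rewrite in_itv /= => st h.
    apply: contrapT => nZ; apply: h; apply/fine_cvgP; split; first by near=> N.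
    by apply: riemann_step_cvg => //; exact: rc.
  - have : mu.-integrable `[0, t[ (EFin \o cst M); last by [].
    apply: measurable_bounded_integrable => //.
    by exists M; split; [exact: num_real|move=> K MK s _ /=; rewrite ger0_norm// ltW].
  - apply: nearW => s N /=; rewrite in_itv /= => st; rewrite lee_fin.
    exact: riemann_step_bounded.
rewrite -(Rintegral_itv_bndo_bndc ig) /Rintegral.
have fE : (\int[mu]_(s in `[0%R, t[) (g s)%:E)%E \is a fin_num by exact: integrable_fin_num ig.
move: cv; rewrite -(fineK fE).
have -> : (fun N => \int[mu]_(s in `[0%R, t[) (riemann_step g t N s)%:E)%E =
    (fun N => (t / N%:R * \sum_(i < N) g (i.+1%:R * (t / N%:R)))%:E).
  by apply/funext => N; exact: integral_riemann_step.
by move=> /fine_cvg.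
Unshelve. all: end_near. Qed.

End riemann_sums.

(** * Limits in probability and moments *)

Section conversions.
Context {R : realType} {d : measure_display} {Omega : measurableType d}.
Variable P : probability Omega R.

Lemma Lnorm_moment (f : Omega -> R) (m : nat) (C : R) : (0 < m)%N -> 0 <= C ->
  ('N[P]_(m%:R)%:E[EFin \o f] <= C%:E)%E ->
  (\int[P]_x (`|f x| ^+ m)%:E <= (C ^+ m)%:E)%E.
Proof.
move=> m0 C0 h.
have mR : m%:R != 0 :> R by rewrite pnatr_eq0 -lt0n.
have <- : (\int[P]_x (`|(EFin \o f) x| `^ m%:R) = \int[P]_x (`|f x| ^+ m)%:E)%E.
  by apply: eq_integral => x _; rewrite /= powR_mulrn.
rewrite -poweR_Lnorm// -powR_mulrn// -poweR_EFin.
by apply: gt0_ler_poweR => //; rewrite ?in_itv/= ?leey ?andbT ?lee_fin ?Lnorm_ge0.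
Qed.

Lemma ereal_sup_lty_bound (I : Type) (D : set I) (f : I -> \bar R) :
  (ereal_sup [set f t | t in D] < +oo)%E ->
  exists2 C : R, 0 <= C & forall t, D t -> (f t <= C%:E)%E.
Proof.
move=> h; exists (Num.max 0 (fine (ereal_sup [set f t | t in D]))).
  by rewrite le_max lexx.
move=> t Dt; have : (f t <= ereal_sup [set f t | t in D])%E.
  by apply: ereal_sup_ubound; exists t.
move: h; case: (ereal_sup _) => [r| |]//= _ h.
  by apply: le_trans h _; rewrite lee_fin le_max lexx orbT.
by apply: le_trans h _; rewrite leNye.
Qed.

(** The hypothesis concerns p > 1; the order m + 2 exceeds 1 for every [m] and controls the order
    [m]. *)
Lemma sup_Lnorm_moments_bounded (I : Type) (D : set I) (Y : I -> Omega -> R) :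
  (forall t, D t -> measurable_fun setT (Y t)) ->
  (forall p : R, 1 < p ->
     (ereal_sup [set ('N[P]_p%:E[EFin \o Y t])%E | t in D] < +oo)%E) ->
  moments_bounded P D Y.
Proof.
move=> mY h; apply: mb_cofinal => // m.
exists m.+2; first by rewrite (leq_trans (leqnSn m)).
have m1 : 1 < m.+2%:R :> R by rewrite ltr1n.
have [C C0 hC] := ereal_sup_lty_bound (h _ m1).
by exists (C ^+ m.+2) => t Dt; apply: Lnorm_moment => //; exact: hC.
Qed.

Lemma moment_Lnorm_le (f : Omega -> R) (p C : R) : 0 < p -> 0 <= C ->
  (\int[P]_x (`|f x| `^ p)%:E <= C%:E)%E ->
  ('N[P]_p%:E[EFin \o f] <= (C `^ p^-1)%:E)%E.
Proof.
move=> p0 C0 h; rewrite unlock -poweR_EFin.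
apply: gt0_ler_poweR; rewrite ?invr_ge0 ?(ltW p0)//.
- by rewrite in_itv /= leey andbT integral_ge0// => x _; exact: poweR_ge0.
- by rewrite in_itv /= leey andbT lee_fin.
Qed.

Lemma measurable_ge_set (f : Omega -> R) (e : R) : measurable_fun setT f ->
  measurable [set x | e <= f x].
Proof.
move=> mf; have -> : [set x | e <= f x] = f @^-1` `[e, +oo[.
  by apply/seteqP; split => x /=; rewrite in_itv /= andbT.
by rewrite -[X in measurable X]setTI; apply: mf.
Qed.

(* Split according to whether V_m is 1-close to V, truncating |V| at L before letting L grow. *)
Lemma cvg_in_prob_moment (V_ : nat -> Omega -> R) (V : Omega -> R) (q : nat) (K : R) :
  (0 < q)%N ->
  (forall m, measurable_fun setT (V_ m)) -> measurable_fun setT V ->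
  cvg_in_prob P V_ V ->
  (forall m, (\int[P]_x (`|V_ m x| ^+ q)%:E <= K%:E)%E) ->
  (\int[P]_x (`|V x| ^+ q)%:E <= (2 ^+ q * (K + 1))%:E)%E.
Proof.
move=> q0 mV_ mV cV hK.
have mmin (L : R) : measurable_fun setT (fun x => (Num.min `|V x| L ^+ q)%:E).
  apply/measurable_EFinP; apply: measurable_funX; apply: measurable_minr => //.
  exact: measurableT_comp.
have mB m : measurable [set x | 1 <= `|V_ m x - V x|].
  apply: measurable_ge_set; apply: measurableT_comp => //; exact: measurable_funB.
have trunc_bound (L : nat) :
    (\int[P]_x (Num.min `|V x| L%:R ^+ q)%:E <= (2 ^+ q * (K + 1))%:E)%E.
  have step m : (\int[P]_x (Num.min `|V x| L%:R ^+ q)%:E <=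
      (2 ^+ q * (K + 1))%:E + (L%:R ^+ q)%:E * P [set x | (1 <= `|V_ m x - V x|)%R])%E.
    apply: (@le_trans _ _ (\int[P]_x ((2 ^+ q)%:E * ((`|V_ m x| ^+ q)%:E + 1%:E) +
        (L%:R ^+ q)%:E * (\1_[set x | (1 <= `|V_ m x - V x|)%R] x)%:E))%E).
      apply: ge0_le_integralT => x; rewrite -?EFinD -?EFinM -?EFinD lee_fin.
        by rewrite exprn_ge0// le_min normr_ge0 ler0n.
      rewrite indicE; have [xB|xB] := boolP (x \in _).
        rewrite mulr1; apply: (@le_trans _ _ (L%:R ^+ q)).
          by rewrite lerXn2r ?nnegrE// ?le_min ?normr_ge0 ?ler0n// ge_min lexx orbT.
        by rewrite lerDr mulr_ge0 ?exprn_ge0 ?addr_ge0 ?exprn_ge0.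
      rewrite mulr0 addr0.
      have hx : `|V_ m x - V x| < 1.
        by rewrite ltNge; apply/negP => h; move/negP: xB; apply; rewrite inE.
      apply: (@le_trans _ _ (`|V x| ^+ q)).
        by rewrite lerXn2r ?nnegrE// ?le_min ?normr_ge0 ?ler0n// ge_min lexx.
      have -> : V x = V_ m x + (V x - V_ m x) by rewrite subrKC.
      apply: le_trans (normrX_add_le _ _ _) _.
      rewrite ler_wpM2l ?exprn_ge0// lerD2l exprn_ile1// distrC ltW//.
    have mVq := measurable_normX q (mV_ m).
    rewrite ge0_integralD//; last 3 first.
    - by move=> x _; rewrite -EFinD -EFinM lee_fin mulr_ge0 ?exprn_ge0 ?addr_ge0 ?exprn_ge0.
    - by apply: emeasurable_funM => //; apply: emeasurable_funD.
    - by apply: emeasurable_funM => //; apply/measurable_EFinP; exact: measurable_indic.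
    rewrite ge0_integralZl_EFin//; last 2 first.
    - by move=> x _; rewrite -EFinD lee_fin addr_ge0 ?exprn_ge0.
    - exact: emeasurable_funD.
    rewrite ge0_integralZl_EFin//; last first.
      by apply/measurable_EFinP; exact: measurable_indic.
    rewrite integral_indic// setIT; apply: leeD => //.
    rewrite EFinM; apply: lee_wpmul2l; first by rewrite lee_fin exprn_ge0.
    rewrite ge0_integralD//.
    rewrite EFinD; apply: leeD => //.
    by rewrite integral_cst// mul1e; exact: probability_le1.
  have cvP := cV 1 ltr01.
  have cvR : ((2 ^+ q * (K + 1))%:E + (L%:R ^+ q)%:E *
      P [set x | (1 <= `|V_ m x - V x|)%R])%E @[m --> \oo] --> (2 ^+ q * (K + 1))%:E.
    rewrite -[X in _ --> X]adde0 -[X in _ --> (_ + X)%E](mule0 (L%:R ^+ q)%:E).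
    apply: cvgeD => //; first exact: cvg_cst.
    by apply: cvgeZl.
  rewrite -(cvg_lim _ cvR)//; apply: lime_ge; first by apply/cvg_ex; eexists; exact: cvR.
  by near=> m; exact: step.
have min_mono x (i j : nat) : (i <= j)%N ->
    ((Num.min `|V x| i%:R ^+ q)%:E <= (Num.min `|V x| j%:R ^+ q)%:E)%E.
  move=> ij; rewrite lee_fin lerXn2r ?nnegrE ?le_min ?normr_ge0 ?ler0n// ge_min lexx/=.
  by rewrite ge_min ler_nat ij orbT.
have min_ge0 x (i : nat) : (0 <= (Num.min `|V x| i%:R ^+ q)%:E)%E.
  by rewrite lee_fin exprn_ge0// le_min normr_ge0 ler0n.
have -> : (\int[P]_x (`|V x| ^+ q)%:E =
    \int[P]_x limn (fun L : nat => (Num.min `|V x| L%:R ^+ q)%:E))%E.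
  apply: eq_integral => x _; apply/esym/cvg_lim => //; apply: cvg_near_cst.
  near=> L; congr (_ ^+ q)%:E; apply/min_idPl; near: L.
  exact: nbhs_infty_ger.
have := @cvg_monotone_convergence _ _ R P setT measurableT
  (fun (L : nat) x => (Num.min `|V x| L%:R ^+ q)%:E) (fun L => mmin L%:R)
  (fun L x _ => min_ge0 x L) (fun x _ i j => min_mono x i j).
move=> /cvg_lim <- //; apply: lime_le.
  by apply: ereal_nondecreasing_is_cvgn => i j ij; apply: ge0_le_integralT => x; auto.
by near=> L; exact: trunc_bound.
Unshelve. all: by end_near.
Qed.

End conversions.

Section limits.
Context {R : realType} {d : measure_display} {Omega : measurableType d}.
Variable P : probability Omega R.

Lemma ae_cvg_in_prob (V_ : nat -> Omega -> R) (V : Omega -> R) :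
  (forall m, measurable_fun setT (V_ m)) -> measurable_fun setT V ->
  {ae P, forall x, V_ m x @[m --> \oo] --> V x} ->
  cvg_in_prob P V_ V.
Proof.
move=> mV_ mV cV e e0.
have mB m : measurable [set x | e <= `|V_ m x - V x|].
  apply: measurable_ge_set; apply: measurableT_comp => //; exact: measurable_funB.
have := @dominated_convergence _ _ R P setT measurableT
  (fun m x => (\1_[set x | e <= `|V_ m x - V x|] x)%:E) (fun=> 0%E) (fun=> 1%E).
move=> []//.
- by move=> m; apply/measurable_EFinP; exact: measurable_indic.
- apply: filterS cV => x cx _; apply: cvg_near_cst.
  have /cvgrPdist_lt/(_ e e0) h := cx.
  near=> m; rewrite indicE memNset//= distrC; apply/negP; rewrite -ltNge.
  by near: m.
- by apply: finite_measure_integrable_cst.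
- by apply/aeW => x m _; rewrite abse_EFin lee_fin indicE; case: (_ \in _); rewrite ?normr1 ?normr0.
move=> _ _; rewrite integral0; apply: cvg_trans; apply: near_eq_cvg.
by near=> m => /=; rewrite integral_indic// setIT.
Unshelve. all: by end_near.
Qed.

(** Transfers moment bounds from elementary sums to their limits; the constant stays uniform in the
    index because the bound on the approximations is. *)
Lemma mb_cvg_in_prob (I : Type) (D : set I) (Y : I -> nat -> Omega -> R)
    (Z : I -> Omega -> R) :
  (forall i, D i -> measurable_fun setT (Z i)) ->
  (forall i, D i -> cvg_in_prob P (Y i) (Z i)) ->
  moments_bounded P [set im : I * nat | D im.1] (fun im => Y im.1 im.2) ->
  moments_bounded P D Z.
Proof.
move=> mZ cZ [mY hY]; apply: mb_cofinal => // m; exists m.+1; first by [].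
have [C hC] := hY m.+1; exists (2 ^+ m.+1 * (C + 1)) => i Di.
apply: (cvg_in_prob_moment (V_ := Y i)) => //; auto.
- by move=> k; apply: (mY (i, k)).
- by move=> k; apply: (hC (i, k)).
Qed.

End limits.

(** * Increments of the drift and of the volatility *)

Section drift_and_volatility_increments.
Context {R : realType} {d : measure_display} {Omega : measurableType d}.
Variables (P : probability Omega R) (T : R) (F : R -> set (set Omega)).
Hypotheses (T0 : 0 < T) (filF : filtration T F).

Lemma filtration_sigma t : 0 <= t <= T -> sigma_algebra setT (F t).
Proof. by case: filF => h _ /h[]. Qed.

Lemma filtration_measurable t : 0 <= t <= T -> F t `<=` @measurable d Omega.
Proof. by case: filF => h _ /h[]. Qed.

Lemma filtration_sub s t : 0 <= s -> s <= t -> t <= T -> F s `<=` F t.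
Proof. by case: filF => _; apply. Qed.

Lemma adapted_measurable (Y : R -> Omega -> R) t : adapted T F Y -> 0 <= t <= T ->
  measurable_fun setT (Y t).
Proof.
move=> aY tT; apply: measurable_wrt_measurable (aY t tT).
exact: filtration_measurable.
Qed.

Lemma adapted_le (Y : R -> Omega -> R) s t : adapted T F Y -> 0 <= s -> s <= t -> t <= T ->
  measurable_wrt (F t) (Y s).
Proof.
move=> aY s0 st tT; apply: measurable_wrt_sub (aY s _); first exact: filtration_sub.
by rewrite s0 (le_trans st).
Qed.

(** The partition criterion writes the event by countable unions and intersections of conditions on
    the values of [Y] at times in [a, t]. *)
Lemma no_jump_adapted (Y : R -> Omega -> R) (a t : R) : cadlag T Y -> adapted T F Y ->
  0 <= a -> a <= t -> t <= T -> F t [set x | no_jump (Y ^~ x) a t].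
Proof.
move=> cY aY a0 at_ tT.
have tI : 0 <= t <= T by rewrite tT (le_trans a0).
have sG := filtration_sigma tI.
have -> : [set x | no_jump (Y ^~ x) a t] =
    \bigcap_q \bigcup_m0 \bigcap_m \bigcap_i [set x |
      (m0 <= m)%N -> (i < m)%N ->
      `|Y (a + i.+1%:R * ((t - a) / m%:R)) x - Y (a + i%:R * ((t - a) / m%:R)) x|
        < q.+1%:R^-1].
  apply/seteqP; split => x /= hx.
    move=> q _; have q0 : 0 < q.+1%:R^-1 :> R by rewrite invr_gt0.
    have [m0 _ h] := no_jump_small_osc (cY x) a0 at_ tT hx q0.
    by exists m0 => // m _ i _ m0m im; apply: h.
  apply: (small_osc_no_jump (cY x)) => // e e0.
  have [q qe] : exists q : nat, q.+1%:R^-1 < e.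
    have [q _ h] := near_infty_natSinv_lt (PosNum e0); exists q.
    exact: (h q (leqnn q)).
  have [m0 _ h] := hx q I; exists m0 => // m m0m i im.
  exact: lt_trans (h m I i I m0m im) qe.
suff : measurable (\bigcap_q \bigcup_m0 \bigcap_m \bigcap_i [set x : g_sigma_algebraType (F t) |
      (m0 <= m)%N -> (i < m)%N ->
      `|Y (a + i.+1%:R * ((t - a) / m%:R)) x - Y (a + i%:R * ((t - a) / m%:R)) x|
        < q.+1%:R^-1]).
  by rewrite measurable_g_measurableTypeE.
apply: bigcapT_measurable => q; apply: bigcupT_measurable => m0.
apply: bigcapT_measurable => m; apply: bigcapT_measurable => i.
have [m0m|m0m] := boolP (m0 <= m)%N; last first.
  by rewrite (_ : [set _ | _] = setT)//; apply/seteqP; split.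
have [im|im] := boolP (i < m)%N; last first.
  by rewrite (_ : [set _ | _] = setT)//; apply/seteqP; split.
have mm : (0 < m%:R :> R) by rewrite ltr0n (leq_ltn_trans _ im).
have pt j : (j <= m)%N -> 0 <= a + j%:R * ((t - a) / m%:R) <= t.
  move=> jm; have h0 : 0 <= t - a by rewrite subr_ge0.
  have j1 : j%:R <= m%:R :> R by rewrite ler_nat.
  rewrite addr_ge0 ?mulr_ge0 ?divr_ge0// ?(ltW mm)//=.
  rewrite mulrCA -lerBrDl ler_piMr// ler_pdivrMr// mul1r//.
have mpt j : (j <= m)%N -> measurable_fun [set: g_sigma_algebraType (F t)]
    (Y (a + j%:R * ((t - a) / m%:R))).
  by move=> /pt/andP[p0 p1]; apply/(measurable_wrtP _ sG); exact: adapted_le.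
rewrite (_ : [set _ | _] = ~` [set x : g_sigma_algebraType (F t) | q.+1%:R^-1 <=
  `|Y (a + i.+1%:R * ((t - a) / m%:R)) x - Y (a + i%:R * ((t - a) / m%:R)) x|]); last first.
  apply/seteqP; split => x /=.
    by move=> /(_ isT isT) h; apply/negP; rewrite -ltNge.
  by move=> /negP; rewrite -ltNge.
apply: measurableC; apply: measurable_ge_set.
by apply: measurableT_comp => //; apply: measurable_funB; apply: mpt => //; exact: ltnW.
Qed.

(** Without jumps in ]a, t] the jump part is the same at both ends, so the increment of sigma is
    that of [sigma_tilde], to which the bound of order |t - s|^(1/2) applies. *)
Lemma mb_sigma_increment (sigma : R -> Omega -> R) :
  cadlag T sigma -> adapted T F sigma ->
  (forall p : R, 1 < p -> exists C : R, forall s t : R, 0 <= s <= T -> 0 <= t <= T ->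
       ('N[P]_p%:E[EFin \o (fun omega =>
           sigma_tilde sigma t omega - sigma_tilde sigma s omega)%R]
        <= (C * `|t - s| `^ 2^-1)%:E)%E) ->
  moments_bounded P [set at_ : R * R | 0 <= at_.1 /\ at_.1 < at_.2 <= T]
    (fun at_ x => (Num.sqrt (at_.2 - at_.1))^-1 *
      (\1_[set x | no_jump (sigma ^~ x) at_.1 at_.2] x * (sigma at_.2 x - sigma at_.1 x))).
Proof.
move=> cs as_ h.
have mNJ a t : 0 <= a -> a < t <= T -> measurable_fun setT
    (fun x => \1_[set x | no_jump (sigma ^~ x) a t] x * (sigma t x - sigma a x)).
  move=> a0 /andP[at_ tT]; have t0 := le_trans a0 (ltW at_).
  apply: measurable_funM.
    apply: measurable_indic; apply: (@filtration_measurable t); first by rewrite t0.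
    by apply: no_jump_adapted => //; exact: ltW.
  by apply: measurable_funB; apply: adapted_measurable => //; rewrite ?t0 ?a0//= ltW ?(lt_le_trans at_).
apply: mb_cofinal => [[a t] /= [a0 atT]|m].
  by apply: measurable_funM => //; exact: mNJ.
exists m.+2; first by rewrite (leq_trans (leqnSn m)).
have m1 : 1 < m.+2%:R :> R by rewrite ltr1n.
have [C hC] := h _ m1; exists (`|C| ^+ m.+2) => -[a t] /= [a0 /andP[at_ tT]].
have s0 : 0 < Num.sqrt (t - a) by rewrite sqrtr_gt0 subr_gt0.
have t0 := le_trans a0 (ltW at_).
have hM : (\int[P]_x (`|\1_[set x | no_jump (sigma ^~ x) a t] x *
    (sigma t x - sigma a x)| ^+ m.+2)%:E <= ((`|C| * Num.sqrt (t - a)) ^+ m.+2)%:E)%E.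
  apply: (@le_trans _ _ (\int[P]_x
      (`|sigma_tilde sigma t x - sigma_tilde sigma a x| ^+ m.+2)%:E)%E).
    apply: ge0_le_integralT => x; rewrite lee_fin ?exprn_ge0// lerXn2r ?nnegrE//.
    rewrite indicE; have [|] := boolP (x \in _); last by rewrite mul0r normr0.
    rewrite inE /= => nj; rewrite mul1r /sigma_tilde /Jsigma.
    rewrite (jump_part_const a0 (ltW at_) nj).
    by rewrite [X in `|X|](_ : _ = sigma t x - jump_part (sigma^~ x) a -
      (sigma a x - jump_part (sigma^~ x) a))//; ring.
  apply: Lnorm_moment => //.
  apply: le_trans (hC a t _ _) _; rewrite ?a0 ?t0 ?tT ?(ltW (lt_le_trans at_ tT))//.
  rewrite lee_fin gtr0_norm ?subr_gt0// powR12_sqrt ?subr_ge0 ?(ltW at_)//.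
  by rewrite ler_wpM2r ?sqrtr_ge0// ler_norm.
under eq_integral => x _ do rewrite normrM normfV (gtr0_norm s0) exprMn EFinM.
rewrite ge0_integralZl_EFin//; last first.
  by apply: measurable_normX; apply: mNJ => //; rewrite at_.
apply: le_trans (lee_wpmul2l _ hM) _; first by rewrite lee_fin exprn_ge0// invr_ge0 ltW.
by rewrite -EFinM lee_fin exprMn mulrCA -exprMn mulVf ?gt_eqF// expr1n mulr1.
Qed.


Lemma grid0 n : grid T n 0 = 0 :> R.
Proof. by rewrite /grid mul0r mul0r. Qed.

Lemma grid_ge0 n k : 0 <= grid T n k :> R.
Proof. by rewrite /grid divr_ge0// mulr_ge0// ltW. Qed.

Lemma grid_leT n k : (0 < n)%N -> (k <= n)%N -> grid T n k <= T :> R.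
Proof.
move=> n0 kn; rewrite /grid ler_pdivrMr ?ltr0n// mulrC ler_wpM2l ?(ltW T0)//.
by rewrite ler_nat.
Qed.

Lemma mesh_point n k (m i : nat) : (0 < n)%N -> (k <= n)%N -> (i <= k * m.+1)%N ->
  0 <= i%:R * (T / (n * m.+1)%:R) <= T.
Proof.
move=> n0 kn ik; have nm : 0 < (n * m.+1)%:R :> R by rewrite ltr0n muln_gt0 n0.
rewrite mulr_ge0 ?divr_ge0 ?(ltW T0) ?(ltW nm)//= mulrCA ler_piMr ?(ltW T0)//.
by rewrite ler_pdivrMr// mul1r ler_nat (leq_trans ik)// leq_mul2r kn orbT.
Qed.

Lemma grid_mesh n k (m : nat) : (0 < k)%N ->
  grid T n k / (k * m.+1)%:R = T / (n * m.+1)%:R :> R.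
Proof.
move=> k0; rewrite /grid !natrM !invfM.
have kR : k%:R != 0 :> R by rewrite pnatr_eq0 -lt0n.
have nz : m.+1%:R != 0 :> R by [].
case: (eqVneq (n%:R : R) 0) => [->|nR]; first by rewrite invr0 mul0r !mulr0 mul0r.
by move: (m.+1%:R : R) nz => z nz; field; rewrite kR nR nz.
Qed.

(* The meshes T/(n(m+1)) are common to all grid intervals of rank n. *)
Lemma riemann_mesh_cvg (g : R -> R) n k : cadlag_path T g -> (0 < n)%N -> (k <= n)%N ->
  T / (n * m.+1)%:R * \sum_(i < k * m.+1) g (i.+1%:R * (T / (n * m.+1)%:R)) @[m --> \oo]
    --> \int[lebesgue_measure]_(s in `[0, grid T n k]) g s.
Proof.
move=> cg n0 kn; case: (posnP k) => [->|k0].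
  rewrite grid0 set_itv1 Rintegral_set1.
  apply: cvg_near_cst; near=> m; by rewrite mul0n big_ord0 mulr0.
have t0 : 0 < grid T n k :> R by rewrite /grid divr_gt0 ?mulr_gt0 ?ltr0n.
have tT := grid_leT n0 kn.
have [M M0 gM] := cadlag_bounded cg.
have [] := @riemann_sum_cvg R g (grid T n k) M set0 t0 (finite_set0 _).
- by move=> x /andP[x0 xt]; apply: gM; rewrite x0 (le_trans xt).
- by move=> s /andP[s0 st] _; apply: (cadlag_right cg); rewrite s0 (lt_le_trans st).
move=> _ h.
have kk : (k * m.+1)%N @[m --> \oo] --> \oo.
  apply/cvgnyPge => A; near=> m; rewrite (@leq_trans m.+1)//; last by rewrite leq_pmull.
  by rewrite ltnW// ltnS; near: m; exact: nbhs_infty_ge.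
have := cvg_comp _ _ kk h; apply: cvg_trans; apply: near_eq_cvg.
by near=> m => /=; rewrite grid_mesh.
Unshelve. all: by end_near.
Qed.

(** The integral is a pointwise limit of Riemann sums, each a finite combination of random
    variables. *)
Lemma measurable_drift (b : R -> Omega -> R) n k : cadlag T b -> adapted T F b ->
  (0 < n)%N -> (k <= n)%N ->
  measurable_fun setT (fun x => \int[lebesgue_measure]_(s in `[0, grid T n k]) b s x).
Proof.
move=> cb ab n0 kn.
apply: (measurable_fun_cvg (h := fun m x => T / (n * m.+1)%:R *
  \sum_(i < k * m.+1) b (i.+1%:R * (T / (n * m.+1)%:R)) x)); last first.
  by move=> x _; exact: riemann_mesh_cvg.
move=> m; apply: measurable_funM => //; apply: measurable_sum => -[i ik] /=.
by apply: adapted_measurable => //; exact: (mesh_point n0 kn ik).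
Qed.

(** On the mesh, n times the Riemann sum over one grid interval is T times the mean of [b] over m +
    1 points; by Jensen's inequality its moments are bounded uniformly in m. *)
Lemma mb_drift_increment (b : R -> Omega -> R) : cadlag T b -> adapted T F b ->
  moments_bounded P [set t | 0 <= t <= T] b ->
  moments_bounded P [set nk : nat * nat | (0 < nk.2 <= nk.1)%N]
    (fun nk x => nk.1%:R * (\int[lebesgue_measure]_(s in `[0, grid T nk.1 nk.2]) b s x -
      \int[lebesgue_measure]_(s in `[0, grid T nk.1 nk.2.-1]) b s x)).
Proof.
move=> cb ab mb.
have mD (n k : nat) : (0 < k <= n)%N -> [/\ (0 < n)%N, (k <= n)%N & (k.-1 <= n)%N].
  by move=> /andP[k0 kn]; rewrite (leq_trans k0 kn) kn (leq_trans (leq_pred k)).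
pose S n k m x := T / (n * m.+1)%:R *
  \sum_(i < k * m.+1) b (i.+1%:R * (T / (n * m.+1)%:R)) x.
have pt (n k m i : nat) : (0 < k <= n)%N -> (i < k * m.+1)%N ->
    0 <= i.+1%:R * (T / (n * m.+1)%:R) <= T.
  move=> kn ik; have [n0 {}kn _] := mD _ _ kn.
  exact: (mesh_point n0 kn ik).
have Sdiff n k m x : (0 < k <= n)%N -> n%:R * (S n k m x - S n k.-1 m x) =
    T * ((size (iota (k.-1 * m.+1) m.+1))%:R^-1 *
      \sum_(i <- iota (k.-1 * m.+1) m.+1) b (i.+1%:R * (T / (n * m.+1)%:R)) x).
  move=> kn; have [n0 _ _] := mD _ _ kn; case: k kn => [//|k] _; rewrite [k.+1.-1]/=.
  rewrite /S -mulrBr -!(big_mkord xpredT (fun i => b (i.+1%:R * (T / (n * m.+1)%:R)) x)).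
  rewrite (@big_cat_nat _ _ _ (k * m.+1)%N 0%N (k.+1 * m.+1)%N) ?leq_mul2r ?leqnSn ?orbT// addrC addKr.
  rewrite size_iota {1}/index_iota -mulnBl subSnn mul1n natrM invfM.
  have nR : n%:R != 0 :> R by rewrite pnatr_eq0 -lt0n.
  by rewrite !mulrA (mulrC n%:R) mulfK.
apply: (mb_cvg_in_prob (Y := fun nk m x => nk.1%:R * (S nk.1 nk.2 m x - S nk.1 nk.2.-1 m x))).
- move=> [n k] /= /mD[n0 kn k1n]; apply: measurable_funM => //.
  by apply: measurable_funB; exact: measurable_drift.
- move=> [n k] /= kn; have [n0 kn' k1n] := mD _ _ kn.
  have mS m j : (j <= k)%N -> measurable_fun setT (S n j m).
    move=> jk; apply: measurable_funM => //; apply: measurable_sum => -[i ik] /=.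
    apply: adapted_measurable => //; apply: (pt _ k) => //.
    by rewrite (leq_trans ik)// leq_mul2r jk orbT.
  apply: ae_cvg_in_prob.
  + move=> m; apply: measurable_funM => //; apply: measurable_funB; apply: mS => //.
    exact: leq_pred.
  + by apply: measurable_funM => //; apply: measurable_funB; exact: measurable_drift.
  + by apply: aeW => x; apply: cvgMr; apply: cvgB; exact: riemann_mesh_cvg.
apply: (mb_eq (Z := fun im x => T * ((size (iota (im.1.2.-1 * im.2.+1) im.2.+1))%:R^-1 *
      \sum_(i <- iota (im.1.2.-1 * im.2.+1) im.2.+1)
        b (i.+1%:R * (T / (im.1.1 * im.2.+1)%:R)) x))).
  by move=> [[n k] m] x /= kn; exact: Sdiff.
apply: (@mb_scale _ _ _ _ _ _ (fun=> T) T); first by move=> i _; rewrite gtr0_norm.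
apply: (@mb_mean _ _ _ _ _ _ (fun im : nat * nat * nat => iota (im.1.2.-1 * im.2.+1) im.2.+1)
  (fun im i => b (i.+1%:R * (T / (im.1.1 * im.2.+1)%:R)))).
  by move=> i _; rewrite size_iota.
apply: (mb_reindex (f := fun ii : nat * nat * nat * nat =>
   ii.2.+1%:R * (T / (ii.1.1.1 * ii.1.2.+1)%:R))) mb => -[[[n k] m] i] /= [kn].
rewrite -[_ :: _]/(iota (k.-1 * m.+1)%N m.+1) mem_iota => /andP[_ ik]; apply: (pt _ k) => //.
by move: kn ik => /andP[]; case: k => //= k _ _; rewrite mulSn addnC.
Qed.

End drift_and_volatility_increments.

(** * Approximation of the Ito integral *)

Section standard_normal_variables.
Context {R : realType} {d : measure_display} {Omega : measurableType d}.
Variable P : probability Omega R.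
Local Notation N01 := (normal_prob (0 : R) 1).

Definition std_normal (xi : Omega -> R) : Prop :=
  measurable_fun setT xi /\
  forall B : set R, measurable B -> P (xi @^-1` B) = N01 B.

Lemma std_normal_integral (xi : Omega -> R) (f : R -> \bar R) : std_normal xi ->
  measurable_fun setT f -> (forall y, (0 <= f y)%E) ->
  (\int[P]_x f (xi x) = \int[N01]_y f y)%E.
Proof.
move=> [mxi lxi] mf f0.
have := @ge0_integral_pushforward _ _ _ (measurableTypeR R) R xi mxi P setT f measurableT mf (fun y _ => f0 y).
move=> e; rewrite -[LHS]e.
by apply: eq_measure_integral => A mA _; exact: lxi.
Qed.

(** The constant depends on the order only, and is at least 1 as the martingale estimate
    requires. *)
Lemma std_normal_moment (k : nat) : exists2 C : R, 1 <= C &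
  forall xi, std_normal xi -> (\int[P]_x (`|xi x| ^+ k)%:E <= C%:E)%E.
Proof.
have [C hC] := @normal_moment R k; exists (Num.max 1 C); first by rewrite le_max lexx.
move=> xi nxi; rewrite (std_normal_integral (f := fun y => (`|y| ^+ k)%:E))//.
- by apply: le_trans hC _; rewrite lee_fin le_max lexx orbT.
- exact: measurable_normX.
Qed.

Lemma std_normal_integrable (xi : Omega -> R) : std_normal xi ->
  P.-integrable setT (EFin \o xi).
Proof.
move=> nxi; have [mxi _] := nxi; apply/integrableP; split; first exact/measurable_EFinP.
have [C _ hC] := std_normal_moment 1; apply: le_lt_trans (hC _ nxi) _; exact: ltry.
Qed.

Lemma std_normal_mean (xi : Omega -> R) : std_normal xi -> (\int[P]_x (xi x)%:E = 0)%E.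
Proof.
move=> nxi; have [mxi lxi] := nxi.
have := @integral_pushforward _ _ _ (measurableTypeR R) R xi mxi P setT (EFin : R -> \bar R).
rewrite preimage_setT => /(_ _ (std_normal_integrable nxi) measurableT) <-//.
rewrite -[RHS](@normal_mean R); apply: eq_measure_integral => A mA _.
exact: lxi.
Qed.

End standard_normal_variables.

Section wiener_increments.
Context {R : realType} {d : measure_display} {Omega : measurableType d}.
Variables (P : probability Omega R) (T : R) (F : R -> set (set Omega)).
Variable w : R -> Omega -> R.
Hypotheses (T0 : 0 < T) (filF : filtration T F) (wF : wiener P T F w).

Definition winc (s t : R) (x : Omega) : R := (w t x - w s x) / Num.sqrt (t - s).

Lemma wincE s t x : s < t -> w t x - w s x = Num.sqrt (t - s) * winc s t x.
Proof.
by move=> st; rewrite /winc mulrC divfK// gt_eqF// sqrtr_gt0 subr_gt0.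
Qed.

Lemma winc_adapted s t : 0 <= s -> s < t -> t <= T -> measurable_wrt (F t) (winc s t).
Proof.
move=> s0 st tT; have [aw _ _ _ _] := wF.
have tI : 0 <= t <= T by rewrite tT (le_trans s0 (ltW st)).
have sG := filtration_sigma filF tI.
apply: measurable_wrtM => //; last exact: measurable_wrt_cst.
apply: measurable_wrtB => //; first exact: aw.
apply: (adapted_le filF) => //; exact: ltW.
Qed.

Lemma winc_std_normal s t : 0 <= s -> s < t -> t <= T -> std_normal P (winc s t).
Proof.
move=> s0 st tT; have tI : 0 <= t <= T by rewrite tT (le_trans s0 (ltW st)).
split.
  apply: measurable_wrt_measurable (winc_adapted s0 st tT).
  exact: (filtration_measurable filF).
move=> B mB; have [_ _ _ lw _] := wF.
have ss : 0 < Num.sqrt (t - s) by rewrite sqrtr_gt0 subr_gt0.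
rewrite -(normal_prob_scale ss mB) -(lw s t s0 st tT)//.
rewrite -[X in measurable X]setTI; apply: measurable_funM => //.
Qed.

Lemma winc_independent s t : 0 <= s -> s < t -> t <= T ->
  independent_of P (F s) (winc s t).
Proof.
move=> s0 st tT A B FA mB; have [_ _ _ _ iw] := wF.
apply: (iw s t s0 st tT A ((fun y => y / Num.sqrt (t - s)) @^-1` B) FA).
by rewrite -[X in measurable X]setTI; apply: measurable_funM.
Qed.

End wiener_increments.

Section limits_in_probability.
Context {R : realType} {d : measure_display} {Omega : measurableType d}.
Variable P : probability Omega R.

Lemma cvg_in_prob_dominated (A_ B_ V_ : nat -> Omega -> R) (A B V : Omega -> R) (C : R) :
  (forall m, measurable_fun setT (A_ m)) -> measurable_fun setT A ->
  (forall m, measurable_fun setT (B_ m)) -> measurable_fun setT B ->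
  (forall m, measurable_fun setT (V_ m)) -> measurable_fun setT V ->
  0 < C ->
  (forall m x, `|V_ m x - V x| <= C * (`|A_ m x - A x| + `|B_ m x - B x|)) ->
  cvg_in_prob P A_ A -> cvg_in_prob P B_ B -> cvg_in_prob P V_ V.
Proof.
move=> mA_ mA mB_ mB mV_ mV C0 h cA cB e e0.
have e'0 : 0 < e / C / 2 by rewrite !divr_gt0.
have mS (f_ : nat -> Omega -> R) (f : Omega -> R) m c : measurable_fun setT (f_ m) ->
    measurable_fun setT f -> measurable [set x | c <= `|f_ m x - f x|].
  move=> mf_ mf; apply: measurable_ge_set; apply: measurableT_comp => //.
  exact: measurable_funB.
have hS : (P [set x | (e / C / 2 <= `|A_ m x - A x|)%R] +
    P [set x | (e / C / 2 <= `|B_ m x - B x|)%R])%E @[m --> \oo] --> 0%E.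
  rewrite -[X in _ --> X]adde0; apply: cvgeD => //; [exact: cA|exact: cB].
apply: (squeeze_cvge _ (cvg_cst 0%E) hS); near=> m.
rewrite measure_ge0/=; apply: le_trans (measureU2 P _ _) => //; try exact: mS.
apply: le_measure; rewrite ?inE; first exact: mS.
  by apply: measurableU; exact: mS.
move=> x /= ex; apply: contrapT => /not_orP[/negP + /negP].
rewrite -!ltNge => h1 h2; move: (le_trans ex (h m x)); apply/negP; rewrite -ltNge.
rewrite mulrC -ltr_pdivlMr//; lra.
Unshelve. all: by end_near.
Qed.

End limits_in_probability.

(** * Approximation of the volatility by simple processes *)

Section mesh_process.
Context {R : realType} {d : measure_display} {Omega : measurableType d}.
Variables (P : probability Omega R) (T : R) (F : R -> set (set Omega)).
Variable sigma : R -> Omega -> R.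
Hypotheses (T0 : 0 < T) (filF : filtration T F).
Hypotheses (cs : cadlag T sigma) (adap : adapted T F sigma).
Local Notation mu := (@lebesgue_measure R).

(** Values at left ends keep the process predictable. It is used with N = n(m+1), for which the mesh
    refines the grid of rank n. *)
Definition mesh_process (N : nat) : @simple_process R d Omega :=
  SimpleProcess N (fun i => i%:R * (T / N%:R)) (fun i => sigma (i%:R * (T / N%:R))).

Lemma mesh_time (N i : nat) : (0 < N)%N -> (i <= N)%N -> 0 <= i%:R * (T / N%:R) <= T.
Proof.
by case: N => // N _ iN; have := @mesh_point R T T0 1 1 N i isT isT; rewrite !mul1n; apply.
Qed.

Lemma mesh_process_predictable N : (0 < N)%N -> simple_predictable T F (mesh_process N).
Proof.
move=> N0; have NR : N%:R != 0 :> R by rewrite pnatr_eq0 -lt0n.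
split => /= [||i iN|i iN].
- by rewrite mul0r.
- by rewrite mulrCA divff// mulr1.
- by rewrite ler_wpM2r ?divr_ge0 ?(ltW T0)// ler_nat.
- by apply: adap; exact: mesh_time (ltnW iN).
Qed.

Lemma mesh_process_valE N i (s : R) x : (0 < N)%N -> (i < N)%N ->
  i%:R * (T / N%:R) < s <= i.+1%:R * (T / N%:R) ->
  sp_val (mesh_process N) s x = sigma (i%:R * (T / N%:R)) x.
Proof.
move=> N0 iN /andP[s1 s2]; have h0 : 0 < T / N%:R by rewrite divr_gt0 ?ltr0n.
rewrite /sp_val /=.
apply: (@sum_indic_pick _ N (fun i => `]i%:R * (T / N%:R), i.+1%:R * (T / N%:R)]%classic)
  (fun i => sigma (i%:R * (T / N%:R)) x)) => //.
  by rewrite /= in_itv /= s1 s2.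
move=> j jN ji; rewrite /= in_itv /= => /andP[s3 s4].
have := lt_le_trans s1 s4; have := lt_le_trans s3 s2.
rewrite !ltr_pM2r// !ltr_nat !ltnS => h1 h2.
by move/eqP: ji; apply; apply/eqP; rewrite eqn_leq h1 h2.
Qed.

Lemma mesh_process_val_cell N (s : R) x : (0 < N)%N -> 0 < s <= T ->
  exists i, [/\ (i < N)%N, i%:R * (T / N%:R) < s <= i.+1%:R * (T / N%:R) &
    sp_val (mesh_process N) s x = sigma (i%:R * (T / N%:R)) x].
Proof.
move=> N0 sT; have h0 : 0 < T / N%:R by rewrite divr_gt0 ?ltr0n.
have NR : N%:R != 0 :> R by rewrite pnatr_eq0 -lt0n.
have [|i [iN + _]] := @grid_oc R (T / N%:R) s N h0.
  by rewrite mulrC divfK.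
rewrite /= in_itv /= => si; exists i; split => //; exact: mesh_process_valE.
Qed.

Lemma mesh_process_val0 N x : sp_val (mesh_process N) 0 x = 0.
Proof.
rewrite /sp_val big1// => i _; rewrite indicE memNset ?mulr0//= in_itv /=.
by rewrite ltNge mulr_ge0// divr_ge0// ltW.
Qed.

Lemma mesh_error_bounded N x M (s : R) : (0 < N)%N -> 0 <= M ->
  (forall s, 0 <= s <= T -> `|sigma s x| <= M) -> 0 <= s <= T ->
  `|(sp_val (mesh_process N) s x - sigma s x) ^+ 2| <= (2 * M) ^+ 2.
Proof.
move=> N0 M0 hM sT; rewrite normrX lerXn2r ?nnegrE ?mulr_ge0//.
apply: le_trans (ler_normB _ _) _; rewrite mulr_natl mulr2n lerD ?hM//.
move: sT => /andP[]; rewrite le_eqVlt => /orP[/eqP <- _|s0 sT].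
  by rewrite mesh_process_val0 normr0.
have [|i [iN _ ->]] := @mesh_process_val_cell N s x N0; first by rewrite s0.
by apply: hM; apply: mesh_time => //; exact: ltnW.
Qed.

(** Away from the mesh points the simple process is locally constant, so the squared error inherits
    right continuity from sigma; its time integral is then a limit of Riemann sums, hence a random
    variable. *)
Lemma mesh_error_right_cont N x (s : R) : (0 < N)%N -> 0 <= s < T ->
  ~ [set i%:R * (T / N%:R) | i in `I_N.+1] s ->
  right_cont_at (fun s => (sp_val (mesh_process N) s x - sigma s x) ^+ 2) s.
Proof.
move=> N0 /andP[s0 sT] nZ e e0.
have s0' : 0 < s.
  rewrite lt_neqAle s0 andbT; apply/eqP => s00; apply: nZ; exists 0%N => //=.
  by rewrite mul0r.
have [|i [iN /andP[i1 i2] iE]] := @mesh_process_val_cell N s x N0.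
  by rewrite s0' ltW.
have {}i2 : s < i.+1%:R * (T / N%:R).
  by rewrite lt_neqAle i2 andbT; apply/eqP => sE; apply: nZ; exists i.+1.
have [M M0 hM] := cadlag_bounded (cs x).
(* The difference of the two squares is at most 4M times the increment of sigma; the added 1 keeps
   the denominator positive when M = 0. *)
have e'0 : 0 < e / (4 * M + 1) by rewrite divr_gt0// ltr_wpDl// mulr_ge0.
have [|dl dl0 hdl] := @cadlag_right _ _ _ s (cs x) _ _ e'0; first by rewrite s0.
exists (Num.min dl (i.+1%:R * (T / N%:R) - s)); first by rewrite lt_min dl0 subr_gt0.
move=> y sy; rewrite addrC -ltrBlDr lt_min => /andP[y1 y2].
have yi : y < i.+1%:R * (T / N%:R) by lra.
have iT : i.+1%:R * (T / N%:R) <= T by have /andP[] := mesh_time N0 iN.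
rewrite iE (@mesh_process_valE N i y)//; last by rewrite (lt_trans i1 sy) ltW.
have hy : `|sigma y x - sigma s x| < e / (4 * M + 1) by apply: hdl => //; lra.
set c := sigma _ x; have cM : `|c| <= M by apply: hM; apply: mesh_time => //; exact: ltnW.
have -> : (c - sigma y x) ^+ 2 - (c - sigma s x) ^+ 2 =
    (sigma y x - sigma s x) * ((sigma y x + sigma s x) - (c + c)) by ring.
have My : `|sigma y x| <= M by apply: hM; apply/andP; split; lra.
have Ms : `|sigma s x| <= M by apply: hM; apply/andP; split; lra.
rewrite normrM; apply: (@le_lt_trans _ _ (`|sigma y x - sigma s x| * (4 * M))).
  rewrite ler_wpM2l// (le_trans (ler_normB _ _))//.
  have := ler_normD (sigma y x) (sigma s x); have := ler_normD c c; lra.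
apply: (@le_lt_trans _ _ (e / (4 * M + 1) * (4 * M))).
  by rewrite ler_wpM2r ?mulr_ge0// ltW.
by rewrite mulrAC ltr_pdivrMr ?ltr_wpDl ?mulr_ge0//; lra.
Qed.

Lemma mesh_error_riemann N x : (0 < N)%N ->
  measurable_fun `[0, T] (fun s => (sp_val (mesh_process N) s x - sigma s x) ^+ 2) /\
  T / N'%:R * \sum_(i < N') (sp_val (mesh_process N) (i.+1%:R * (T / N'%:R)) x -
     sigma (i.+1%:R * (T / N'%:R)) x) ^+ 2 @[N' --> \oo] -->
    \int[mu]_(s in `[0, T]) (sp_val (mesh_process N) s x - sigma s x) ^+ 2.
Proof.
move=> N0; have [M M0 hM] := cadlag_bounded (cs x).
apply: (@riemann_sum_cvg R (fun s => (sp_val (mesh_process N) s x - sigma s x) ^+ 2)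
  T ((2 * M) ^+ 2) [set i%:R * (T / N%:R) | i in `I_N.+1]) => //.
- by apply: finite_image; exact: finite_II.
- by move=> s sT; apply: mesh_error_bounded.
- by move=> s sT nZ; apply: mesh_error_right_cont.
Qed.

Lemma measurable_mesh_error N : (0 < N)%N -> measurable_fun setT
  (fun x => \int[mu]_(s in `[0, T]) (sp_val (mesh_process N) s x - sigma s x) ^+ 2).
Proof.
move=> N0; apply: (measurable_fun_cvg (h := fun N' x => T / N'%:R * \sum_(i < N')
    (sp_val (mesh_process N) (i.+1%:R * (T / N'%:R)) x -
     sigma (i.+1%:R * (T / N'%:R)) x) ^+ 2)); last first.
  by move=> x _; have [] := mesh_error_riemann x N0.
move=> N'; apply: measurable_funM => //; apply: measurable_sum => -[i iN'] /=.
apply: measurable_funX; apply: measurable_funB; last first.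
  by apply: (adapted_measurable filF) => //; apply: mesh_time => //; exact: leq_ltn_trans iN'.
rewrite /sp_val /=; apply: measurable_sum => -[j jN] /=; apply: measurable_funM => //.
by apply: (adapted_measurable filF) => //; apply: mesh_time => //; exact: ltnW.
Qed.

(** Where sigma does not jump, its value at the mesh point to the left converges to the current
    value, and the error is bounded along each path. *)
Lemma mesh_error_cvg (N : nat -> nat) x : (forall m, (0 < N m)%N) -> N m @[m --> \oo] --> \oo ->
  jumps_finite T (sigma ^~ x) ->
  \int[mu]_(s in `[0, T]) (sp_val (mesh_process (N m)) s x - sigma s x) ^+ 2
    @[m --> \oo] --> 0.
Proof.
move=> N0 Noo fJ; have [M M0 hM] := cadlag_bounded (cs x).
have mE : measurable (`[0, T]%classic : set R) by exact: measurable_itv.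
(* At time 0 every simple process vanishes, so 0 is exceptional along with the finitely many jump
   times. *)
pose Z := [set 0] `|` (`]0, T] `&` [set s | jump (sigma ^~ x) s != 0]).
have fZ : finite_set Z by rewrite finite_setU; split.
have cZ : countable Z by exact: finite_set_countable.
have mZ : measurable Z.
  by apply: countable_measurable => // y; exact: measurable_set1.
have muZ : mu Z = 0%E by exact: countable_lebesgue_measure0.
have mT : (mu `[0%R, T] < +oo)%E by rewrite /= lebesgue_measure_itv /= lte_fin T0 -EFinB ltry.
suff [_ _ h] : [/\ mu.-integrable `[0, T] (fun=> 0%E),
    (\int[mu]_(s in `[0%R, T])
      `|((sp_val (mesh_process (N m)) s x - sigma s x) ^+ 2)%:E - 0|)%E @[m --> \oo] --> 0%E &
    (\int[mu]_(s in `[0%R, T])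
      ((sp_val (mesh_process (N m)) s x - sigma s x) ^+ 2)%:E)%E @[m --> \oo] -->
      (\int[mu]_(s in `[0%R, T]) 0%E)%E].
  by move: h; rewrite integral0 => /fine_cvg.
apply: (@dominated_convergence _ _ R mu `[0, T]%classic mE
    (fun m s => ((sp_val (mesh_process (N m)) s x - sigma s x) ^+ 2)%:E) (fun=> 0%E)
    (fun=> ((2 * M) ^+ 2)%:E)) => //.
- by move=> m; apply/measurable_EFinP; have [] := mesh_error_riemann x (N0 m).
- exists Z; split => // s /= /not_implyP[]; rewrite in_itv /= => /andP[s0 sT] h.
  apply: contrapT => nZ; apply: h; apply/fine_cvgP; split; first by near=> m.
  have s0' : 0 < s.
    by rewrite lt_neqAle s0 andbT; apply/eqP => s00; apply: nZ; left.
  have sI : 0 < s <= T by rewrite s0'.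
  have js : jump (sigma ^~ x) s = 0.
    by apply: contrapT => /eqP js; apply: nZ; right.
  apply/cvgrPdist_lt => e e0; have e1 : 0 < Num.sqrt e by rewrite sqrtr_gt0.
  have [dl dl0 hdl] := no_jump_left (cs x) sI js e1.
  near=> m; rewrite /= sub0r normrN normrX.
  have [i [iN /andP[i1 i2] ->]] := mesh_process_val_cell x (N0 m) sI.
  rewrite -[ltRHS]sqr_sqrtr ?(ltW e0)// ltrXn2r ?nnegrE ?(ltW e1)//.
  apply: hdl => //; move: i2; rewrite -natr1 mulrDl mul1r.
  suff : T / (N m)%:R < dl by lra.
  rewrite ltr_pdivrMr ?ltr0n// mulrC -ltr_pdivrMr//.
  near: m; exact: (Noo _ (nbhs_infty_gtr (T / dl))).
- have : mu.-integrable `[0, T] (EFin \o cst ((2 * M) ^+ 2)); last by [].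
  apply: measurable_bounded_integrable => //.
  by exists ((2 * M) ^+ 2); split; [exact: num_real|move=> K MK s _ /=; rewrite ger0_norm ?sqr_ge0// ltW].
- apply: nearW => s m /=; rewrite in_itv /= => st; rewrite lee_fin.
  exact: mesh_error_bounded.
Unshelve. all: end_near. Qed.

Lemma mesh_process_approx (N : nat -> nat) : (forall m, (0 < N m)%N) -> N m @[m --> \oo] --> \oo ->
  {ae P, forall x, jumps_finite T (sigma ^~ x)} ->
  cvg_in_prob P (fun m x => \int[mu]_(s in `[0, T])
    (sp_val (mesh_process (N m)) s x - sigma s x) ^+ 2) (fun=> 0).
Proof.
move=> N0 Noo fJ; apply: ae_cvg_in_prob => //.
- by move=> m; exact: measurable_mesh_error.
- by apply: filterS fJ => x fJx; exact: mesh_error_cvg.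
Qed.

Lemma grid_mesh_time n k m : grid T n k = (k * m.+1)%:R * (T / (n * m.+1)%:R).
Proof.
case: (posnP k) => [->|k0]; first by rewrite grid0 mul0n mul0r.
by rewrite -(grid_mesh T n m k0) mulrC divfK// pnatr_eq0 muln_eq0 negb_or -lt0n k0.
Qed.

(** Grid times are mesh times, so the minimum leaves the cells before [grid T n k] intact and
    collapses the later ones. *)
Lemma mesh_sp_int (w : R -> Omega -> R) n k m x : (0 < n)%N -> (k <= n)%N ->
  sp_int (mesh_process (n * m.+1)) w (grid T n k) x =
  \sum_(i < k * m.+1) sigma (i%:R * (T / (n * m.+1)%:R)) x *
    (w (i.+1%:R * (T / (n * m.+1)%:R)) x - w (i%:R * (T / (n * m.+1)%:R)) x).
Proof.
move=> n0 kn; rewrite /sp_int /=.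
have nm0 : 0 < (n * m.+1)%:R :> R by rewrite ltr0n muln_gt0 n0.
have h0 : 0 < T / (n * m.+1)%:R by rewrite divr_gt0.
rewrite (grid_mesh_time n k m); set h := T / _ in h0 *.
rewrite -!(big_mkord xpredT (fun i => sigma (i%:R * h) x * (w (i.+1%:R * h) x - w (i%:R * h) x))).
rewrite -(big_mkord xpredT (fun i => sigma (i%:R * h) x *
  (w (Num.min (i.+1%:R * h) ((k * m.+1)%:R * h)) x - w (Num.min (i%:R * h) ((k * m.+1)%:R * h)) x))).
rewrite (@big_cat_nat _ _ _ (k * m.+1)%N 0%N (n * m.+1)%N) ?leq_mul2r ?kn ?orbT//=.
rewrite [X in _ + X]big_nat_cond [X in _ + X]big1 ?addr0 => [|i /andP[/andP[ki _] _]]; last first.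
  by rewrite !min_r ?subrr ?mulr0// ler_pM2r// ler_nat// leqW.
apply: eq_big_nat => i /andP[_ ik].
by rewrite !min_l// ler_pM2r// ler_nat// ltnW.
Qed.

End mesh_process.

(** * The martingale part of the increments *)

Section martingale_part.
Context {R : realType} {d : measure_display} {Omega : measurableType d}.
Variables (P : probability Omega R) (T : R) (F : R -> set (set Omega)).
Variables sigma w M : R -> Omega -> R.
Hypotheses (T0 : 0 < T) (filF : filtration T F) (wF : wiener P T F w).
Hypotheses (cs : cadlag T sigma) (adap : adapted T F sigma).
Hypothesis itoM : ito_integral P T F w sigma M.
Hypothesis fJ : {ae P, forall x, jumps_finite T (sigma ^~ x)}.
Hypothesis sigma_increments : moments_bounded P
  [set at_ : R * R | 0 <= at_.1 /\ at_.1 < at_.2 <= T]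
  (fun at_ x => (Num.sqrt (at_.2 - at_.1))^-1 *
    (\1_[set x | no_jump (sigma ^~ x) at_.1 at_.2] x * (sigma at_.2 x - sigma at_.1 x))).

Local Notation NJ a t := [set x | no_jump (sigma ^~ x) a t].

Lemma measurable_no_jump a t : 0 <= a -> a <= t -> t <= T -> measurable (NJ a t).
Proof.
move=> a0 at_ tT; have t0 := le_trans a0 at_.
apply: (filtration_measurable filF (t := t)); first by rewrite t0.
exact: (no_jump_adapted filF).
Qed.

(** The coefficients carry the indicator of no jump up to [tau i], not up to the end of the window,
    so that they are known at time [tau i]. There are m + 1 steps of length h, with (m + 1) h = T/n,
    and the second moment of the volatility increment is of order at most t_k - a. *)
Lemma martingale_mesh_moment (q : nat) : exists C : R, forall (n l k m : nat)
    (h a : R) (tau : nat -> R), (0 < n)%N -> (l < k <= n)%N ->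
  h = T / (n * m.+1)%:R -> a = grid T n l ->
  (forall i, tau i = (k.-1 * m.+1 + i)%:R * h) ->
  (\int[P]_x ((\sum_(i < m.+1) (Num.sqrt h * (\1_(NJ a (tau i)) x *
      (sigma (tau i) x - sigma a x))) * winc w (tau i) (tau i.+1) x) ^+ (2 * q.+1))%:E
   <= ((C * (T / n%:R * (grid T n k - a))) ^+ q.+1)%:E)%E.
Proof.
have [mu1 mu11 hmu1] := std_normal_moment P 2.
have [mu2 mu21 hmu2] := std_normal_moment P (2 * q.+1).
have [_ /(_ (2 * q.+1)%N)[C0 hC0]] := sigma_increments.
(* [mu] bounds both moments that the martingale estimate asks for, and C1 >= 1 ensures C0 <=
   C1^(q+1). *)
pose mu := Num.max mu1 mu2; pose C1 := Num.max 1 C0.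
exists (moment_const q.+1 mu * C1).
move=> n l k m h a tau n0 /andP[lk kn] hE aE tauE.
have h0 : 0 < h by rewrite hE divr_gt0// ltr0n muln_gt0 n0.
have k0 : (0 < k)%N by rewrite (leq_ltn_trans _ lk).
have a0 : 0 <= a by rewrite aE; exact: grid_ge0.
have tauS i : tau i.+1 - tau i = h by rewrite !tauE addnS -natr1; ring.
have tau_lt i : tau i < tau i.+1 by rewrite -subr_gt0 tauS.
have atau i : a <= tau i.
  rewrite aE tauE (grid_mesh_time T n l m) -hE ler_wpM2r ?(ltW h0)// ler_nat.
  by rewrite (leq_trans _ (leq_addr _ _))// leq_mul2r -ltnS prednK// lk orbT.
have tau0 i : 0 <= tau i by exact: le_trans (atau i).
have taum i : (i <= m.+1)%N -> tau i <= grid T n k.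
  move=> im; rewrite tauE (grid_mesh_time T n k m) -hE ler_wpM2r ?(ltW h0)// ler_nat.
  by rewrite -[in leqRHS](prednK k0) mulSnr leq_add2l.
have tauT i : (i <= m.+1)%N -> tau i <= T.
  by move=> im; apply: le_trans (taum i im) _; exact: grid_leT.
have tauI i : (i <= m.+1)%N -> 0 <= tau i <= T by move=> im; rewrite tau0 tauT.
have ak : a < grid T n k.
  rewrite aE /grid ltr_pM2r ?invr_gt0 ?ltr0n// ltr_pM2r// ltr_nat//.
have nW i : (i < m.+1)%N -> std_normal P (winc w (tau i) (tau i.+1)).
  by move=> im; apply: (winc_std_normal filF wF) => //; exact: tauT.
have C11 : 1 <= C1 by rewrite le_max lexx.
have e0 : 0 < C1 * (h * (grid T n k - a)).
  by rewrite !mulr_gt0 ?subr_gt0// (lt_le_trans _ C11).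
have -> : moment_const q.+1 mu * C1 * (T / n%:R * (grid T n k - a)) =
    moment_const q.+1 mu * m.+1%:R * (C1 * (h * (grid T n k - a))).
  rewrite hE natrM invfM; have nz : m.+1%:R != 0 :> R by [].
  have nz' : n%:R != 0 :> R by rewrite pnatr_eq0 -lt0n.
  by move: (m.+1%:R : R) (n%:R : R) nz nz' => z z' nz nz'; field; rewrite nz nz'.
have sq2 (y : R) j : y ^+ (2 * j) = `|y| ^+ (2 * j).
  by rewrite !exprM real_normK ?num_real.
apply: (martingale_transform_moment (G := fun i => F (tau i))
  (D := fun i x => Num.sqrt h * (\1_(NJ a (tau i)) x * (sigma (tau i) x - sigma a x)))
  (eta := fun i => winc w (tau i) (tau i.+1))) => //.
- by rewrite le_max mu11.
- by move=> i im; split;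
    [apply: (filtration_sigma filF)|apply: (filtration_measurable filF)]; exact: tauI.
- by move=> i im; apply: (filtration_sub filF) => //; [exact: ltW|exact: tauT].
- move=> i im; have sG := filtration_sigma filF (tauI i (ltnW im)).
  apply: measurable_wrtM => //; first exact: measurable_wrt_cst.
  apply: measurable_wrtM => //.
    apply: measurable_wrt_indic => //; apply: (no_jump_adapted filF) => //.
    by apply: tauT; exact: ltnW.
  apply: measurable_wrtB => //; first by apply: adap; apply: tauI; exact: ltnW.
  by apply: (adapted_le filF) => //; apply: tauT; exact: ltnW.
- by move=> i im; apply: (winc_adapted filF wF) => //; exact: tauT.
- by move=> i im; apply: (winc_independent wF) => //; exact: tauT.
- by move=> i im; apply: std_normal_integrable; exact: nW.
- by move=> i im; apply: (std_normal_mean (P := P)); exact: nW.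
- move=> i im; under eq_integral do rewrite (sq2 _ 1%N).
  by apply: le_trans (hmu1 _ (nW i im)) _; rewrite lee_fin le_max lexx.
- move=> i im; under eq_integral do rewrite sq2.
  by apply: le_trans (hmu2 _ (nW i im)) _; rewrite lee_fin le_max lexx orbT.
(* If [tau i] equals [a] the coefficient is 0; the case is separate because the normalized
   increments of sigma are bounded for distinct times. *)
move=> i im; have := atau i; rewrite le_eqVlt => /orP[/eqP <-|ati].
  under eq_integral do rewrite subrr !mulr0 expr0n muln_eq0/=.
  by rewrite integral0 lee_fin exprn_ge0// ltW.
have s0 : 0 < tau i - a by rewrite subr_gt0.
have ss0 : 0 < Num.sqrt (tau i - a) by rewrite sqrtr_gt0.
have := hC0 (a, tau i); rewrite /= a0 ati tauT 1?ltnW// => /(_ (conj isT isT)) hD.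
rewrite (_ : (fun x => _) = (fun x => ((h * (tau i - a)) ^+ q.+1)%:E *
    (`|(Num.sqrt (tau i - a))^-1 * (\1_(NJ a (tau i)) x * (sigma (tau i) x - sigma a x))|
      ^+ (2 * q.+1))%:E)%E); last first.
  apply/funext => x; rewrite -EFinM -sq2; congr EFin.
  rewrite -[in RHS](sqr_sqrtr (ltW h0)) -[in RHS](sqr_sqrtr (ltW s0)) -exprMn -exprM -exprMn.
  by rewrite sqrtr_sqr (gtr0_norm ss0); congr (_ ^+ _); rewrite mulrA -!mulrA mulVKf// gt_eqF.
rewrite ge0_integralZl_EFin//; last 2 first.
- apply: measurable_normX; apply: (sigma_increments.1 (a, tau i)).
  by rewrite /= a0 ati tauT// ltnW.
- by rewrite exprn_ge0// mulr_ge0 ?ltW.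
apply: le_trans (lee_wpmul2l _ hD) _; first by rewrite lee_fin exprn_ge0// mulr_ge0 ?ltW.
rewrite -EFinM lee_fin mulrC [in leRHS]exprMn ler_pM ?exprn_ge0 ?mulr_ge0 ?(ltW h0) ?(ltW s0)//.
- rewrite -lee_fin; apply: le_trans hD.
  by apply: integral_ge0 => x _; rewrite lee_fin exprn_ge0.
- by rewrite (le_trans (_ : _ <= C1))// ?le_max ?lexx ?orbT// ler_eXnr.
- rewrite lerXn2r ?nnegrE ?mulr_ge0 ?(ltW h0) ?(ltW s0) ?subr_ge0 ?(ltW ak)//.
  by rewrite ler_wpM2l ?(ltW h0)// lerD2r taum// ltnW.
Qed.

(** Freezing sigma at the time t_l costs sqrt(T/n (t_k - t_l)). For the elementary integrals this is
    the mesh estimate, and convergence in probability transfers it to [M]. *)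
Lemma mb_martingale_increment :
  moments_bounded P [set nlk : nat * nat * nat | (0 < nlk.1.1)%N /\ (nlk.1.2 < nlk.2 <= nlk.1.1)%N]
    (fun nlk x => (Num.sqrt (T / nlk.1.1%:R * (grid T nlk.1.1 nlk.2 - grid T nlk.1.1 nlk.1.2)))^-1 *
      (\1_(NJ (grid T nlk.1.1 nlk.1.2) (grid T nlk.1.1 nlk.2)) x *
        (M (grid T nlk.1.1 nlk.2) x - M (grid T nlk.1.1 nlk.2.-1) x -
          sigma (grid T nlk.1.1 nlk.1.2) x *
            (w (grid T nlk.1.1 nlk.2) x - w (grid T nlk.1.1 nlk.2.-1) x)))).
Proof.
have [aw _ _ _ _] := wF; have [mM _ cM] := itoM.
pose S n k m x := sp_int (mesh_process T sigma (n * m.+1)) w (grid T n k) x.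
have nm0 n m : (0 < n)%N -> (0 < n * m.+1)%N by move=> n0; rewrite muln_gt0 n0.
have gI n k : (0 < n)%N -> (k <= n)%N -> 0 <= grid T n k <= T.
  by move=> n0 kn; rewrite grid_ge0//= grid_leT.
have gm Y n k : adapted T F Y -> (0 < n)%N -> (k <= n)%N -> measurable_fun setT (Y (grid T n k)).
  by move=> aY n0 kn; apply: (adapted_measurable filF) => //; exact: gI.
have mS n k m : (0 < n)%N -> (k <= n)%N -> measurable_fun setT (S n k m).
  move=> n0 kn; rewrite /S (_ : (fun x => _) = fun x =>
    \sum_(i < k * m.+1) sigma (i%:R * (T / (n * m.+1)%:R)) x *
    (w (i.+1%:R * (T / (n * m.+1)%:R)) x - w (i%:R * (T / (n * m.+1)%:R)) x)); last first.
    by apply/funext => x; exact: mesh_sp_int.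
  apply: measurable_sum => -[i ik] /=; have pt j : (j <= k * m.+1)%N ->
      0 <= j%:R * (T / (n * m.+1)%:R) <= T by exact: mesh_point.
  by apply: measurable_funM; [|apply: measurable_funB];
    apply: (adapted_measurable filF) => //; apply: pt => //; exact: ltnW.
have cS n k : (0 < n)%N -> (k <= n)%N -> cvg_in_prob P (S n k) (M (grid T n k)).
  move=> n0 kn; apply: (cM (fun m => mesh_process T sigma (n * m.+1))); last exact: gI.
    by move=> m; apply: (mesh_process_predictable T0 adap); exact: nm0.
  apply: (mesh_process_approx T0 filF cs adap _ _ fJ) => [m|]; first exact: nm0.
  apply/cvgnyPge => A; near=> m; rewrite (@leq_trans m.+1)//; last by rewrite leq_pmull.
  by rewrite ltnW// ltnS; near: m; exact: nbhs_infty_ge.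
have mNJ n l k : (0 < n)%N -> (l < k <= n)%N -> measurable (NJ (grid T n l) (grid T n k)).
  move=> n0 /andP[lk kn]; apply: measurable_no_jump; rewrite ?grid_ge0 ?grid_leT//.
  by rewrite /grid ler_pM2r ?invr_gt0 ?ltr0n// ler_pM2r// ler_nat ltnW.
have side n l k : (l < k <= n)%N -> [/\ (l <= n)%N, (k <= n)%N & (k.-1 <= n)%N].
  move=> /andP[lk kn]; rewrite kn (leq_trans (leq_pred _) kn); split => //.
  by rewrite (leq_trans (ltnW lk)).
have mV n l k (A B : Omega -> R) : (0 < n)%N -> (l < k <= n)%N ->
    measurable_fun setT A -> measurable_fun setT B -> measurable_fun setT
    (fun x => (Num.sqrt (T / n%:R * (grid T n k - grid T n l)))^-1 *
      (\1_(NJ (grid T n l) (grid T n k)) x *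
        (A x - B x - sigma (grid T n l) x * (w (grid T n k) x - w (grid T n k.-1) x)))).
  move=> n0 lkn mA mB; have [ln kn k1n] := side _ _ _ lkn.
  apply: measurable_funM => //; apply: measurable_funM.
    by apply: measurable_indic; exact: mNJ.
  apply: measurable_funB; first exact: measurable_funB.
  by apply: measurable_funM; [|apply: measurable_funB]; exact: gm.
have c0 n l k : (0 < n)%N -> (l < k <= n)%N ->
    0 < T / n%:R * (grid T n k - grid T n l).
  move=> n0 /andP[lk kn]; rewrite mulr_gt0 ?divr_gt0 ?ltr0n// subr_gt0.
  by rewrite /grid ltr_pM2r ?invr_gt0 ?ltr0n// ltr_pM2r// ltr_nat.
apply: (mb_cvg_in_prob (Y := fun nlk m x =>
    (Num.sqrt (T / nlk.1.1%:R * (grid T nlk.1.1 nlk.2 - grid T nlk.1.1 nlk.1.2)))^-1 *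
      (\1_(NJ (grid T nlk.1.1 nlk.1.2) (grid T nlk.1.1 nlk.2)) x *
        (S nlk.1.1 nlk.2 m x - S nlk.1.1 nlk.2.-1 m x -
          sigma (grid T nlk.1.1 nlk.1.2) x *
            (w (grid T nlk.1.1 nlk.2) x - w (grid T nlk.1.1 nlk.2.-1) x))))).
- move=> [[n l] k] /= [n0 lkn]; have [ln kn k1n] := side _ _ _ lkn.
  by apply: mV => //; apply: mM; exact: gI.
- move=> [[n l] k] /= [n0 lkn]; have [ln kn k1n] := side _ _ _ lkn.
  have cpos : 0 < (Num.sqrt (T / n%:R * (grid T n k - grid T n l)))^-1.
    by rewrite invr_gt0 sqrtr_gt0 c0.
  apply: (cvg_in_prob_dominated (A_ := S n k) (B_ := S n k.-1) (A := M (grid T n k))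
    (B := M (grid T n k.-1)) (C := (Num.sqrt (T / n%:R * (grid T n k - grid T n l)))^-1)) => //.
  + by move=> m; exact: mS.
  + by apply: mM; exact: gI.
  + by move=> m; exact: mS.
  + by apply: mM; exact: gI.
  + by move=> m; apply: mV => //; exact: mS.
  + by apply: mV => //; apply: mM; exact: gI.
  + move=> m x; rewrite -mulrBr -mulrBr !normrM (gtr0_norm cpos) ler_wpM2l ?(ltW cpos)//.
    rewrite (le_trans (ler_piMl _ _))//; first by rewrite indicE; case: (_ \in _); rewrite ?normr1 ?normr0.
    rewrite [X in `|X| <= _](_ : _ = (S n k m x - M (grid T n k) x) -
      (S n k.-1 m x - M (grid T n k.-1) x)); first exact: ler_normB.
    ring.
  + exact: cS.
  + exact: cS.
apply: mb_cofinal => [[[[n l] k] m] /= [n0 lkn]|q].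
  by have [ln kn k1n] := side _ _ _ lkn; apply: mV => //; exact: mS.
exists (2 * q.+1)%N; first by rewrite mul2n -addnn (leq_trans (leqnSn q)) ?leq_addr.
have [C hC] := martingale_mesh_moment q.
exists (C ^+ q.+1) => -[[[n l] k] m] /= [n0 lkn]; have [ln kn k1n] := side _ _ _ lkn.
pose h := T / (n * m.+1)%:R; pose a := grid T n l; pose tau i := (k.-1 * m.+1 + i)%:R * h.
have {}hC := hC n l k m h a tau n0 lkn erefl erefl (fun=> erefl).
have ek : (k * m.+1 = k.-1 * m.+1 + m.+1)%N by case: (k) (lkn) => // k' _; rewrite mulSnr.
(* No jump up to [grid T n k] implies none up to any mesh point before it, so the single indicator
   in front may be replaced by the adapted ones inside the sum. *)
have NJsub i x : (i <= m.+1)%N -> no_jump (sigma ^~ x) a (grid T n k) -> no_jump (sigma ^~ x) a (tau i).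
  move=> im nj s /andP[s1 s2]; apply: nj; rewrite s1 (le_trans s2)//.
  rewrite /tau (grid_mesh_time T n k m) ler_wpM2r ?divr_ge0 ?(ltW T0)// ler_nat.
  by rewrite ek leq_add2l.
have h0 : 0 < h by rewrite divr_gt0// ltr0n nm0.
have ws i x : w (tau i.+1) x - w (tau i) x = Num.sqrt h * winc w (tau i) (tau i.+1) x.
  have e : tau i.+1 - tau i = h by rewrite /tau addnS -natr1; ring.
  have lt_ : tau i < tau i.+1 by rewrite -subr_gt0 e.
  by rewrite (wincE w x lt_) e.
have Yle x : `|(Num.sqrt (T / n%:R * (grid T n k - a)))^-1 *
      (\1_(NJ a (grid T n k)) x * (S n k m x - S n k.-1 m x -
          sigma a x * (w (grid T n k) x - w (grid T n k.-1) x)))| ^+ (2 * q.+1) <=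
    ((T / n%:R * (grid T n k - a)) ^+ q.+1)^-1 * (\sum_(i < m.+1) (Num.sqrt h *
      (\1_(NJ a (tau i)) x * (sigma (tau i) x - sigma a x))) * winc w (tau i) (tau i.+1) x)
      ^+ (2 * q.+1).
  have c1 := c0 n l k n0 lkn.
  rewrite normrM exprMn ger0_norm ?invr_ge0 ?sqrtr_ge0// exprVn exprM sqr_sqrtr ?(ltW c1)//.
  rewrite ler_wpM2l ?invr_ge0 ?exprn_ge0 ?(ltW c1)//.
  rewrite indicE; have [|_] := boolP (x \in _); last first.
    by rewrite mul0r normr0 expr0n muln_eq0/= exprM exprn_ge0// sqr_ge0.
  rewrite inE /= => nj; rewrite exprM real_normK ?num_real// -exprM mul1r.
  rewrite le_eqVlt; apply/orP; left; apply/eqP; congr (_ ^+ _).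
  rewrite /S !mesh_sp_int// -/h.
  under [RHS]eq_bigr => i _.
    rewrite indicE mem_set; last by apply: NJsub => //; exact: ltnW.
    rewrite mul1r mulrAC -ws mulrC mulrBl.
    over.
  rewrite big_split /= sumrN -mulr_sumr; congr (_ - _ * _).
    rewrite -!(big_mkord xpredT (fun i => sigma (i%:R * h) x * (w (i.+1%:R * h) x - w (i%:R * h) x))).
    rewrite (@big_cat_nat _ _ _ (k.-1 * m.+1)%N 0%N (k * m.+1)%N) ?leq_mul2r ?leq_pred ?orbT//.
    rewrite addrC addKr -{1}[(k.-1 * m.+1)%N]add0n big_addn ek addKn big_mkord.
    by apply: eq_bigr => i _; rewrite /tau /= addnS (addnC i).
  rewrite -(big_mkord xpredT (fun i => w (tau i.+1) x - w (tau i) x)) telescope_sumr//.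
  by rewrite /tau addn0 (grid_mesh_time T n k m) (grid_mesh_time T n k.-1 m) -/h ek.
apply: (@le_trans _ _ (\int[P]_x (((T / n%:R * (grid T n k - a)) ^+ q.+1)^-1%:E *
   ((\sum_(i < m.+1) (Num.sqrt h * (\1_(NJ a (tau i)) x * (sigma (tau i) x - sigma a x))) *
     winc w (tau i) (tau i.+1) x) ^+ (2 * q.+1))%:E))%E).
  by apply: ge0_le_integralT => x; rewrite -?EFinM lee_fin ?exprn_ge0//; exact: Yle.
have c1 := c0 n l k n0 lkn.
have tT i : (i <= m.+1)%N -> 0 <= tau i <= T.
  move=> im; apply: (mesh_point T0 n0 kn).
  by rewrite ek leq_add2l.
have atau i : a <= tau i.
  rewrite /a /tau (grid_mesh_time T n l m) ler_wpM2r ?(ltW h0)// ler_nat.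
  case: (k) (lkn) => // k' /andP[lk' _] /=.
  by rewrite (leq_trans _ (leq_addr _ _))// leq_mul2r -ltnS lk' orbT.
rewrite ge0_integralZl_EFin//; last 3 first.
- by move=> x _; rewrite lee_fin exprM exprn_ge0// sqr_ge0.
- apply/measurable_EFinP; apply: measurable_funX; apply: measurable_sum => -[i im] /=.
  have /andP[t0 tT'] := tT i (ltnW im).
  apply: measurable_funM; last first.
    have := winc_std_normal filF wF t0 _ (elimT andP (tT i.+1 im)).2.
    by rewrite /tau addnS ltr_pM2r// ltr_nat => /(_ (leqnn _))[].
  apply: measurable_funM => //; apply: measurable_funM.
    apply: measurable_indic; apply: measurable_no_jump => //; exact: grid_ge0.
  apply: measurable_funB; apply: (adapted_measurable filF) => //; first by rewrite t0.
  exact: gI.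
- by rewrite invr_ge0 exprn_ge0// ltW.
apply: le_trans (lee_wpmul2l _ hC) _; first by rewrite lee_fin invr_ge0 exprn_ge0// ltW.
by rewrite -EFinM lee_fin (exprMn q.+1 C) mulrCA mulVf ?mulr1// expf_neq0// gt_eqF.
Unshelve. all: by end_near.
Qed.

End martingale_part.

(** * Trimmed means of perturbed samples *)

Section trimmed_means.
Context {R : realType}.
Implicit Types (W : seq nat) (z zeta rho f g : nat -> R) (p c u : R).

Definition mean W f : R := (size W)%:R^-1 * \sum_(k <- W) f k.

(** The rank condition of the trimming for an arbitrary sample, at level p = 1 - alpha, ties
    receiving their largest rank. *)
Definition kept W z p (k : nat) : bool :=
  (count (fun k' => `|z k'| <= `|z k|) W)%:R <= p * (size W)%:R.

Lemma mean_le W f g : (forall k, k \in W -> f k <= g k) -> mean W f <= mean W g.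
Proof.
move=> fg; rewrite /mean ler_wpM2l ?invr_ge0// !big_seq.
by apply: ler_sum => k kW; exact: fg.
Qed.

Lemma mean_ge0 W f : (forall k, k \in W -> 0 <= f k) -> 0 <= mean W f.
Proof.
by move=> f0; rewrite /mean mulr_ge0 ?invr_ge0// big_seq sumr_ge0.
Qed.

Lemma meanD W f g : mean W (fun k => f k + g k) = mean W f + mean W g.
Proof. by rewrite /mean big_split mulrDr. Qed.

Lemma meanB W f g : mean W (fun k => f k - g k) = mean W f - mean W g.
Proof. by rewrite /mean big_split /= sumrN mulrDr mulrN. Qed.

Lemma mean_cst W c : (0 < size W)%N -> mean W (fun=> c) = c.
Proof.
move=> W0; rewrite /mean big_const_seq count_predT iter_addr_0 -[c *+ _]mulr_natl mulKf//.
by rewrite pnatr_eq0 -lt0n.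
Qed.

Lemma mean_norm W f : `|mean W f| <= mean W (fun k => `|f k|).
Proof.
rewrite /mean normrM ger0_norm ?invr_ge0// ler_wpM2l ?invr_ge0//.
exact: ler_norm_sum.
Qed.

Lemma mean_band W z u : mean W (fun k => \1_(band u) (z k)) =
  (count (fun k => `|z k| <= u) W)%:R / (size W)%:R.
Proof.
rewrite /mean mulrC; congr (_ / _); rewrite -sum1_count natr_sum [RHS]big_mkcond/=.
apply: eq_bigr => k _; rewrite indicE.
by case: ifPn => h; [rewrite mem_set|rewrite memNset// => /=; exact/negP].
Qed.

(** An element below [c1] has rank at most the number of elements below [c1]; an element above [c2]
    outranks all those below [c2]. *)
Lemma kept_sandwich W z p c1 c2 (k : nat) :
  (count (fun k => `|z k| <= c1) W)%:R <= p * (size W)%:R ->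
  p * (size W)%:R < (count (fun k => `|z k| <= c2) W)%:R ->
  (`|z k| <= c1 -> kept W z p k) /\ (kept W z p k -> `|z k| <= c2).
Proof.
move=> h1 h2; split => [zk|kk].
  apply: le_trans h1; rewrite ler_nat; apply: sub_count => k' /= h; exact: le_trans h zk.
rewrite leNgt; apply/negP => zk; move: kk; apply/negP; rewrite -ltNge.
apply: (lt_le_trans h2); rewrite ler_nat; apply: sub_count => k' /= h.
exact: le_trans h (ltW zk).
Qed.

Lemma kept_all W z (k : nat) : kept W z 1 k.
Proof. by rewrite /kept mul1r ler_nat count_size. Qed.

(** A perturbation of size at most [e] shifts the threshold by at most [e]; the indices with a
    larger perturbation are counted separately. *)
Lemma mean_band_perturb W z zeta rho u e : (forall k, z k = zeta k + rho k) -> 0 < e ->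
  mean W (fun k => \1_(band u) (zeta k)) <=
    mean W (fun k => \1_(band (u + e)) (z k)) + mean W (fun k => \1_(~` band e) (rho k)) /\
  mean W (fun k => \1_(band u) (z k)) <=
    mean W (fun k => \1_(band (u + e)) (zeta k)) + mean W (fun k => \1_(~` band e) (rho k)).
Proof.
move=> zE e0; rewrite -!meanD; split; apply: mean_le => k _; rewrite !indicE in_setC.
- case: (boolP (_ \in band u)); last by move=> _; rewrite addr_ge0.
  rewrite inE /= => h; have [hr|hr] := boolP (rho k \in _); last by rewrite lerDr.
  rewrite mem_set ?lerDl//= /band /=; rewrite inE /= in hr.
  by rewrite zE (le_trans (ler_normD _ _)) ?lerD.
- case: (boolP (_ \in band u)); last by move=> _; rewrite addr_ge0.
  rewrite inE /= => h; have [hr|hr] := boolP (rho k \in _); last by rewrite lerDr.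
  rewrite mem_set ?lerDl//= /band /=; rewrite inE /= in hr.
  rewrite (_ : zeta k = z k - rho k); last by rewrite zE addrK.
  by rewrite (le_trans (ler_normB _ _)) ?lerD.
Qed.

Lemma normal_pdf_antitone (x y : R) : 0 <= x <= y -> normal_pdf 0 1 y <= normal_pdf 0 1 x.
Proof.
move=> /andP[x0 xy]; rewrite !normal_pdfE// ler_wpM2l ?normal_peak_ge0//.
rewrite /normal_fun ler_expR !subr0 expr1n ler_pdivrMr// divfK// lerN2.
by rewrite lerXn2r ?nnegrE// (le_trans x0).
Qed.

Lemma exceed_le (x e : R) (r : nat) : 0 < e -> \1_(~` band e) x <= (`|x| / e) ^+ r.
Proof.
move=> e0; rewrite indicE in_setC; have [|] := boolP (x \in _); first by rewrite exprn_ge0 ?divr_ge0// ltW.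
rewrite notin_setE /= => /negP; rewrite -ltNge => h.
by rewrite exprn_ege1// ler_pdivlMr// mul1r ltW.
Qed.

Lemma sqr_perturb (a b : R) : `|(a + b) ^+ 2 - a ^+ 2| <= 2 * `|a * b| + b ^+ 2.
Proof.
have -> : (a + b) ^+ 2 - a ^+ 2 = 2 * (a * b) + b ^+ 2 by ring.
apply: le_trans (ler_normD _ _) _; rewrite normrM (ger0_norm (sqr_ge0 b)).
by rewrite (ger0_norm (_ : 0 <= 2)).
Qed.

(** An uncertainty [eta] of the threshold and a perturbation up to [eta] together give an annulus of
    half-width 2 eta. Squares wrongly kept or dropped are at most (c + 1)^2 because eta <= 1; larger
    perturbations are charged to (|rho|/eta)^r. *)
Lemma kept_term_le (b : bool) (zeta rho c eta : R) (r : nat) :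
  0 < eta <= 1 -> eta <= c ->
  (`|zeta + rho| <= c - eta -> b) -> (b -> `|zeta + rho| <= c + eta) ->
  `|b%:R * (zeta + rho) ^+ 2 - \1_(band c) zeta * zeta ^+ 2| <=
    2 * `|zeta * rho| + rho ^+ 2 + (c + 1) ^+ 2 *
      ((`|rho| / eta) ^+ r + (\1_(band (c + 2 * eta)) zeta - \1_(band (c - 2 * eta)) zeta)).
Proof.
move=> /andP[eta0 eta1] etac hin hout.
have c0 : 0 <= c by lra.
have t1 : 0 <= 2 * `|zeta * rho| + rho ^+ 2 by rewrite addr_ge0 ?sqr_ge0// mulr_ge0.
have t2 : 0 <= (`|rho| / eta) ^+ r by rewrite exprn_ge0// divr_ge0// ltW.
have t3 : 0 <= \1_(band (c + 2 * eta)) zeta - \1_(band (c - 2 * eta)) zeta :> R.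
  rewrite subr_ge0 !indicE; have [|] := boolP (zeta \in band (c - 2 * eta)); last by [].
  by rewrite inE /= => h; rewrite mem_set//=; apply: le_trans h _; lra.
have c1 : 0 <= (c + 1) ^+ 2 by exact: sqr_ge0.
have t4 := mulr_ge0 c1 (addr_ge0 t2 t3).
(* When [b] disagrees with [|zeta| <= c], either rho is large or zeta lies in the annulus. *)
have disagree : `|zeta| <= c + 2 * eta \/ eta < `|rho| -> c - 2 * eta < `|zeta| \/ eta < `|rho| ->
    1 <= (`|rho| / eta) ^+ r + (\1_(band (c + 2 * eta)) zeta - \1_(band (c - 2 * eta)) zeta).
  have big : eta < `|rho| -> 1 <= (`|rho| / eta) ^+ r + (\1_(band (c + 2 * eta)) zeta - \1_(band (c - 2 * eta)) zeta).
    by move=> h; rewrite (le_trans (_ : 1 <= (`|rho| / eta) ^+ r)) ?lerDl// exprn_ege1// ler_pdivlMr// mul1r ltW.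
  move=> [h1|/big//] [h2|/big//].
  rewrite !indicE mem_set// memNset ?subr0; first by rewrite lerDr.
  by move=> /=; apply/negP; rewrite -ltNge.
rewrite indicE; have [zc|zc] := boolP (zeta \in band c).
  move: zc; rewrite inE /band /= => zc.
  case: b hin hout => hin hout.
    by rewrite !mul1r; apply: le_trans (sqr_perturb _ _) _; rewrite lerDl.
  rewrite mul0r mul1r sub0r normrN ger0_norm ?sqr_ge0//.
  have hz : c - eta < `|zeta + rho| by rewrite ltNge; apply/negP => /hin.
  apply: ler_wpDl => //.
  rewrite -[leLHS]mulr1 ler_pM ?sqr_ge0//.
    by rewrite -[leLHS]real_normK ?num_real// lerXn2r ?nnegrE//; lra.
  apply: disagree; first by left; lra.
  have [h|h] := leP `|rho| eta; [left|by right].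
  by have := ler_normD zeta rho; lra.
have {}zc : c < `|zeta| by move: zc; rewrite notin_setE /= => /negP; rewrite -ltNge.
case: b hin hout => hin hout; last by rewrite !mul0r subr0 normr0 addr_ge0.
rewrite mul1r mul0r subr0 ger0_norm ?sqr_ge0//; apply: ler_wpDl => //.
rewrite -[leLHS]mulr1 ler_pM ?sqr_ge0//.
  have := hout isT.
  by rewrite -[X in _ -> X <= _]real_normK ?num_real// => h; rewrite lerXn2r ?nnegrE//; lra.
apply: disagree; last by left; lra.
have [h|h] := leP `|rho| eta; [left|by right].
have := hout isT; have := ler_normB (zeta + rho) rho; rewrite addrK; lra.
Qed.

Definition band_gap W zeta u : R := mean W (fun k => \1_(band u) (zeta k) - normal_band u).

(* Dominates the indicator of the event that the empirical (1 - alpha)-quantile of the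
   perturbed sample is further than eta from that of the normal law. *)
Definition quantile_defect W zeta rho c (eta : R) (r : nat) : R :=
  (`|band_gap W zeta (c + eta / 2)| + `|band_gap W zeta (c - eta / 2)| +
    mean W (fun k => (`|rho k| / (eta / 2)) ^+ r)) / (normal_pdf 0 1 (c + 1) / 2 * eta).

(** Either the empirical counts at c - eta and c + eta enclose the level and the termwise bound
    applies, or the defect is at least 1 and its r-th power pays for the crude bound by the sum of
    squares. *)
Lemma trimmed_mean_le W zeta rho c (eta : R) (r : nat) : (0 < size W)%N ->
  0 < eta <= 1 -> eta <= c ->
  `|mean W (fun k => (kept W (fun k => zeta k + rho k) (normal_band c) k)%:R *
       (zeta k + rho k) ^+ 2) -
    mean W (fun k => \1_(band c) (zeta k) * zeta k ^+ 2)| <=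
  mean W (fun k => 2 * `|zeta k * rho k| + rho k ^+ 2 + (c + 1) ^+ 2 *
    ((`|rho k| / eta) ^+ r +
      (\1_(band (c + 2 * eta)) (zeta k) - \1_(band (c - 2 * eta)) (zeta k)))) +
  quantile_defect W zeta rho c eta r ^+ r *
    mean W (fun k => (zeta k + rho k) ^+ 2 + zeta k ^+ 2).
Proof.
move=> W0 eta01 etac; have /andP[eta0 eta1] := eta01.
set z := fun k => zeta k + rho k; pose E := mean W (fun k => (`|rho k| / (eta / 2)) ^+ r).
set a := normal_pdf 0 1 (c + 1) / 2.
have a0 : 0 < a by rewrite divr_gt0// normal_pdfE// mulr_gt0 ?normal_peak_gt0// /normal_fun expR_gt0.
have K0 : 0 < (size W)%:R :> R by rewrite ltr0n.
have e20 : 0 < eta / 2 by rewrite divr_gt0.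
have E0 : 0 <= E by apply: mean_ge0 => k _; rewrite exprn_ge0// divr_ge0// ltW.
have LE : mean W (fun k => \1_(~` band (eta / 2)) (rho k)) <= E.
  by apply: mean_le => k _; exact: exceed_le.
have defect0 : 0 <= quantile_defect W zeta rho c eta r.
  by rewrite /quantile_defect divr_ge0 ?addr_ge0// mulr_ge0// ltW.
have M0 : 0 <= mean W (fun k => (zeta k + rho k) ^+ 2 + zeta k ^+ 2).
  by apply: mean_ge0 => k _; rewrite addr_ge0 ?sqr_ge0.
have terms (k : nat) : (`|z k| <= c - eta -> kept W z (normal_band c) k) ->
    (kept W z (normal_band c) k -> `|z k| <= c + eta) -> _ :=
  @kept_term_le (kept W z (normal_band c) k) (zeta k) (rho k) c eta r eta01 etac.
rewrite -meanB; apply: le_trans (mean_norm _ _) _.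
have bad : 1 <= quantile_defect W zeta rho c eta r ->
    mean W (fun k => `|(kept W z (normal_band c) k)%:R * z k ^+ 2 -
      \1_(band c) (zeta k) * zeta k ^+ 2|) <=
    quantile_defect W zeta rho c eta r ^+ r *
      mean W (fun k => (zeta k + rho k) ^+ 2 + zeta k ^+ 2).
  move=> h; apply: le_trans (ler_peMl M0 (exprn_ege1 r h)).
  apply: mean_le => k _; apply: le_trans (ler_normB _ _) _.
  rewrite (normrM _ (z k ^+ 2)) (normrM _ (zeta k ^+ 2)).
  rewrite (ger0_norm (sqr_ge0 (z k))) (ger0_norm (sqr_ge0 (zeta k))); apply: lerD.
    by apply: ler_piMl; rewrite ?sqr_ge0//; case: kept; rewrite ?normr1 ?normr0.
  by apply: ler_piMl; rewrite ?sqr_ge0// indicE; case: (_ \in _); rewrite ?normr1 ?normr0.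
have first_ge0 : 0 <= mean W (fun k => 2 * `|zeta k * rho k| + rho k ^+ 2 + (c + 1) ^+ 2 *
    ((`|rho k| / eta) ^+ r +
      (\1_(band (c + 2 * eta)) (zeta k) - \1_(band (c - 2 * eta)) (zeta k)))).
  apply: mean_ge0 => k _; apply: addr_ge0.
    by apply: addr_ge0; [exact: mulr_ge0|exact: sqr_ge0].
  apply: mulr_ge0; first exact: sqr_ge0.
  apply: addr_ge0; first by rewrite exprn_ge0// divr_ge0// ltW.
  rewrite subr_ge0 !indicE; have [|//] := boolP (zeta k \in band (c - 2 * eta)).
  by rewrite inE /= => h; rewrite mem_set//=; apply: le_trans h _; lra.
have ae0 : 0 < a * eta by rewrite mulr_gt0.
(* The normal density is at least 2a on [0, c + 1], so moving the threshold by eta / 2 changes the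
   mass by at least a eta. The other eta / 2 of the margin is left to the perturbation. *)
have a_le (u v : R) : 0 <= u <= v -> v <= c + 1 ->
    2 * a * (v - u) <= normal_band v - normal_band u.
  move=> uv vc; apply: le_trans (normal_band_lb uv); have /andP[u0 uv'] := uv.
  rewrite ler_wpM2r ?subr_ge0// /a mulrC divfK//.
  by apply: normal_pdf_antitone; rewrite (le_trans u0).
have pE (u : R) : band_gap W zeta u = mean W (fun k => \1_(band u) (zeta k)) - normal_band u.
  by rewrite /band_gap meanB mean_cst.
have perturb u : _ := @mean_band_perturb W z zeta rho u (eta / 2) (fun=> erefl) e20.
have [h1|h1] := leP (count (fun k => `|z k| <= c - eta) W)%:R (normal_band c * (size W)%:R);
  [have [h2|h2] := leP (count (fun k => `|z k| <= c + eta) W)%:R (normal_band c * (size W)%:R)|].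
(* Here too few elements lie below c + eta, although the normal law exceeds the level at c + eta / 2
   by a eta; the last case is its mirror image at c - eta. *)
- apply: ler_wpDl => //; apply: bad; rewrite /quantile_defect -/a -/E ler_pdivlMr// mul1r.
  have := (perturb (c + eta / 2)).1; rewrite -addrA -splitr [X in _ <= X + _ -> _]mean_band => h3.
  have h4 : (count (fun k => `|z k| <= c + eta) W)%:R / (size W)%:R <= normal_band c.
    by rewrite ler_pdivrMr.
  have := @a_le c (c + eta / 2); rewrite (_ : c + eta / 2 - c = eta / 2); last by lra.
  move=> /(_ _ _) h5; have {}h5 : a * eta <= normal_band (c + eta / 2) - normal_band c.
    by apply: le_trans (h5 _ _); clear -eta0 eta1 etac; lra.
  have := ler_norm (- band_gap W zeta (c + eta / 2)); rewrite normrN; have := pE (c + eta / 2).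
  have := normr_ge0 (band_gap W zeta (c - eta / 2)); clear -h3 h4 h5 LE; lra.
- apply: ler_wpDr; first by rewrite mulr_ge0// exprn_ge0.
  apply: mean_le => k _; have [i1 i2] := kept_sandwich k h1 h2.
  exact: terms.
- apply: ler_wpDl => //; apply: bad; rewrite /quantile_defect -/a -/E ler_pdivlMr// mul1r.
  have := (perturb (c - eta)).2; rewrite mean_band => h3.
  have h4 : normal_band c <= (count (fun k => `|z k| <= c - eta) W)%:R / (size W)%:R.
    by rewrite ler_pdivlMr// ltW.
  move: h3; rewrite (_ : c - eta + eta / 2 = c - eta / 2); last by lra.
  move=> h3.
  have := @a_le (c - eta / 2) c; rewrite (_ : c - (c - eta / 2) = eta / 2); last by lra.
  move=> /(_ _ _) h5; have {}h5 : a * eta <= normal_band c - normal_band (c - eta / 2).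
    by apply: le_trans (h5 _ _); clear -eta0 eta1 etac; lra.
  have := ler_norm (band_gap W zeta (c - eta / 2)); have := pE (c - eta / 2).
  have := normr_ge0 (band_gap W zeta (c + eta / 2)); clear -h3 h4 h5 LE; lra.
Qed.

Lemma full_mean_le W zeta rho : 
  `|mean W (fun k => (kept W (fun k => zeta k + rho k) 1 k)%:R * (zeta k + rho k) ^+ 2) -
    mean W (fun k => zeta k ^+ 2)| <=
  mean W (fun k => 2 * `|zeta k * rho k| + rho k ^+ 2).
Proof.
rewrite -meanB; apply: le_trans (mean_norm _ _) _; apply: mean_le => k _.
by rewrite kept_all mul1r; exact: sqr_perturb.
Qed.

End trimmed_means.

(** * Rates and averages of Wiener increments *)

Section rates.
Context {R : realType} {d : measure_display} {Omega : measurableType d}.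
Variable P : probability Omega R.

(** [Y] is O(n^(-g)) in every L^p, where n is [nn i]. Rates add under products, and rate 0 means
    bounded moments. *)
Definition has_rate {I : Type} (D : set I) (nn : I -> nat) (g : R) (Y : I -> Omega -> R) : Prop :=
  moments_bounded P D (fun i x => (nn i)%:R `^ g * Y i x).

Section calculus.
Variables (I : Type) (D : set I) (nn : I -> nat).
Hypothesis nn_gt0 : forall i, D i -> (0 < nn i)%N.
Implicit Types (Y Z : I -> Omega -> R) (g : R).
Local Notation rate := (has_rate D nn).

Let n0 i : D i -> 0 < (nn i)%:R :> R.
Proof. by move=> /nn_gt0; rewrite ltr0n. Qed.

Let nD i (g1 g2 : R) : D i -> (nn i)%:R `^ (g1 + g2) = (nn i)%:R `^ g1 * (nn i)%:R `^ g2 :> R.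
Proof. by move=> /n0 h; rewrite powRD//; apply/implyP => _; rewrite gt_eqF. Qed.

Lemma powR_nat_le1 (n : nat) g : (0 < n)%N -> g <= 0 -> n%:R `^ g <= 1 :> R.
Proof.
move=> n1 g0; rewrite -[leRHS](powRr0 (n%:R : R)) ler_powR//.
by rewrite ler1n.
Qed.

Lemma rate_eq Y Z g : (forall i x, D i -> Y i x = Z i x) -> rate g Z -> rate g Y.
Proof. by move=> YZ; apply: mb_eq => i x Di; rewrite YZ. Qed.

Lemma rate_weaken Y g g' : g <= g' -> rate g' Y -> rate g Y.
Proof.
move=> gg' hY; apply: (@mb_eq _ _ _ _ _ _ _
    (fun i x => (nn i)%:R `^ (g - g') * ((nn i)%:R `^ g' * Y i x))).
  by move=> i x Di; rewrite mulrA -nD// subrK.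
apply: (@mb_scale _ _ _ _ _ _ _ 1) => // i Di; rewrite ger0_norm ?powR_ge0//.
by rewrite powR_nat_le1 ?nn_gt0// subr_le0.
Qed.

Lemma rate0E Y : rate 0 Y <-> moments_bounded P D Y.
Proof. by split; apply: mb_eq => i x Di; rewrite powRr0 mul1r. Qed.

Lemma rate_add Y Z g : rate g Y -> rate g Z -> rate g (fun i x => Y i x + Z i x).
Proof.
move=> hY hZ; apply: (mb_eq _ (mb_add hY hZ)) => i x _.
by rewrite mulrDr.
Qed.

Lemma rate_mul Y Z g g' : rate g Y -> rate g' Z -> rate (g + g') (fun i x => Y i x * Z i x).
Proof.
move=> hY hZ; apply: (mb_eq _ (mb_mul hY hZ)) => i x Di.
by rewrite nD// mulrACA.
Qed.

Lemma rate_mulr0 Y Z g : rate g Y -> rate 0 Z -> rate g (fun i x => Y i x * Z i x).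
Proof. by move=> hY hZ; rewrite -[g]addr0; exact: rate_mul. Qed.

Lemma rate_exp Y g k : rate g Y -> rate (k%:R * g) (fun i x => Y i x ^+ k).
Proof.
move=> hY; apply: (mb_eq _ (mb_exp k hY)) => i x Di.
by rewrite exprMn [k%:R * g]mulrC powRrM powR_mulrn ?powR_ge0.
Qed.

Lemma rate_norm Y g : rate g Y -> rate g (fun i x => `|Y i x|).
Proof.
move=> hY; apply: (mb_eq _ (mb_norm hY)) => i x Di.
by rewrite normrM ger0_norm ?powR_ge0.
Qed.

Lemma rate_opp Y g : rate g Y -> rate g (fun i x => - Y i x).
Proof. by move=> hY; apply: (mb_eq _ (mb_opp hY)) => i x Di; rewrite mulrN. Qed.

Lemma rate_cst (c : I -> R) g C : (forall i, D i -> `|c i| <= C * (nn i)%:R `^ (- g)) ->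
  rate g (fun i _ => c i).
Proof.
move=> hc; apply: (@mb_cst _ _ _ _ _ _ _ C) => i Di.
rewrite normrM ger0_norm ?powR_ge0// mulrC -ler_pdivlMr ?powR_gt0 ?n0//.
by rewrite -powRN; exact: hc.
Qed.

Lemma rate_mull0 (c : I -> R) C Y g : (forall i, D i -> `|c i| <= C) -> rate g Y ->
  rate g (fun i x => c i * Y i x).
Proof.
move=> hc hY; rewrite -[g]add0r; apply: rate_mul => //.
by apply: (@rate_cst _ _ C) => i Di; rewrite oppr0 powRr0 mulr1; exact: hc.
Qed.

Lemma rate_indic (A : I -> set Omega) Y g : (forall i, D i -> measurable (A i)) ->
  rate g Y -> rate g (fun i x => \1_(A i) x * Y i x).
Proof.
move=> mA hY; apply: (mb_eq _ (mb_indic_mul mA hY)) => i x Di.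
by rewrite mulrCA.
Qed.

Lemma rate_mean (s : I -> seq nat) (Y : I -> nat -> Omega -> R) g :
  (forall i, D i -> (0 < size (s i))%N) ->
  has_rate [set ik : I * nat | D ik.1 /\ ik.2 \in s ik.1] (fun ik => nn ik.1) g
    (fun ik => Y ik.1 ik.2) ->
  rate g (fun i x => mean (s i) (fun k => Y i k x)).
Proof.
move=> s0 hY; apply: (mb_eq _ (mb_mean (Y := fun i k x => (nn i)%:R `^ g * Y i k x) s0 hY)).
by move=> i x Di; rewrite /mean -mulr_sumr mulrCA.
Qed.

End calculus.

Lemma rate_reindex (I I' : Type) (D : set I) (D' : set I') (nn : I -> nat) (f : I' -> I)
    (Y : I -> Omega -> R) g : (forall i, D' i -> D (f i)) ->
  has_rate D nn g Y -> has_rate D' (fun i => nn (f i)) g (fun i => Y (f i)).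
Proof. by move=> ff; exact: (mb_reindex ff). Qed.

End rates.

Section wiener_averages.
Context {R : realType} {d : measure_display} {Omega : measurableType d}.
Variables (P : probability Omega R) (T : R) (F : R -> set (set Omega)).
Variable w : R -> Omega -> R.
Hypotheses (T0 : 0 < T) (filF : filtration T F) (wF : wiener P T F w).
Local Notation N01 := (normal_prob (0 : R) 1).

Definition zeta (n k : nat) : Omega -> R := winc w (grid T n k.-1) (grid T n k).

Lemma grid_lt n k l : (0 < n)%N -> (k < l)%N -> grid T n k < grid T n l.
Proof. by move=> n0 kl; rewrite /grid ltr_pM2r ?invr_gt0 ?ltr0n// ltr_pM2r// ltr_nat. Qed.

Lemma zeta_std_normal n k : (0 < k <= n)%N -> std_normal P (zeta n k).
Proof.
move=> /andP[k0 kn]; have n0 := leq_trans k0 kn.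
apply: (winc_std_normal filF wF); rewrite ?grid_ge0 ?grid_leT//.
by apply: grid_lt => //; rewrite ltn_predL.
Qed.

Lemma mb_zeta (I : Type) (D : set I) (f g : I -> nat) :
  (forall i, D i -> (0 < g i <= f i)%N) -> moments_bounded P D (fun i => zeta (f i) (g i)).
Proof.
move=> h; split => [i Di|m]; first by have [] := zeta_std_normal (h i Di).
have [C _ hC] := std_normal_moment P m; exists C => i Di.
by apply: hC; exact: zeta_std_normal (h i Di).
Qed.

Lemma growth_le (y : R) m : (1 + y ^+ 2) ^+ m <= 2 ^+ m * (1 + `|y| ^+ (2 * m)).
Proof.
have := normrX_add_le 1 (y ^+ 2) m.
rewrite ger0_norm ?addr_ge0 ?sqr_ge0// normr1 expr1n (ger0_norm (sqr_ge0 y)) -exprM.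
by rewrite exprM -(real_normK (num_real y)) -exprM.
Qed.

(** Quadratic growth is the common frame for band indicators and truncated squares; a moment of
    order m of [g] then costs one of order 2m of the normal variable. *)
Lemma std_normal_comp_moment (xi : Omega -> R) (g : R -> R) C : std_normal P xi ->
  measurable_fun setT g -> (forall y, `|g y| <= C * (1 + y ^+ 2)) -> 0 <= C ->
  forall m C1, (\int[P]_x (`|xi x| ^+ (2 * m))%:E <= C1%:E)%E ->
  (\int[P]_x (`|g (xi x)| ^+ m)%:E <= (C ^+ m * 2 ^+ m * (1 + C1))%:E)%E.
Proof.
move=> [mxi _] mg gC C0 m C1 hC1.
apply: (@le_trans _ _ (\int[P]_x ((C ^+ m * 2 ^+ m)%:E * (1%:E + (`|xi x| ^+ (2 * m))%:E)))%E).
  apply: ge0_le_integralT => x; first by rewrite lee_fin exprn_ge0.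
  rewrite -EFinD -EFinM lee_fin -mulrA; apply: (@le_trans _ _ ((C * (1 + xi x ^+ 2)) ^+ m)).
    by rewrite lerXn2r ?nnegrE// mulr_ge0// addr_ge0 ?sqr_ge0.
  by rewrite exprMn ler_wpM2l ?exprn_ge0// growth_le.
have mq := measurable_normX (2 * m) mxi.
rewrite ge0_integralZl_EFin//; last 3 first.
- by move=> x _; rewrite -EFinD lee_fin addr_ge0 ?exprn_ge0.
- exact: emeasurable_funD.
- by rewrite mulr_ge0 ?exprn_ge0.
rewrite [in leRHS]EFinM; apply: lee_wpmul2l; first by rewrite lee_fin mulr_ge0 ?exprn_ge0.
rewrite ge0_integralD// EFinD; apply: leeD => //.
by rewrite integral_cst// mul1e; exact: probability_le1.
Qed.

Lemma std_normal_comp_integrable (xi : Omega -> R) (g : R -> R) C : std_normal P xi ->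
  measurable_fun setT g -> (forall y, `|g y| <= C * (1 + y ^+ 2)) -> 0 <= C ->
  P.-integrable setT (EFin \o (g \o xi)).
Proof.
move=> nxi mg gC C0; have [mxi _] := nxi; apply/integrableP; split.
  by apply/measurable_EFinP; exact: measurableT_comp.
have [C1 _ hC1] := std_normal_moment P (2 * 1).
have := std_normal_comp_moment nxi mg gC C0 (hC1 _ nxi).
by move=> h; apply: le_lt_trans h _; exact: ltry.
Qed.

Lemma std_normal_comp_mean (xi : Omega -> R) (g : R -> R) C : std_normal P xi ->
  measurable_fun setT g -> (forall y, `|g y| <= C * (1 + y ^+ 2)) -> 0 <= C ->
  (\int[P]_x (g (xi x))%:E = \int[N01]_y (g y)%:E)%E.
Proof.
move=> nxi mg gC C0; have [mxi lxi] := nxi.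
have := @integral_pushforward _ _ _ (measurableTypeR R) R xi mxi P setT (EFin \o g).
rewrite preimage_setT => /(_ _ (std_normal_comp_integrable nxi mg gC C0) measurableT) <-//.
  by apply: eq_measure_integral => A mA _; exact: lxi.
exact/measurable_EFinP.
Qed.

Lemma measurable_wrt_comp (G : set (set Omega)) (xi : Omega -> R) (g : R -> R) :
  measurable_fun setT g -> measurable_wrt G xi -> measurable_wrt G (g \o xi).
Proof.
move=> mg mxi B mB; rewrite comp_preimage; apply: mxi.
by rewrite -[X in measurable X]setTI; exact: mg.
Qed.

Lemma independent_of_comp (G : set (set Omega)) (xi : Omega -> R) (g : R -> R) :
  measurable_fun setT g -> independent_of P G xi -> independent_of P G (g \o xi).
Proof.
move=> mg ind A B GA mB; rewrite comp_preimage; apply: ind => //.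
by rewrite -[X in measurable X]setTI; exact: mg.
Qed.

(* [g] takes the window into account through the band widths, which depend on n. *)
Lemma mb_average (I : Type) (D : set I) (nn st sz : I -> nat) (g : I -> R -> R) (C : R) :
  (forall i, D i -> [/\ (0 < st i)%N, (0 < sz i)%N & ((st i).-1 + sz i <= nn i)%N]) ->
  (forall i, D i -> measurable_fun setT (g i)) ->
  (forall i y, D i -> `|g i y| <= C * (1 + y ^+ 2)) -> 0 <= C ->
  (forall i, D i -> (\int[N01]_y (g i y)%:E = 0)%E) ->
  moments_bounded P D (fun i x => Num.sqrt (sz i)%:R *
    mean (iota (st i) (sz i)) (fun k => g i (zeta (nn i) k x))).
Proof.
move=> HD mg gC C0 g0.
have kI i k : D i -> (k < sz i)%N -> (0 < st i + k <= nn i)%N.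
  move=> /HD[s0 z0 le_n] kz; rewrite addn_gt0 s0 /=; apply: leq_trans le_n.
  by rewrite -[st i](prednK s0) addSn -addnS prednK// leq_add2l.
have meanE i x : D i -> Num.sqrt (sz i)%:R *
    mean (iota (st i) (sz i)) (fun k => g i (zeta (nn i) k x)) =
    (Num.sqrt (sz i)%:R)^-1 * \sum_(k < sz i) 1 * g i (zeta (nn i) (st i + k) x).
  move=> Di; have [s0 z0 _] := HD i Di; have z0' : 0 < (sz i)%:R :> R by rewrite ltr0n.
  rewrite /mean size_iota mulrA; congr (_ * _).
    rewrite -[X in _ / X](sqr_sqrtr (ltW z0')) invfM mulrA mulfV ?mul1r// gt_eqF// sqrtr_gt0//.
  rewrite -[st i]addn0 iotaDl big_map -{1}[sz i]subn0 -/(index_iota 0 (sz i)) big_mkord addn0.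
  by apply: eq_bigr => k _; rewrite mul1r.
have mgz i k : D i -> (k < sz i)%N -> measurable_fun setT (g i \o zeta (nn i) (st i + k)).
  move=> Di kz; apply: measurableT_comp; first exact: mg.
  by have [] := zeta_std_normal (kI i k Di kz).
apply: (mb_eq meanE); apply: mb_cofinal => [i Di|q].
  apply: measurable_funM => //; apply: measurable_sum => -[k kz] /=.
  by apply: measurable_funM => //; exact: mgz.
exists (2 * q.+1)%N; first by rewrite mul2n -addnn (leq_trans (leqnSn q)) ?leq_addr.
have [C1 _ hC1] := std_normal_moment P (2 * 2).
have [C2 _ hC2] := std_normal_moment P (2 * (2 * q.+1)).
pose mu := Num.max 1 (Num.max (C ^+ 2 * 2 ^+ 2 * (1 + C1)) (C ^+ (2 * q.+1) * 2 ^+ (2 * q.+1) * (1 + C2))).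
exists ((moment_const q.+1 mu) ^+ q.+1) => i Di; have [s0 z0 le_n] := HD i Di.
have n0 : (0 < nn i)%N by apply: leq_trans le_n; rewrite addn_gt0 z0 orbT.
have z0' : 0 < (sz i)%:R :> R by rewrite ltr0n.
have sq2 (y : R) j : y ^+ (2 * j) = `|y| ^+ (2 * j).
  by rewrite !exprM real_normK ?num_real.
have gI k : (k <= nn i)%N -> 0 <= grid T (nn i) k <= T.
  by move=> kn; rewrite grid_ge0//= grid_leT.
have lI k : (k <= sz i)%N -> ((st i).-1 + k <= nn i)%N.
  by move=> kz; apply: leq_trans le_n; rewrite leq_add2l.
have stS k : ((st i).-1 + k).+1 = (st i + k)%N by rewrite -addSn prednK.
have gP k (kz : (k < sz i)%N) := zeta_std_normal (kI i k Di kz).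
have zE k : zeta (nn i) (st i + k) = winc w (grid T (nn i) ((st i).-1 + k))
    (grid T (nn i) ((st i).-1 + k.+1)).
  by rewrite /zeta addnS stS -stS.
have gl k : grid T (nn i) ((st i).-1 + k) < grid T (nn i) ((st i).-1 + k.+1).
  by apply: grid_lt => //; rewrite ltn_add2l.
(* A centered sum is the martingale transform with all coefficients equal to 1, hence of order
   sqrt(sz i). *)
have main := @martingale_transform_moment _ _ _ P q.+1 mu 1
  (fun k => F (grid T (nn i) ((st i).-1 + k))) (fun _ _ => 1)
  (fun k => g i \o zeta (nn i) (st i + k)) (sz i).
under eq_integral do rewrite -sq2 exprMn (exprM _ 2) exprVn sqr_sqrtr ?(ltW z0')// EFinM.
rewrite ge0_integralZl_EFin//; last 2 first.
- by move=> x _; rewrite lee_fin exprM exprn_ge0// sqr_ge0.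
- apply/measurable_EFinP; apply: measurable_funX; apply: measurable_sum => -[k kz] /=.
  by apply: measurable_funM => //; exact: mgz.
apply: (@le_trans _ _ (((sz i)%:R^-1 ^+ q.+1)%:E *
  ((moment_const q.+1 mu * (sz i)%:R * 1) ^+ q.+1)%:E)%E); last first.
  rewrite -EFinM lee_fin mulr1 [in leLHS](exprMn q.+1 (moment_const _ _)) mulrCA -exprMn mulVf ?gt_eqF//.
  by rewrite expr1n mulr1.
apply: lee_wpmul2l; first by rewrite lee_fin exprn_ge0// invr_ge0 ltW.
apply: main => //=.
- by rewrite le_max lexx.
- by move=> k kz; split; [apply: (filtration_sigma filF)|apply: (filtration_measurable filF)];
    apply: gI; exact: lI.
- move=> k kz; apply: (filtration_sub filF); first exact: grid_ge0.
    exact: ltW.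
  by have /andP[] := gI _ (lI k.+1 kz).
- move=> k kz; apply: measurable_wrt_cst; apply: (filtration_sigma filF).
  by apply: gI; apply: lI; exact: ltnW.
- move=> k kz; apply: measurable_wrt_comp; first exact: mg.
  rewrite zE; apply: (winc_adapted filF wF (grid_ge0 T0 _ _) (gl k)).
  by have /andP[] := gI _ (lI k.+1 kz).
- move=> k kz; apply: independent_of_comp; first exact: mg.
  rewrite zE; apply: (winc_independent wF (grid_ge0 T0 _ _) (gl k)).
  by have /andP[] := gI _ (lI k.+1 kz).
- move=> k kz; exact: (std_normal_comp_integrable (gP k kz) (mg i Di) (fun y => gC i y Di) C0).
- move=> k kz; rewrite -[RHS](g0 i Di).
  exact: (std_normal_comp_mean (gP k kz) (mg i Di) (fun y => gC i y Di) C0).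
- move=> k kz; under eq_integral do rewrite (sq2 _ 1%N).
  apply: le_trans (std_normal_comp_moment (gP k kz) (mg i Di) (fun y => gC i y Di) C0 (hC1 _ (gP k kz))) _.
  by rewrite lee_fin !le_max lexx orbT.
- move=> k kz; under eq_integral do rewrite sq2.
  apply: le_trans (std_normal_comp_moment (gP k kz) (mg i Di) (fun y => gC i y Di) C0 (hC2 _ (gP k kz))) _.
  by rewrite lee_fin !le_max lexx !orbT.
- by move=> k kz; under eq_integral do rewrite expr1n; rewrite integral_cst// mul1e expr1n; exact: probability_le1.
Qed.

End wiener_averages.

(** * The local-global realized volatility *)

Section windows.
Context {R : realType}.

(** The equivalence gives |kappa - B n^c0| <= B n^c0 / 2 for large n, hence B n^c0 <= 2 kappa + 1 <=
    (3B + 1) n^c0; the finitely many other n are absorbed by 1 <= kbar <= n <= N. *)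
Lemma kbar_bounds (kappa : nat -> nat) (c0 B : R) : 0 < c0 < 1 -> 0 < B ->
  (forall n, (0 < n)%N -> (2 * kappa n + 1 <= n)%N) ->
  ((fun n : nat => (kappa n)%:R : R^o) ~_\oo (fun n : nat => B * n%:R `^ c0)) ->
  exists c1 c2 : R, [/\ 0 < c1, 0 < c2 & forall n, (0 < n)%N ->
    c1 * n%:R `^ c0 <= (kbar (kappa n))%:R <= c2 * n%:R `^ c0].
Proof.
move=> /andP[c00 c01] B0 hk he.
have [n0 _ hn0] : \forall n \near \oo, `|(kappa n)%:R - B * n%:R `^ c0| <= 2^-1 * `|B * n%:R `^ c0|.
  have /eqaddoP ho := he; have h2 : (0 : R) < 2^-1 by [].
  exact: (ho _ h2).
pose N := n0.+1; have N0 : 0 < N%:R :> R by rewrite ltr0n.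
exists (Num.min B N%:R^-1), (Num.max (3 * B + 1) N%:R); split => [||n n_gt0].
- by rewrite lt_min B0 invr_gt0.
- by rewrite lt_max N0 orbT.
have nR : 1 <= n%:R :> R by rewrite ler1n.
have p1 : 1 <= n%:R `^ c0 :> R.
  by rewrite -[leLHS](powRr0 (n%:R : R)) ler_powR// ltW.
have p0 : 0 < n%:R `^ c0 :> R by exact: lt_le_trans p1.
have pn : n%:R `^ c0 <= n%:R :> R.
  by rewrite -[leRHS](powRr1 (ler0n R n)) ler_powR// ltW.
have Kn : (kbar (kappa n))%:R <= n%:R :> R by rewrite ler_nat; exact: hk.
have K1 : 1 <= (kbar (kappa n))%:R :> R by rewrite ler1n /kbar addn1.
have KE : (kbar (kappa n))%:R = 2 * (kappa n)%:R + 1 :> R by rewrite /kbar natrD natrM.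
have [nN|nN] := leqP n0 n.
  have := hn0 n nN; rewrite /= (ger0_norm (mulr_ge0 (ltW B0) (ltW p0))) ler_norml => /andP[h1 h2].
  apply/andP; split.
    apply: (@le_trans _ _ (B * n%:R `^ c0)); first by rewrite ler_wpM2r ?(ltW p0)// ge_min lexx.
    by rewrite KE; lra.
  apply: (@le_trans _ _ ((3 * B + 1) * n%:R `^ c0)).
    by rewrite KE mulrDl mul1r; lra.
  by rewrite ler_wpM2r ?(ltW p0)// le_max lexx.
have nN' : n%:R <= N%:R :> R by rewrite ler_nat /N (leq_trans (ltnW nN)).
apply/andP; split.
  apply: (@le_trans _ _ 1) => //; apply: (@le_trans _ _ (N%:R^-1 * n%:R `^ c0)).
    by rewrite ler_wpM2r ?(ltW p0)// ge_min lexx orbT.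
  by rewrite mulrC ler_pdivrMr// mul1r (le_trans pn).
apply: (@le_trans _ _ (N%:R * n%:R `^ c0)); last by rewrite ler_wpM2r ?(ltW p0)// le_max lexx orbT.
by rewrite -[leLHS]mulr1 ler_pM// (le_trans Kn).
Qed.

Lemma win_startP n kn j : (2 * kn + 1 <= n)%N -> (1 <= j <= n)%N ->
  (0 < win_start n kn j)%N /\ (win_start n kn j + 2 * kn <= n)%N.
Proof.
rewrite addn1 => hk /andP[j0 jn].
have k2 : (kn + kn < n)%N by rewrite addnn -mul2n.
rewrite /win_start; case: ifP => [_|/negbT]; first by rewrite add1n.
rewrite -ltnNge => kj; case: ifP => [jk|_].
  rewrite subn_gt0 kj mul2n -addnn addnA subnK ?(ltnW kj)//.
  by split => //; rewrite addnC -leq_subRL// (leq_trans (leq_addr kn kn)) ?(ltnW k2).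
by rewrite subn_gt0 hk subnK// ltnW.
Qed.

End windows.

Section scaled_increments.
Context {R : realType} {d : measure_display} {Omega : measurableType d}.

(* On a window where the increments are sqrt(T/n) a z_k, the ranks are those of z; the
   truncation only removes increments with 1 < sqrt n (Delta X)^2 = T a^2 z^2 / sqrt n. *)
Lemma LGRV_error (T : R) (X : R -> Omega -> R) (alpha : R) (n kn j : nat) (x : Omega)
    (a : R) (z : nat -> R) : 0 < T -> (0 < n)%N -> a != 0 -> 0 < q_norm alpha ->
  (forall k, k \in window n kn j -> incr T X n k x = Num.sqrt (T / n%:R) * (a * z k)) ->
  let W := window n kn j in
  `|LGRV T X alpha n kn j x - a ^+ 2| <=
    a ^+ 2 / q_norm alpha *
      `|mean W (fun k => (kept W z (1 - alpha) k)%:R * z k ^+ 2) - q_norm alpha| +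
    a ^+ 4 * T / q_norm alpha * n%:R `^ (- 2^-1) * mean W (fun k => z k ^+ 4).
Proof.
move=> T0 n0 a0 q0 hz /=; set W := window n kn j; set q := q_norm alpha in q0 *.
have nR : 0 < n%:R :> R by rewrite ltr0n.
have h0 : 0 < T / n%:R by rewrite divr_gt0.
have s0 : 0 < Num.sqrt (T / n%:R) by rewrite sqrtr_gt0.
have sW : size W = kbar kn by rewrite size_iota.
have K0 : (kbar kn)%:R != 0 :> R by rewrite pnatr_eq0 /kbar addn1.
have rankE k : k \in W -> rank_in T X W n k x = count (fun k' => `|z k'| <= `|z k|) W.
  move=> kW; rewrite /rank_in; apply: eq_in_count => k' k'W.
  by rewrite !hz// !normrM ler_pM2l ?normr_gt0 ?gt_eqF// ler_pM2l ?normr_gt0.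
have hsq k : k \in W -> `|incr T X n k x| ^+ 2 = T / n%:R * (a ^+ 2 * z k ^+ 2).
  by move=> kW; rewrite real_normK ?num_real// hz// !exprMn sqr_sqrtr// ltW.
have LE : LGRV T X alpha n kn j x =
    a ^+ 2 / q * mean W (fun k => (kept W z (1 - alpha) k)%:R * z k ^+ 2 * trunc T X n k x).
  rewrite /LGRV /trimmed -/W big_filter big_mkcond /= /mean mulr_sumr [RHS]mulrA mulr_sumr.
  rewrite big_seq [RHS]big_seq; apply: eq_bigr => k kW.
  rewrite rankE// -sW -/(kept W z (1 - alpha) k) sW hsq// -/q.
  have nR' : n%:R != 0 :> R by rewrite gt_eqF.
  case: kept; last by rewrite !mul0r !mulr0.
  rewrite (_ : true%:R = 1 :> R)//.
  move: ((kbar kn)%:R : R) (n%:R : R) K0 nR' => y v y0 v0.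
  by field; rewrite y0 v0 !gt_eqF.
have trunc01 k : 0 <= trunc T X n k x <= 1 by rewrite /trunc ler0n /= lern1 leq_b1.
have trunc_err k : k \in W -> 1 - trunc T X n k x <= T * a ^+ 2 * n%:R `^ (- 2^-1) * z k ^+ 2.
  move=> kW; have r0 : 0 <= T * a ^+ 2 * n%:R `^ (- 2^-1) * z k ^+ 2.
    by rewrite mulr_ge0 ?sqr_ge0// mulr_ge0 ?powR_ge0// mulr_ge0 ?sqr_ge0// ltW.
  rewrite /trunc; have [_|lt_] := leP `|incr T X n k x| (n%:R `^ (- 4^-1)).
    by rewrite subrr.
  rewrite subr0; have := ltW lt_; rewrite -(@ler_pXn2r _ 2%N) ?nnegrE ?powR_ge0//.
  rewrite -(powR_mulrn 2 (powR_ge0 n%:R (- 4^-1))) -powRrM hsq//.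
  rewrite (_ : - 4^-1 * 2%:R = - 2^-1 :> R); last by lra.
  have p0 : 0 < n%:R `^ 2^-1 :> R by rewrite powR_gt0.
  have nE : n%:R = n%:R `^ 2^-1 * n%:R `^ 2^-1 :> R.
    by rewrite powR12_sqrt ?ler0n// -expr2 sqr_sqrtr.
  rewrite powRN {2}nE; move: (n%:R `^ 2^-1) p0 => y y0 hh.
  rewrite (_ : _ * _ = T / (y * y) * (a ^+ 2 * z k ^+ 2) * y); last first.
    by field; rewrite gt_eqF.
  by rewrite -ler_pdivrMr// mul1r.
pose kz k := (kept W z (1 - alpha) k)%:R * z k ^+ 2.
have aq0 : 0 <= a ^+ 2 / q by rewrite divr_ge0 ?sqr_ge0// ltW.
(* The error splits into that of the trimmed mean without truncation and the kept squares lost by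
   truncation. *)
rewrite LE (_ : _ - _ = a ^+ 2 / q * (mean W kz - q) -
    a ^+ 2 / q * mean W (fun k => kz k * (1 - trunc T X n k x))); last first.
  have -> : mean W (fun k => kz k * (1 - trunc T X n k x)) =
      mean W kz - mean W (fun k => kz k * trunc T X n k x).
    by rewrite -meanB; congr mean; apply/funext => k; rewrite mulrBr mulr1.
  rewrite /kz; move: (mean _ _) (mean _ _) => u v.
  by field; rewrite gt_eqF.
apply: le_trans (ler_normB _ _) _; rewrite (normrM _ (mean W kz - q)) (normrM _ (mean W _)) (ger0_norm aq0); apply: lerD => //.
have kz0 k : 0 <= kz k by rewrite mulr_ge0 ?sqr_ge0.
rewrite ger0_norm; last first.
  by apply: mean_ge0 => k _; rewrite mulr_ge0// subr_ge0; case/andP: (trunc01 k).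
apply: (@le_trans _ _ (a ^+ 2 / q * mean W (fun k => T * a ^+ 2 * n%:R `^ (- 2^-1) * z k ^+ 4))).
  rewrite ler_wpM2l//; apply: mean_le => k kW.
  rewrite (_ : _ * z k ^+ 4 = z k ^+ 2 * (T * a ^+ 2 * n%:R `^ (- 2^-1) * z k ^+ 2)); last by ring.
  rewrite ler_pM// ?trunc_err//; first by rewrite subr_ge0; case/andP: (trunc01 k).
  by rewrite /kz; case: kept; rewrite ?mul1r// mul0r sqr_ge0.
rewrite /mean -mulr_sumr le_eqVlt; apply/orP; left; apply/eqP; ring.
Qed.

End scaled_increments.

(** * Noise on a calm window and domination of the estimation error *)

Section residuals.
Context {R : realType} {d : measure_display} {Omega : measurableType d}.
Variables (P : probability Omega R) (T : R) (F : R -> set (set Omega)).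
Variables b sigma w M : R -> Omega -> R.
Variables (kappa : nat -> nat) (beta C0 : R).
Hypotheses (T0 : 0 < T) (filF : filtration T F) (wF : wiener P T F w).
Hypotheses (cs : cadlag T sigma) (adap : adapted T F sigma).
Hypotheses (cb : cadlag T b) (adapb : adapted T F b).
Hypothesis itoM : ito_integral P T F w sigma M.
Hypothesis fJ : {ae P, forall x, jumps_finite T (sigma ^~ x)}.
Hypothesis sigma_increments : moments_bounded P
  [set at_ : R * R | 0 <= at_.1 /\ at_.1 < at_.2 <= T]
  (fun at_ x => (Num.sqrt (at_.2 - at_.1))^-1 *
    (\1_[set x | no_jump (sigma ^~ x) at_.1 at_.2] x * (sigma at_.2 x - sigma at_.1 x))).
Hypothesis mb_b : moments_bounded P [set t | 0 <= t <= T] b.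
Hypothesis mb_sigma : moments_bounded P [set t | 0 <= t <= T] sigma.
Hypothesis mb_sigmaV : moments_bounded P [set t | 0 <= t <= T] (fun t x => (sigma t x)^-1).
Hypothesis beta_half : 0 < beta <= 2^-1.
Hypothesis window_length : forall n, (0 < n)%N ->
  Num.sqrt ((kbar (kappa n))%:R / n%:R) <= C0 * n%:R `^ (- beta).
Hypothesis window_count : forall n, (0 < n)%N ->
  (Num.sqrt (kbar (kappa n))%:R)^-1 <= C0 * n%:R `^ (- beta).

Local Notation NJ a t := [set x | no_jump (sigma ^~ x) a t].

(* A window is indexed by n and by its first increment s. *)
Definition windows : set (nat * nat) :=
  [set i | [/\ (0 < i.1)%N, (0 < i.2)%N & (i.2 + 2 * kappa i.1 <= i.1)%N]].

Definition win (i : nat * nat) : seq nat := iota i.2 (kbar (kappa i.1)).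

Definition win_points : set (nat * nat * nat) :=
  [set ik | windows ik.1 /\ ik.2 \in win ik.1].

Definition win_left (i : nat * nat) : R := grid T i.1 i.2.-1.

(** Only sigma is constrained, through an event of the filtration, hence measurable; up to a null
    set, [jump_free] is contained in it. *)
Definition win_calm (i : nat * nat) : set Omega :=
  NJ (win_left i) (grid T i.1 (i.2 + 2 * kappa i.1)).

(** Rescaled increment of the continuous part of X minus its version with frozen volatility. The
    jump part is left out, being constant on the windows where the residual is compared with
    increments of X. *)
Definition residual (i : nat * nat) (k : nat) (x : Omega) : R :=
  \1_(win_calm i) x * ((Num.sqrt (T / i.1%:R))^-1 *
    (\int[lebesgue_measure]_(s in `[0, grid T i.1 k]) b s x
      - \int[lebesgue_measure]_(s in `[0, grid T i.1 k.-1]) b s x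
      + (M (grid T i.1 k) x - M (grid T i.1 k.-1) x))
    - sigma (win_left i) x * zeta T w i.1 k x).

Lemma size_win i : (0 < size (win i))%N.
Proof. by rewrite size_iota /kbar addn1. Qed.

Lemma windows_gt0 i : windows i -> (0 < i.1)%N.
Proof. by case. Qed.

Lemma win_pointsP n s k : win_points (n, s, k) ->
  [/\ (0 < n)%N, (0 < k <= n)%N, (s.-1 < k)%N & (k <= s + 2 * kappa n)%N].
Proof.
rewrite /win_points /win /= mem_iota /kbar addn1 addnS ltnS => -[[n0 s0 sn] /andP[sk ks]].
split => //; last by rewrite prednK.
by rewrite (leq_trans s0 sk) (leq_trans ks sn).
Qed.

Lemma win_leftI i : windows i -> 0 <= win_left i <= T.
Proof.
move=> [n0 s0 sn]; rewrite /win_left grid_ge0//= grid_leT//.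
by rewrite (leq_trans (leq_pred _))// (leq_trans _ sn) ?leq_addr.
Qed.

Lemma win_pointI n s k : win_points (n, s, k) -> 0 <= grid T n k <= T.
Proof. by move=> /win_pointsP[n0 /andP[_ kn] _ _]; rewrite grid_ge0//= grid_leT. Qed.

Lemma grid_step n k : (0 < k)%N -> grid T n k - grid T n k.-1 = T / n%:R.
Proof. by case: k => // k _; rewrite /grid /= -natr1; ring. Qed.

Lemma measurable_win_calm i : windows i -> measurable (win_calm i).
Proof.
move=> wi; have [n0 s0 sn] := wi; have /andP[l0 lT] := win_leftI wi.
apply: (measurable_no_jump filF cs adap) => //; last exact: grid_leT.
apply: ltW; apply: grid_lt => //.
by rewrite (@leq_trans i.2) ?leq_addr// ltn_predL.
Qed.

Lemma win_calm_sub n s k x : win_points (n, s, k) -> win_calm (n, s) x ->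
  no_jump (sigma ^~ x) (grid T n s.-1) (grid T n k).
Proof.
move=> /win_pointsP[n0 _ _ ks] nj u /andP[u1 u2]; apply: nj; rewrite u1/= (le_trans u2)//.
by rewrite /grid ler_wpM2r ?invr_ge0// ler_wpM2r ?(ltW T0)// ler_nat.
Qed.

Lemma rate_beta_half : forall n, (0 < n)%N -> n%:R `^ (- 2^-1) <= n%:R `^ (- beta) :> R.
Proof.
move=> n n0; rewrite ler_powR ?ler1n// lerN2.
by case/andP: beta_half.
Qed.

Lemma win_points_gt0 ik : win_points ik -> (0 < ik.1.1)%N.
Proof. by case: ik => [[n s] k] [/windows_gt0]. Qed.

Lemma rate_lag : has_rate P win_points (fun ik => ik.1.1) beta
   (fun ik _ => Num.sqrt (grid T ik.1.1 ik.2 - win_left ik.1)).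
Proof.
apply: (rate_cst P win_points_gt0 (C := Num.sqrt T * C0)) => -[[n s] k] h.
have [/= n0 /andP[k0 kn] sk ks] := win_pointsP h.
rewrite ger0_norm ?sqrtr_ge0// -mulrA; apply: le_trans (ler_wpM2l (sqrtr_ge0 _) (window_length n0)).
rewrite -sqrtrM ?(ltW T0)// ler_wsqrtr// /win_left /grid /= -mulrBl -mulrBl.
rewrite mulrA (mulrC T) ler_wpM2r ?invr_ge0// ler_wpM2r ?(ltW T0)//.
rewrite -natrB ?(ltnW sk)// ler_nat leq_subLR /kbar addn1 addnS.
by rewrite (leq_trans ks)// -addSn leq_add2r leqSpred.
Qed.

(** The drift contributes n^(-1) / sqrt(T/n), of order n^(-1/2), and beta <= 1/2. Dividing the
    martingale estimate by sqrt(T/n) leaves the root of the distance to the left end of the window,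
    of order at most sqrt(kbar/n). *)
Lemma rate_residual :
  has_rate P win_points (fun ik => ik.1.1) beta (fun ik => residual ik.1 ik.2).
Proof.
have hd := mb_drift_increment T0 filF cb adapb mb_b.
have hM := mb_martingale_increment T0 filF wF cs adap itoM fJ sigma_increments.
have gt0 := win_points_gt0.
have mA ik : win_points ik -> measurable (win_calm ik.1).
  by case: ik => [[n s] k] [/measurable_win_calm].
pose drift (ik : nat * nat * nat) x := ik.1.1%:R *
  (\int[lebesgue_measure]_(s in `[0, grid T ik.1.1 ik.2]) b s x -
   \int[lebesgue_measure]_(s in `[0, grid T ik.1.1 ik.2.-1]) b s x).
pose mart (ik : nat * nat * nat) x :=
  (Num.sqrt (T / ik.1.1%:R * (grid T ik.1.1 ik.2 - win_left ik.1)))^-1 *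
      (\1_(NJ (win_left ik.1) (grid T ik.1.1 ik.2)) x *
        (M (grid T ik.1.1 ik.2) x - M (grid T ik.1.1 ik.2.-1) x -
          sigma (win_left ik.1) x *
            (w (grid T ik.1.1 ik.2) x - w (grid T ik.1.1 ik.2.-1) x))).
have mb1 : moments_bounded P win_points drift.
  apply: (mb_reindex (f := fun ik : nat * nat * nat => (ik.1.1, ik.2)) _ hd).
  by move=> [[n s] k] /win_pointsP[].
have mb2 : moments_bounded P win_points mart.
  apply: (mb_reindex (f := fun ik : nat * nat * nat => (ik.1.1, ik.1.2.-1, ik.2)) _ hM).
  by move=> [[n s] k] /win_pointsP[/= n0 /andP[k0 kn] sk ks]; split => //; rewrite sk.
apply: (rate_eq (Z := fun ik x =>
  (Num.sqrt (T / ik.1.1%:R))^-1 / ik.1.1%:R * (\1_(win_calm ik.1) x * drift ik x) +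
  Num.sqrt (grid T ik.1.1 ik.2 - win_left ik.1) * (\1_(win_calm ik.1) x * mart ik x))).
  move=> [[n s] k] x h; have [/= n0 /andP[k0 kn] sk ks] := win_pointsP h.
  rewrite /residual /drift /mart /=; rewrite !indicE.
  have [|_] := boolP (x \in win_calm _); last by rewrite !mul0r !mulr0 addr0.
  rewrite inE => hx; rewrite mem_set; last exact: win_calm_sub hx.
  rewrite /zeta /winc grid_step//.
  have nR : n%:R != 0 :> R by rewrite pnatr_eq0 -lt0n.
  have h0 : 0 < T / n%:R by rewrite divr_gt0// ltr0n.
  have g0 : 0 < grid T n k - win_left (n, s) by rewrite subr_gt0 grid_lt.
  rewrite [Num.sqrt (T / n%:R * _)]sqrtrM ?(ltW h0)//.
  have q0 : Num.sqrt (T / n%:R) != 0 by rewrite gt_eqF// sqrtr_gt0.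
  have q1 : Num.sqrt (grid T n k - win_left (n, s)) != 0 by rewrite gt_eqF// sqrtr_gt0.
  rewrite /win_left /= in q1 *.
  move: (Num.sqrt (T / n%:R)) (Num.sqrt (grid T n k - _)) (n%:R : R) nR q0 q1 => y z v v0 y0 z0.
  by field; rewrite v0 y0 z0.
have half n : (0 < n)%N -> (Num.sqrt (T / n%:R))^-1 / n%:R = (Num.sqrt T)^-1 * n%:R `^ (- 2^-1).
  move=> n0; rewrite sqrtrM ?(ltW T0)// sqrtrV ?ler0n// invfM invrK -mulrA; congr (_ * _).
  rewrite powRN powR12_sqrt ?ler0n//.
  have s0 : Num.sqrt n%:R != 0 :> R by rewrite gt_eqF// sqrtr_gt0 ltr0n.
  by rewrite -[X in _ / X](sqr_sqrtr (ler0n R n)) expr2 invfM mulrA mulfV ?mul1r.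
apply: rate_add.
  apply: (rate_eq (Z := fun ik x => (fun=> (Num.sqrt (T / ik.1.1%:R))^-1 / ik.1.1%:R) x *
     (\1_(win_calm ik.1) x * drift ik x))) => //.
  apply: (rate_mulr0 gt0); last by apply: rate_indic => //; apply/rate0E.
  apply: (rate_cst P gt0 (C := (Num.sqrt T)^-1)) => -[[n s] k] /gt0 /= n0.
  rewrite half// ger0_norm ?mulr_ge0 ?invr_ge0 ?sqrtr_ge0 ?powR_ge0//.
  by rewrite ler_wpM2l ?invr_ge0 ?sqrtr_ge0// rate_beta_half.
apply: (rate_eq (Z := fun ik x => (fun=> Num.sqrt (grid T ik.1.1 ik.2 - win_left ik.1)) x *
     (\1_(win_calm ik.1) x * mart ik x))) => //.
by apply: (rate_mulr0 gt0); [exact: rate_lag|apply: rate_indic => //; apply/rate0E].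
Qed.

(** The perturbation rho_k of the standardized increments; the moments of 1/sigma at the left end
    preserve the rate of the residual. *)
Definition noise (i : nat * nat) (k : nat) (x : Omega) : R :=
  (sigma (win_left i) x)^-1 * residual i k x.

Local Notation N01 := (normal_prob (0 : R) 1).
Local Notation rate := (has_rate P windows (fun i => i.1)).
Local Notation prate := (has_rate P win_points (fun ik => ik.1.1)).

Let wg := windows_gt0.
Let pg := win_points_gt0.

Lemma rate_noise : prate beta (fun ik => noise ik.1 ik.2).
Proof.
apply: (rate_eq (Z := fun ik x => residual ik.1 ik.2 x * (sigma (win_left ik.1) x)^-1)).
  by move=> ik x _; rewrite mulrC.
apply: (rate_mulr0 pg); first exact: rate_residual.
apply/rate0E; apply: (mb_reindex (f := fun ik : nat * nat * nat => win_left ik.1) _ mb_sigmaV).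
by move=> [[n s] k] [/win_leftI].
Qed.

Lemma rate_zeta : prate 0 (fun ik => zeta T w ik.1.1 ik.2).
Proof.
apply/rate0E; apply: (mb_zeta T0 filF wF) => -[[n s] k] /win_pointsP[] //.
Qed.

(** Centered averages have size kbar^(-1/2), which [window_count] converts into n^(-beta). *)
Lemma rate_average (g : nat * nat -> R -> R) C :
  (forall i, measurable_fun setT (g i)) -> 0 <= C ->
  (forall i y, `|g i y| <= C * (1 + y ^+ 2)) ->
  (forall i, (\int[N01]_y (g i y)%:E = 0)%E) ->
  rate beta (fun i x => mean (win i) (fun k => g i (zeta T w i.1 k x))).
Proof.
move=> mg C00 gC g0.
have h := mb_average T0 filF wF (D := windows) (nn := fun i => i.1) (st := fun i => i.2)
  (sz := fun i => kbar (kappa i.1)) (g := g) (C := C).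
apply: (rate_eq (Z := fun i x => (Num.sqrt (kbar (kappa i.1))%:R)^-1 *
   (Num.sqrt (kbar (kappa i.1))%:R * mean (win i) (fun k => g i (zeta T w i.1 k x))))).
  by move=> i x _; rewrite mulKf// gt_eqF// sqrtr_gt0 ltr0n /kbar addn1.
apply: (rate_mulr0 wg).
  apply: (rate_cst P wg (C := C0)) => i /wg n0; rewrite ger0_norm ?invr_ge0 ?sqrtr_ge0//.
  exact: window_count.
apply/rate0E; apply: h => // i [n0 s0 sn]; split => //; first by rewrite /kbar addn1.
by rewrite /kbar addn1 addnS -addSn prednK.
Qed.

Lemma normal_centered (f : R -> R) (m C : R) : measurable_fun setT f -> 0 <= C ->
  (forall y, `|f y| <= C * (1 + y ^+ 2)) -> (\int[N01]_y (f y)%:E = m%:E)%E ->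
  (\int[N01]_y (f y - m)%:E = 0)%E.
Proof.
move=> mf C00 fC fm.
have nid : std_normal N01 (id : measurableTypeR R -> R) by split => // A mA.
have intf := std_normal_comp_integrable nid mf fC C00.
have intm := finite_measure_integrable_cst N01 m.
have e : (\int[N01]_y ((f y)%:E - m%:E) = \int[N01]_y (f y)%:E - \int[N01]_y m%:E)%E :=
  integralB measurableT intf (intm setT measurableT).
under eq_integral do rewrite EFinB.
have em : (\int[N01]_y m%:E = m%:E)%E.
  rewrite integral_cst//; have PT : N01 setT = 1%E by exact: probability_setT.
  exact: (etrans (congr1 (mule m%:E) PT) (mule1 _)).
by rewrite e fm em subee.
Qed.

(** The thresholds may vary with the window because the growth constant 2 is uniform; this admits
    bands whose width depends on n. *)
Lemma rate_band_gap (u : nat * nat -> R) :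
  rate beta (fun i x => band_gap (win i) (fun k => zeta T w i.1 k x) (u i)).
Proof.
have ind01 (A : set R) (y : R) : `|\1_A y| <= 1 :> R.
  by rewrite indicE; case: (_ \in _); rewrite ?normr1 ?normr0.
have nb01 (v : R) : 0 <= normal_band v <= 1.
  rewrite -!lee_fin normal_bandE measure_ge0/=; apply: probability_le1.
  exact: measurable_band.
apply: (rate_average (g := fun i y => \1_(band (u i)) y - normal_band (u i)) (C := 2)) => //.
- move=> i; apply: measurable_funB => //; apply: measurable_indic; exact: measurable_band.
- move=> i y; apply: le_trans (ler_normB _ _) _; have := ind01 (band (u i)) y.
  have /andP[h1 h2] := nb01 (u i); rewrite (ger0_norm h1); have := sqr_ge0 y; lra.
move=> i; apply: (@normal_centered _ _ 1) => //.
- by apply: measurable_indic; exact: measurable_band.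
- by move=> y; rewrite mul1r (le_trans (ind01 _ _))// lerDl sqr_ge0.
by rewrite integral_indic ?setIT ?normal_bandE//; exact: measurable_band.
Qed.

Lemma rate_trimmed_center alpha : 0 <= alpha < 1 ->
  rate beta (fun i x => mean (win i) (fun k =>
    \1_(q_set alpha) (zeta T w i.1 k x) * zeta T w i.1 k x ^+ 2) - q_norm alpha).
Proof.
move=> a01.
have mf : measurable_fun setT (fun y : R => \1_(q_set alpha) y * y ^+ 2).
  by apply: measurable_funM; [apply: measurable_indic; exact: measurable_q_set|exact: measurable_funX].
have fC (y : R) : `|\1_(q_set alpha) y * y ^+ 2| <= 1 + y ^+ 2.
  rewrite indicE; case: (_ \in _); rewrite ?mul1r ?mul0r ?normr0 ?addr_ge0 ?sqr_ge0//.
  by rewrite ger0_norm ?sqr_ge0// lerDr.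
apply: (rate_eq (Z := fun i x => mean (win i) (fun k => (fun _ y =>
    \1_(q_set alpha) y * y ^+ 2 - q_norm alpha) i (zeta T w i.1 k x)))).
  by move=> i x _; rewrite meanB mean_cst ?size_win.
apply: (rate_average (g := fun _ y => \1_(q_set alpha) y * y ^+ 2 - q_norm alpha)
  (C := 1 + `|q_norm alpha|)) => //.
- by move=> i; apply: measurable_funB.
- move=> i y; apply: le_trans (ler_normB _ _) _; rewrite mulrDl mul1r lerD//.
  by rewrite ler_peMr// lerDl sqr_ge0.
- move=> i; apply: (@normal_centered _ _ 1) => //.
    by move=> y; rewrite mul1r.
  exact: q_normE.
Qed.

Lemma mean_scale (W : seq nat) (c : R) (f : nat -> R) : mean W (fun k => c * f k) = c * mean W f.
Proof. by rewrite /mean -mulr_sumr mulrCA. Qed.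

Lemma rate_sqr_perturb gamma : gamma <= beta ->
  rate gamma (fun i x => mean (win i) (fun k =>
    2 * `|zeta T w i.1 k x * noise i k x| + noise i k x ^+ 2)).
Proof.
move=> gb; have /andP[b0 _] := beta_half.
apply: (rate_mean (s := win) (Y := fun i k x => 2 * `|zeta T w i.1 k x * noise i k x| + noise i k x ^+ 2)).
  by move=> i _; exact: size_win.
apply: (rate_add (Y := fun ik x => 2 * `|zeta T w ik.1.1 ik.2 x * noise ik.1 ik.2 x|)
  (Z := fun ik x => noise ik.1 ik.2 x ^+ 2)).
  apply: (rate_weaken pg gb); apply: (rate_mull0 pg (c := fun=> 2) (C := 2)).
    by move=> ik _; rewrite ger0_norm.
  apply: rate_norm; apply: (rate_eq (Z := fun ik x => noise ik.1 ik.2 x * zeta T w ik.1.1 ik.2 x)).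
    by move=> ik x _; rewrite mulrC.
  by apply: (rate_mulr0 pg); [exact: rate_noise|exact: rate_zeta].
apply: (rate_weaken pg (g' := 2%:R * beta)); first by lra.
exact: (rate_exp 2 rate_noise).
Qed.

(** The radius eta is of order n^(-gamma') with gamma' midway between gamma and beta. Then |rho|/eta
    and the quantile defect are of order n^(-delta), and their r-th powers are negligible. *)
Lemma trimmed_dominated alpha gamma : 0 <= alpha < 1 -> 0 <= gamma < beta ->
  exists B1 : nat * nat -> Omega -> R, rate gamma B1 /\ forall i x, windows i ->
    `|mean (win i) (fun k => (kept (win i) (fun k => zeta T w i.1 k x + noise i k x) (1 - alpha) k)%:R
        * (zeta T w i.1 k x + noise i k x) ^+ 2) - q_norm alpha| <= B1 i x.
Proof.
move=> a01 /andP[g0 gb]; have /andP[b0 bh] := beta_half.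
have hq := rate_weaken wg (ltW gb) (rate_norm (rate_trimmed_center a01)).
(* Without trimming [c_norm] is infinite and there is no quantile to compare with; the mean of all
   squares is treated directly. *)
have [alpha0|alpha0] := eqVneq alpha 0.
  exists (fun i x => mean (win i) (fun k =>
      2 * `|zeta T w i.1 k x * noise i k x| + noise i k x ^+ 2) +
    `|mean (win i) (fun k =>
    \1_(q_set alpha) (zeta T w i.1 k x) * zeta T w i.1 k x ^+ 2) - q_norm alpha|); split.
    by apply: rate_add => //; apply: rate_sqr_perturb; exact: ltW.
  move=> i x _; rewrite (_ : 1 - alpha = 1); last by rewrite alpha0 subr0.
  set A := mean _ _; pose B := mean (win i) (fun k => zeta T w i.1 k x ^+ 2).
  rewrite (_ : A - _ = (A - B) + (B - q_norm alpha)); last by ring.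
  apply: le_trans (ler_normD _ _) _; apply: lerD; first exact: full_mean_le.
  rewrite le_eqVlt; apply/orP; left; apply/eqP; congr (`|_ - _|); congr mean.
  by apply/funext => k; rewrite alpha0 q_set0 indicT mul1r.
have [c [c0 cE cB]] : exists c, [/\ 0 < c, c_norm alpha = (c ^+ 2)%:E & normal_band c = 1 - alpha].
  by apply: c_normP; have /andP[a0 ->] := a01; rewrite lt_neqAle eq_sym alpha0 a0.
(* delta = beta - gamma' is the rate left after division by eta, and [r] makes r delta >= 1, which
   exceeds beta. *)
pose delta := (beta - gamma) / 2; pose gamma' := (gamma + beta) / 2.
have dl0 : 0 < delta by rewrite /delta; lra.
have [r hr] : exists r : nat, 1 <= r%:R * delta.
  exists (Num.bound delta^-1); rewrite -ler_pdivrMr// mul1r ltW// archi_boundP// invr_ge0 ltW//.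
(* The factor min(1, c) enforces eta <= 1 and eta <= c for every n >= 1, not only for large n. *)
pose eta0 := Num.min 1 c; have eta00 : 0 < eta0 by rewrite lt_min ltr01.
pose eta (i : nat * nat) := eta0 * i.1%:R `^ (- gamma').
have eta_gt0 i : windows i -> 0 < eta i by move=> /wg n0; rewrite mulr_gt0// powR_gt0 ?ltr0n.
have eta_le i : windows i -> eta i <= eta0.
  move=> /wg n0; rewrite /eta ler_piMr ?(ltW eta00)//; apply: powR_nat_le1 => //.
  by rewrite /gamma'; lra.
have eta01 i : windows i -> 0 < eta i <= 1.
  by move=> wi; rewrite eta_gt0//= (le_trans (eta_le i wi))// ge_min lexx.
have etac i : windows i -> eta i <= c.
  by move=> wi; rewrite (le_trans (eta_le i wi))// ge_min lexx orbT.
have etaV (v : R) : 0 < v -> prate (- gamma') (fun ik _ => (eta ik.1 / v)^-1).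
  move=> v0; apply: (rate_cst P pg (C := v / eta0)) => -[i k] wp; have [wi _] := wp.
  rewrite ger0_norm ?invr_ge0 ?divr_ge0 ?(ltW v0) ?(ltW (eta_gt0 i wi))// /eta /= invfM invrK.
  by rewrite opprK powRN invfM invrK le_eqVlt; apply/orP; left; apply/eqP; ring.
have ratio (v : R) : 0 < v -> prate 1 (fun ik x => (`|noise ik.1 ik.2 x| / (eta ik.1 / v)) ^+ r).
  move=> v0; apply: (rate_weaken pg hr); apply: rate_exp => //.
  rewrite (_ : delta = beta + (- gamma')); last by rewrite /delta /gamma'; lra.
  by apply: (rate_mul pg); [exact: (rate_norm rate_noise)|exact: etaV].
have gap u : rate beta (fun i x => `|band_gap (win i) (fun k => zeta T w i.1 k x) (u i)|).
  exact: (rate_norm (rate_band_gap u)).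
have b1 : beta <= 1 by lra.
have g1 : gamma <= 1 by lra.
have hmean v : 0 < v -> rate 1 (fun i x => mean (win i) (fun k => (`|noise i k x| / (eta i / v)) ^+ r)).
  move=> v0; apply: (rate_mean (s := win) (Y := fun i k x => (`|noise i k x| / (eta i / v)) ^+ r)).
    by move=> i _; exact: size_win.
  exact: ratio.
have nrate0 : prate 0 (fun ik => noise ik.1 ik.2).
  by apply: (rate_weaken pg (ltW b0)); exact: rate_noise.
have hsq Y : prate 0 Y -> prate 0 (fun ik x => Y ik x ^+ 2).
  by move=> hY; rewrite -(mulr0 2%:R); exact: rate_exp.
have h1 : rate gamma (fun i x => mean (win i) (fun k =>
    2 * `|zeta T w i.1 k x * noise i k x| + noise i k x ^+ 2 + (c + 1) ^+ 2 *
    ((`|noise i k x| / eta i) ^+ r +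
      (\1_(band (c + 2 * eta i)) (zeta T w i.1 k x) -
       \1_(band (c - 2 * eta i)) (zeta T w i.1 k x))))).
  apply: (rate_eq (Z := fun i x => mean (win i) (fun k =>
      2 * `|zeta T w i.1 k x * noise i k x| + noise i k x ^+ 2) + (c + 1) ^+ 2 *
      (mean (win i) (fun k => (`|noise i k x| / (eta i / 1)) ^+ r) +
       (band_gap (win i) (fun k => zeta T w i.1 k x) (c + 2 * eta i) +
        - band_gap (win i) (fun k => zeta T w i.1 k x) (c - 2 * eta i) +
        (normal_band (c + 2 * eta i) - normal_band (c - 2 * eta i)))))).
    move=> i x _; rewrite meanD mean_scale [X in _ + _ * X = _]meanD meanB divr1.
    by rewrite /band_gap !meanB !mean_cst ?size_win//; congr (_ + _ * (_ + _)); ring.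
  apply: rate_add; first by apply: rate_sqr_perturb; exact: ltW.
  apply: (rate_mull0 wg (c := fun=> (c + 1) ^+ 2) (C := `|(c + 1) ^+ 2|)) => //.
  apply: rate_add; first by apply: (rate_weaken wg g1); exact: hmean.
  apply: rate_add.
    apply: (rate_weaken wg (ltW gb)); apply: rate_add; first exact: rate_band_gap.
    by apply: rate_opp; exact: rate_band_gap.
  apply: (rate_weaken wg (g' := gamma')); first by rewrite /gamma'; lra.
  (* Here 8 is the Lipschitz constant 2 of [normal_band] times the distance 4 of the two thresholds
     in units of eta. *)
  apply: (rate_cst P wg (C := 8 * eta0)) => i wi.
  apply: le_trans (normal_band_lipschitz _ _) _; rewrite -mulrA -/(eta i).
  rewrite (_ : c + 2 * eta i - (c - 2 * eta i) = 4 * eta i); last by ring.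
  have e4 : 0 <= 4 * eta i by rewrite mulr_ge0// ltW// eta_gt0.
  rewrite (ger0_norm e4); lra.
have hd : rate delta (fun i x => quantile_defect (win i) (fun k => zeta T w i.1 k x)
    (fun k => noise i k x) c (eta i) r).
  pose a : R := normal_pdf 0 1 (c + 1) / 2.
  have a0 : 0 < a by rewrite divr_gt0// normal_pdfE// mulr_gt0 ?normal_peak_gt0// /normal_fun expR_gt0.
  apply: (rate_eq (Z := fun i x =>
    (`|band_gap (win i) (fun k => zeta T w i.1 k x) (c + eta i / 2)| +
     `|band_gap (win i) (fun k => zeta T w i.1 k x) (c - eta i / 2)| +
     mean (win i) (fun k => (`|noise i k x| / (eta i / 2)) ^+ r)) * (fun=> (eta i / a^-1)^-1) x)).
    by move=> i x _; rewrite /quantile_defect -/a invrK (mulrC a).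
  rewrite (_ : delta = beta + (- gamma')); last by rewrite /delta /gamma'; lra.
  apply: (rate_mul wg).
    apply: rate_add; first by apply: rate_add; exact: gap.
    by apply: (rate_weaken wg b1); exact: hmean.
  apply: (rate_cst P wg (C := a^-1 / eta0)) => i wi.
  rewrite ger0_norm ?invr_ge0 ?divr_ge0 ?invr_ge0 ?(ltW a0) ?(ltW (eta_gt0 i wi))// /eta /=.
  by rewrite opprK powRN !invfM !invrK le_eqVlt; apply/orP; left; apply/eqP; ring.
have hm : rate 0 (fun i x => mean (win i) (fun k =>
    (zeta T w i.1 k x + noise i k x) ^+ 2 + zeta T w i.1 k x ^+ 2)).
  apply: (rate_mean (s := win) (Y := fun i k x =>
      (zeta T w i.1 k x + noise i k x) ^+ 2 + zeta T w i.1 k x ^+ 2)).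
    by move=> i _; exact: size_win.
  apply: (rate_add (Y := fun ik x => (zeta T w ik.1.1 ik.2 x + noise ik.1 ik.2 x) ^+ 2)
    (Z := fun ik x => zeta T w ik.1.1 ik.2 x ^+ 2)).
    apply: (hsq (fun ik x => zeta T w ik.1.1 ik.2 x + noise ik.1 ik.2 x)).
    by apply: rate_add => //; exact: rate_zeta.
  by apply: (hsq (fun ik x => zeta T w ik.1.1 ik.2 x)); exact: rate_zeta.
(* The r-th power of the defect has rate r delta >= 1 >= gamma, enough to carry the crude bound on
   the squares, which is only of rate 0. *)
have h2 := rate_weaken wg (le_trans g1 hr) (rate_mulr0 wg (rate_exp r hd) hm).
eexists; split; first exact: rate_add (rate_add h1 h2) hq.
move=> i x wi /=; set A := mean _ _; pose Bm := mean (win i) (fun k =>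
  \1_(q_set alpha) (zeta T w i.1 k x) * zeta T w i.1 k x ^+ 2).
rewrite (_ : A - _ = (A - Bm) + (Bm - q_norm alpha)); last by ring.
apply: le_trans (ler_normD _ _) _; apply: lerD => //.
have := trimmed_mean_le (fun k => zeta T w i.1 k x) (fun k => noise i k x) r
  (size_win i) (eta01 i wi) (etac i wi).
by rewrite /A /Bm (q_set_band c0 cE) cB.
Qed.

Variables (X J : R -> Omega -> R).
Hypothesis XE : {ae P, forall x, forall t : R, 0 <= t <= T ->
  X t x = X 0 x + \int[lebesgue_measure]_(s in `[0, t]) b s x + M t x + J t x}.
Hypothesis JE : {ae P, forall x, forall t : R, 0 <= t <= T -> J t x = jump_part (J ^~ x) t}.
Hypothesis sigma_neq0 : forall t : R, 0 <= t <= T -> {ae P, forall x, sigma t x != 0}.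

(** A vanishing sum of two nonnegative counts forces both to vanish; as sigma has finitely many
    jumps, each of them would be visible in [Jsigma]. *)
Lemma jump_free_calm n s j x : windows (n, s) -> win_start n (kappa n) j = s ->
  jumps_finite T (sigma ^~ x) -> jump_free T J sigma n (kappa n) j x ->
  win_calm (n, s) x /\
  no_jump (J ^~ x) (win_left (n, s)) (grid T n (s + 2 * kappa n)).
Proof.
move=> wi js fx; rewrite /jump_free /= /Nbar /win_itv js => /eqP.
rewrite padde_eq0 ?njumps_ge0// => /andP[/eqP hJ /eqP hs].
have /andP[l0 _] := win_leftI wi; have [n0 s0 sn] := wi.
split.
  apply: (no_jump_of_jump_part fx) => //; first exact: grid_leT.
  by move=> u u12; apply: (njumps_eq0 hs); rewrite /= in_itv.
by move=> u u12; apply: (njumps_eq0 hJ); rewrite /= in_itv.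
Qed.

(** The jump part cancels between t_(k-1) and t_k; what remains inverts the definitions of
    [residual] and [noise], using that sigma is nonzero at the left end. *)
Lemma incr_scaled n s k j x : win_points (n, s, k) -> win_start n (kappa n) j = s ->
  (forall t, 0 <= t <= T ->
    X t x = X 0 x + \int[lebesgue_measure]_(s in `[0, t]) b s x + M t x + J t x) ->
  (forall t, 0 <= t <= T -> J t x = jump_part (J ^~ x) t) ->
  sigma (win_left (n, s)) x != 0 -> win_calm (n, s) x ->
  no_jump (J ^~ x) (win_left (n, s)) (grid T n (s + 2 * kappa n)) ->
  incr T X n k x = Num.sqrt (T / n%:R) *
    (sigma (win_left (n, s)) x * (zeta T w n k x + noise (n, s) k x)).
Proof.
move=> wp js Xx Jx sx cx nJ; have [n0 /andP[k0 kn] sk ks] := win_pointsP wp.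
have kI := win_pointI wp.
have k1I : 0 <= grid T n k.-1 <= T.
  by rewrite grid_ge0//= grid_leT// (leq_trans (leq_pred k)).
have Jc : jump_part (J ^~ x) (grid T n k) = jump_part (J ^~ x) (grid T n k.-1).
  apply: jump_part_const; first by case/andP: k1I.
    by apply/ltW/grid_lt => //; rewrite ltn_predL.
  move=> u /andP[u1 u2]; apply: nJ; apply/andP; split.
    apply: le_lt_trans u1; rewrite /win_left /grid /= ler_wpM2r ?invr_ge0// ler_wpM2r ?(ltW T0)//.
    by rewrite ler_nat -ltnS (prednK k0).
  by apply: le_trans u2 _; rewrite /grid ler_wpM2r ?invr_ge0// ler_wpM2r ?(ltW T0)// ler_nat.
rewrite /incr (Xx _ kI) (Xx _ k1I) (Jx _ kI) (Jx _ k1I) Jc /noise /residual indicE mem_set// mul1r /=.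
have h0 : 0 < Num.sqrt (T / n%:R) by rewrite sqrtr_gt0 divr_gt0// ltr0n.
by field; rewrite sx gt_eqF.
Qed.

(** [G] adds three measurable terms: the error of the trimmed mean, the loss by truncation, and the
    passage from sigma^2 at the left end of the window to sigma^2 at t_k. The domination is almost
    sure, as are the decomposition of X and sigma being nonzero. *)
Lemma LGRV_dominated alpha gamma : 0 <= alpha < 1 -> 0 <= gamma < beta ->
  exists G : nat * nat * nat -> Omega -> R, prate gamma G /\
    forall n s k j, win_points (n, s, k) -> win_start n (kappa n) j = s ->
    {ae P, forall x, `|\1_(jump_free T J sigma n (kappa n) j) x *
      (LGRV T X alpha n (kappa n) j x - sigma (grid T n k) x ^+ 2)| <= `|G (n, s, k) x|}.
Proof.
move=> a01 gb; have [B1 [hB1 B1le]] := trimmed_dominated a01 gb.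
have /andP[g0 gb'] := gb; have /andP[b0 bh] := beta_half.
have q0 := q_norm_gt0 a01; set q := q_norm alpha in q0.
pose Z4 (i : nat * nat) x := mean (win i) (fun k => (zeta T w i.1 k x + noise i k x) ^+ 4).
pose sl (ik : nat * nat * nat) x := sigma (win_left ik.1) x.
pose sk (ik : nat * nat * nat) x := sigma (grid T ik.1.1 ik.2) x.
pose ds (ik : nat * nat * nat) x := (Num.sqrt (grid T ik.1.1 ik.2 - win_left ik.1))^-1 *
  (\1_(NJ (win_left ik.1) (grid T ik.1.1 ik.2)) x * (sk ik x - sl ik x)).
have hsl : prate 0 sl.
  apply/rate0E; apply: (mb_reindex (f := fun ik : nat * nat * nat => win_left ik.1) _ mb_sigma).
  by move=> [[n s] k] [/win_leftI].
have hsk : prate 0 sk.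
  apply/rate0E; apply: (mb_reindex (f := fun ik : nat * nat * nat => grid T ik.1.1 ik.2) _ mb_sigma).
  by move=> [[n s] k] /win_pointI.
have hds : prate 0 ds.
  apply/rate0E; apply: (mb_reindex
    (f := fun ik : nat * nat * nat => (win_left ik.1, grid T ik.1.1 ik.2)) _ sigma_increments).
  move=> [[n s] k] wp; have [n0 /andP[k0 kn] sk' ks] := win_pointsP wp.
  have /andP[_ kT] := win_pointI wp.
  by rewrite /= /win_left /= grid_ge0// kT andbT; split => //; exact: grid_lt.
have nrate0 : prate 0 (fun ik => noise ik.1 ik.2).
  by apply: (rate_weaken pg (ltW b0)); exact: rate_noise.
have exp0 (Y : nat * nat * nat -> Omega -> R) m : prate 0 Y -> prate 0 (fun ik x => Y ik x ^+ m).
  by move=> hY; rewrite -(mulr0 m%:R); exact: rate_exp.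
have lift (Y : nat * nat -> Omega -> R) g : rate g Y -> prate g (fun ik => Y ik.1).
  by move=> hY; apply: (rate_reindex (f := fun ik : nat * nat * nat => ik.1) _ hY) => ik [].
have hZ4 : rate 0 Z4.
  apply: (rate_mean (s := win) (Y := fun i k x => (zeta T w i.1 k x + noise i k x) ^+ 4)).
    by move=> i _; exact: size_win.
  apply: (exp0 (fun ik x => zeta T w ik.1.1 ik.2 x + noise ik.1 ik.2 x)).
  by apply: rate_add => //; exact: rate_zeta.
pose G1 ik x := q^-1 * (B1 ik.1 x * sl ik x ^+ 2).
pose G2 ik x := (T / q) * (((fun=> ik.1.1%:R `^ (- 2^-1)) x) * (sl ik x ^+ 4 * Z4 ik.1 x)).
pose G3 ik x := ((fun=> Num.sqrt (grid T ik.1.1 ik.2 - win_left ik.1)) x) *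
  (`|ds ik x| * (`|sl ik x| + `|sk ik x|)).
exists (fun ik x => G1 ik x + G2 ik x + G3 ik x); split.
  apply: rate_add; [apply: rate_add|].
  - apply: (rate_mull0 pg (c := fun=> q^-1) (C := `|q^-1|)) => //.
    by apply: (rate_mulr0 pg); [exact: lift|exact: exp0].
  - apply: (rate_mull0 pg (c := fun=> T / q) (C := `|T / q|)) => //.
    apply: (rate_weaken pg (g' := 2^-1)); first by lra.
    apply: (rate_mulr0 pg).
      apply: (rate_cst P pg (C := 1)) => ik wp.
      by rewrite mul1r ger0_norm ?powR_ge0.
    by apply: (rate_mulr0 pg); [exact: exp0|exact: lift].
  - apply: (rate_weaken pg (ltW gb')); apply: (rate_mulr0 pg); first exact: rate_lag.
    by apply: (rate_mulr0 pg); [exact: rate_norm|apply: rate_add; exact: rate_norm].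
move=> n s k j wp js; have [wi kW] := wp; have [n0 _ sk' ks] := win_pointsP wp.
have s0 := sigma_neq0 (win_leftI wi).
have hs : {ae P, forall x, jumps_finite T (sigma ^~ x) /\ sigma (win_left (n, s)) x != 0}.
  by apply: filterS2 fJ s0.
apply: filterS3 XE JE hs => x Xx Jx [fx sx].
rewrite indicE; have [|_] := boolP (x \in _); last by rewrite mul0r normr0.
rewrite inE mul1r => jf; have [cx nJ] := jump_free_calm wi js fx jf.
have wE : window n (kappa n) j = win (n, s) by rewrite /window js.
have hz k' : k' \in window n (kappa n) j -> incr T X n k' x = Num.sqrt (T / n%:R) *
    (sigma (win_left (n, s)) x * (zeta T w n k' x + noise (n, s) k' x)).
  by rewrite wE => k'W; apply: incr_scaled js Xx Jx sx cx nJ; split.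
have err := LGRV_error T0 n0 sx q0 hz; rewrite wE in err.
have G1E : sigma (win_left (n, s)) x ^+ 2 / q * B1 (n, s) x = G1 (n, s, k) x.
  by rewrite /G1 /sl /=; ring.
have G2E : sigma (win_left (n, s)) x ^+ 4 * T / q * n%:R `^ (- 2^-1) * Z4 (n, s) x = G2 (n, s, k) x.
  by rewrite /G2 /sl /=; ring.
have third : `|sigma (win_left (n, s)) x ^+ 2 - sigma (grid T n k) x ^+ 2| <= G3 (n, s, k) x.
  have l0 : 0 < Num.sqrt (grid T n k - win_left (n, s)) by rewrite sqrtr_gt0 subr_gt0 grid_lt.
  rewrite /G3 /ds /= indicE mem_set; last exact: win_calm_sub cx.
  rewrite mul1r normrM normfV (gtr0_norm l0) -/(sl (n, s, k) x) -/(sk (n, s, k) x).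
  rewrite -[_^-1 * _ * _]mulrA mulVKf ?gt_eqF// subr_sqr normrM distrC.
  by rewrite ler_wpM2l// ler_normD.
rewrite (_ : _ - _ = (LGRV T X alpha n (kappa n) j x - sigma (win_left (n, s)) x ^+ 2) +
   (sigma (win_left (n, s)) x ^+ 2 - sigma (grid T n k) x ^+ 2)); last by ring.
apply: le_trans (ler_normD _ _) _; apply: le_trans (ler_norm _).
apply: lerD => //; apply: le_trans err _; rewrite -G1E -G2E; apply: lerD => //.
rewrite ler_wpM2l ?divr_ge0 ?sqr_ge0 ?(ltW q0)//.
exact: B1le.
Qed.

End residuals.

(** * From rates to L^p norms *)

Section conclusion.
Context {R : realType} {d : measure_display} {Omega : measurableType d}.

Lemma window_rates (kappa : nat -> nat) (c0 B : R) : 0 < c0 < 1 -> 0 < B ->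
  (forall n, (0 < n)%N -> (2 * kappa n + 1 <= n)%N) ->
  ((fun n : nat => (kappa n)%:R : R^o) ~_\oo (fun n : nat => B * n%:R `^ c0)) ->
  exists C0, forall n, (0 < n)%N ->
    Num.sqrt ((kbar (kappa n))%:R / n%:R) <=
      C0 * n%:R `^ (- Num.min (2^-1 * (1 - c0)) (2^-1 * c0)) /\
    (Num.sqrt (kbar (kappa n))%:R)^-1 <=
      C0 * n%:R `^ (- Num.min (2^-1 * (1 - c0)) (2^-1 * c0)).
Proof.
move=> c01 B0 hk he; have [c1 [c2 [c10 c20 hc]]] := kbar_bounds c01 B0 hk he.
exists (Num.max (Num.sqrt c2) (Num.sqrt c1)^-1) => n n0; have /andP[h1 h2] := hc n n0.
have nR : 0 < n%:R :> R by rewrite ltr0n.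
have n1 : 1 <= n%:R :> R by rewrite ler1n.
have sqrt_pow (y : R) : Num.sqrt (n%:R `^ y) = n%:R `^ (y / 2).
  by rewrite -powR12_sqrt ?powR_ge0// -powRrM.
have p0 y : 0 < n%:R `^ y :> R by rewrite powR_gt0.
split.
  apply: (@le_trans _ _ (Num.sqrt c2 * n%:R `^ ((c0 - 1) / 2))).
    rewrite -sqrt_pow -sqrtrM ?(ltW c20)// ler_wsqrtr// ler_pdivrMr// -mulrA.
    by rewrite -{2}(powRr1 (ltW nR)) -powRD ?subrK//; apply/implyP => _; rewrite gt_eqF.
  rewrite ler_pM ?sqrtr_ge0 ?powR_ge0// ?le_max ?lexx// ler_powR//.
  rewrite lerNr ge_min; apply/orP; left; lra.
apply: (@le_trans _ _ ((Num.sqrt c1)^-1 * n%:R `^ (- (c0 / 2)))).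
  rewrite powRN -sqrt_pow -invfM -sqrtrM ?(ltW c10)// lef_pV2 ?posrE ?sqrtr_gt0//.
  - by rewrite ler_wsqrtr.
  - by rewrite (lt_le_trans _ h1)// mulr_gt0.
  - by rewrite mulr_gt0.
rewrite ler_pM ?invr_ge0 ?sqrtr_ge0 ?powR_ge0// ?le_max ?lexx ?orbT// ler_powR//.
rewrite lerN2 ge_min; apply/orP; right; lra.
Qed.

(** Inversion with value 0 at 0 is not continuous; it is written as the product of x and (x^2)^(-1),
    the latter through a measurable power function. *)
Lemma measurable_inv (f : Omega -> R) : measurable_fun setT f ->
  measurable_fun setT (fun x => (f x)^-1).
Proof.
move=> mf; rewrite (_ : (fun x => _) = (fun x => f x * (f x ^+ 2) `^ (-1))).
  apply: measurable_funM => //.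
  by apply: (measurableT_comp (measurable_powR _)); exact: measurable_funX.
apply/funext => x; rewrite powR_inv1 ?sqr_ge0//.
have [->|f0] := eqVneq (f x) 0; first by rewrite invr0 mul0r.
by rewrite expr2 invfM mulrA divff// mul1r.
Qed.

(** With H = n^g |G| one has H^p <= 1 + H^m as soon as p <= m, so a moment of natural order
    suffices. [f] enters through its almost sure domination only. *)
Lemma Lnorm_rate_bound (P : probability Omega R) (f G : Omega -> R) (n m : nat) (g p C : R) :
  (0 < n)%N -> 1 < p -> p <= m%:R -> 0 <= C ->
  measurable_fun setT (fun x => n%:R `^ g * G x) ->
  (\int[P]_x (`|n%:R `^ g * G x| ^+ m)%:E <= C%:E)%E ->
  {ae P, forall x, `|f x| <= `|G x|} ->
  ('N[P]_p%:E[EFin \o f] <= (n%:R `^ (- g) * (1 + C) `^ p^-1)%:E)%E.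
Proof.
move=> n0 p1 pm C0 mG hC fG; have nR : 0 < n%:R :> R by rewrite ltr0n.
have pp : 0 < p by exact: lt_trans p1.
have nP : 0 < n%:R `^ (- g) :> R by rewrite powR_gt0.
have -> : n%:R `^ (- g) * (1 + C) `^ p^-1 = ((n%:R `^ (- g)) `^ p * (1 + C)) `^ p^-1.
  by rewrite powRM ?powR_ge0 ?addr_ge0// -[in RHS]powRrM mulfV ?gt_eqF// powRr1// powR_ge0.
apply: moment_Lnorm_le => //; first by rewrite mulr_ge0 ?powR_ge0 ?addr_ge0.
pose H x := `|n%:R `^ g * G x|.
have GE x : `|G x| = n%:R `^ (- g) * H x.
  by rewrite /H normrM ger0_norm ?powR_ge0// powRN mulKf// gt_eqF// powR_gt0.
have Hp x : H x `^ p <= 1 + H x ^+ m.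
  have [h|h] := leP (H x) 1.
    apply: (@le_trans _ _ 1); last by rewrite lerDl exprn_ge0 ?normr_ge0.
    have := ge0_ler_powR (ltW pp) (_ : H x \is Num.nneg) (_ : 1 \is Num.nneg) h.
    by rewrite powR1; apply; rewrite nnegrE ?normr_ge0.
  apply: (@le_trans _ _ (H x ^+ m)); last by rewrite lerDr.
  by rewrite -powR_mulrn ?normr_ge0// ler_powR// ltW.
have mH := measurable_normX m mG.
apply: (@le_trans _ _ (\int[P]_x (((n%:R `^ (- g)) `^ p)%:E * (1%:E + (H x ^+ m)%:E)))%E).
  apply: ae_le_integral_measurable => //.
  - by apply: emeasurable_funM => //; exact: emeasurable_funD.
  - by move=> x; rewrite -EFinD -EFinM lee_fin mulr_ge0 ?powR_ge0// addr_ge0// exprn_ge0 ?normr_ge0.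
  apply: filterS fG => x fGx; rewrite -EFinD -EFinM lee_fin.
  apply: (@le_trans _ _ (`|G x| `^ p)).
    by apply: ge0_ler_powR; rewrite ?nnegrE ?normr_ge0 ?(ltW pp).
  by rewrite GE powRM ?powR_ge0 ?normr_ge0// ler_wpM2l ?powR_ge0.
rewrite ge0_integralZl_EFin//; last 2 first.
- by move=> x _; rewrite -EFinD lee_fin addr_ge0// exprn_ge0 ?normr_ge0.
- exact: emeasurable_funD.
rewrite [in leRHS]EFinM; apply: lee_wpmul2l; first by rewrite lee_fin powR_ge0.
rewrite ge0_integralD//; last by move=> x _; rewrite lee_fin exprn_ge0 ?normr_ge0.
rewrite EFinD; apply: leeD => //.
by rewrite integral_cst// mul1e; exact: probability_le1.
Qed.

End conclusion.

Unset Implicit Arguments.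

Theorem theorem3p7 (R : realType) (d : measure_display)
    (Omega : measurableType d) (P : probability Omega R)
    (T : R) (F : R -> set (set Omega))
    (X b sigma w J : R -> Omega -> R)
    (kappa : nat -> nat) (alpha0 c0 B : R) :
  0 < T ->
  filtration T F ->
  ito_semimartingale P T F X b sigma w J ->
  0 <= alpha0 < 1 ->
  (forall p : R, 1 < p ->
     (ereal_sup [set ('N[P]_p%:E[EFin \o sigma t])%E
                | t in `[0%R, T]] < +oo)%E /\
     exists C : R, forall s t : R, 0 <= s <= T -> 0 <= t <= T ->
       ('N[P]_p%:E[EFin \o (fun omega =>
           sigma_tilde sigma t omega - sigma_tilde sigma s omega)%R]
        <= (C * `|t - s| `^ 2^-1)%:E)%E) ->
  (forall p : R, 1 < p ->
     (ereal_sup [set ('N[P]_p%:E[EFin \o b t])%E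
                | t in `[0%R, T]] < +oo)%E) ->
  (forall t : R, 0 <= t <= T -> {ae P, forall omega, sigma t omega != 0}) ->
  (forall p : R, 1 < p ->
     (ereal_sup [set ('N[P]_p%:E[EFin \o (fun omega => (sigma t omega)^-1)%R])%E
                | t in `[0%R, T]] < +oo)%E) ->
  0 < c0 < 1 ->
  0 < B ->
  (forall n : nat, (0 < n)%N -> (2 * kappa n + 1 <= n)%N) ->
  ((fun n : nat => (kappa n)%:R : R^o) ~_\oo (fun n : nat => B * n%:R `^ c0)) ->
  forall p : R, 1 < p ->
  forall gamma : R, gamma < Num.min (2^-1 * (1 - c0)) (2^-1 * c0) ->
  (ereal_sup [set e : \bar R | exists n j k : nat,
     [/\ (0 < n)%N, (1 <= j <= n)%N, (k \in window n (kappa n) j) &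
         e = ((n%:R `^ gamma)%:E *
              'N[P]_p%:E[EFin \o (fun omega =>
                \1_(jump_free T J sigma n (kappa n) j) omega
                 * (LGRV T X alpha0 n (kappa n) j omega
                    - sigma (grid T n k) omega ^+ 2))%R])%E]]
   < +oo)%E.
Proof.
move=> T0 filF [[_ _] [[cb ab] [cs as_]] [_ _ _ JE] [fs _] [wF [M itoM XE]]] a01 hs hb s0 hsV
  c01 B0 hk he p p1 gamma gammaE.
have fJ : {ae P, forall x, jumps_finite T (sigma ^~ x)}.
  by apply: filterS fs => x; exact: njumps_finite.
have toI (Y : R -> Omega -> R) : moments_bounded P `[0, T] Y ->
    moments_bounded P [set t | 0 <= t <= T] Y.
  by apply: (mb_reindex (f := id)) => t tT; rewrite /= in_itv.
have mbb : moments_bounded P [set t | 0 <= t <= T] b.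
  apply: toI; apply: sup_Lnorm_moments_bounded => // t; rewrite /= in_itv.
  exact: (adapted_measurable filF).
have mbs : moments_bounded P [set t | 0 <= t <= T] sigma.
  apply: toI; apply: sup_Lnorm_moments_bounded => [t|q q1]; last by have [] := hs q q1.
  by rewrite /= in_itv; exact: (adapted_measurable filF).
have mbsV : moments_bounded P [set t | 0 <= t <= T] (fun t x => (sigma t x)^-1).
  apply: toI; apply: sup_Lnorm_moments_bounded => // t; rewrite /= in_itv => tT.
  by apply: measurable_inv; exact: (adapted_measurable filF).
have incs := mb_sigma_increment filF cs as_ (fun q q1 => (hs q q1).2).
have [C0 hC0] := window_rates c01 B0 hk he; set beta := Num.min _ _ in hC0 gammaE.
have /andP[c00 c11] := c01.
have beta01 : 0 < beta <= 2^-1.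
  rewrite /beta lt_min ge_min; apply/andP; split; first by apply/andP; split; lra.
  by apply/orP; left; lra.
(* [gamma] may be negative, whereas the domination is stated for nonnegative exponents; since n >=
   1, the rate max(gamma, 0) is sufficient. *)
have g0b : 0 <= Num.max gamma 0 < beta.
  by rewrite le_max lexx orbT gt_max gammaE; case/andP: beta01.
have [G [[mG hG] Gle]] := LGRV_dominated T0 filF wF cs as_ cb ab itoM fJ incs mbb mbs mbsV
  beta01 (fun n n0 => (hC0 n n0).1) (fun n n0 => (hC0 n n0).2) XE JE s0 a01 g0b.
have [m pm] : exists m : nat, p <= m%:R.
  by exists (Num.bound p); rewrite ltW// archi_boundP// ltW// (lt_trans _ p1).
have [C hC] := hG m.
apply: (@le_lt_trans _ _ ((1 + `|C|) `^ p^-1)%:E); last exact: ltry.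
apply: ge_ereal_sup => _ [n [j [k [n0 jn kW ->]]]].
have [sP sn] := win_startP (hk n n0) jn.
have wp : win_points kappa (n, win_start n (kappa n) j, k) by split.
have CC : C <= `|C| := ler_norm C.
have nR : 0 < n%:R :> R by rewrite ltr0n.
have := Lnorm_rate_bound n0 p1 pm (normr_ge0 C) (mG _ wp)
  (le_trans (hC _ wp) (_ : (C%:E <= `|C|%:E)%E)) (Gle n _ k j wp erefl).
rewrite lee_fin => /(_ CC) h.
apply: le_trans (lee_wpmul2l _ h) _; first by rewrite lee_fin powR_ge0.
rewrite -EFinM lee_fin mulrA ler_piMl ?powR_ge0// -powRD; last by apply/implyP => _; rewrite gt_eqF.
by apply: powR_nat_le1 => //; rewrite subr_le0 le_max lexx.
Qed.
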